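(* Let $d\ge 1$ be an integer and $t_1>0$. (i) (Laguerre) Let $\alpha\in\mathbb{R}^d$ with $\alpha_i>-1$ for all $i$, and let $b\in Z=L^2(\mathbb{R}_+^d,\mu_\alpha)$. If $$\langle b,l^\alpha_\nu\rangle_{\mu_\alpha}=\int_{\mathbb{R}_+^d} b(x)\,l^\alpha_\nu(x)\,\mu_\alpha(dx)\neq 0\quad\text{for all }\nu\in\mathbb{N}_0^d,$$ then the controlled Laguerre system $z'=A^{\alpha}z+Bu$, $t>0$, with controls $u\in L^2(0,t_1;l^2)$, is approximately controllable on $[0,t_1]$, but it is not exactly controllable on $[0,t_1]$ (for any $t_1>0$). (ii) (Jacobi) Let $\alpha,\beta\in\mathbb{R}^d$ with $\alpha_i,\beta_i>-1$ for all $i$, and let $b\in W=L^2([-1,1]^d,\mu_{\alpha,\beta})$. If $$\langle b,p^{\alpha,\beta}_\nu\rangle_{\mu_{\alpha,\beta}}=\int_{[-1,1]^d} b(x)\,p^{\alpha,\beta}_\nu(x)\,\mu_{\alpha,\beta}(dx)\neq 0\quad\text{for all }\nu\in\mathbb{N}_0^d,$$ then the controlled Jacobi system $w'=A^{\alpha,\beta}w+\tilde B\tilde u$, $t>0$, with controls $\tilde u\in L^2(0,t_1;l^2)$, is approximately controllable on $[0,t_1]$, but it is not exactly controllable on $[0,t_1]$ (for any $t_1>0$).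
   Context: Notation: $\mathbb{N}_0=\{0,1,2,\dots\}$; for $\nu\in\mathbb{N}_0^d$, $|\nu|=\sum_{i=1}^d\nu_i$. All $L^2$ spaces are complex Hilbert spaces. $l^2$ is the Hilbert space of square-summable complex families $U=\{U_\nu\}_{\nu\in\mathbb{N}_0^d}$ with $\langle U,V\rangle_{l^2}=\sum_{n=0}^\infty\sum_{|\nu|=n}U_\nu\overline{V_\nu}$. $L^2(0,t_1;l^2)$ is the space of square-integrable $l^2$-valued functions on $(0,t_1)$. Laguerre setting. $\mu_\alpha(dx)=\prod_{i=1}^d \frac{x_i^{\alpha_i}e^{-x_i}}{\Gamma(\alpha_i+1)}\,dx$ on $\mathbb{R}_+^d=(0,\infty)^d$. $l^\alpha_\nu$ ($\nu\in\mathbb{N}_0^d$) are the normalized Laguerre polynomials in $d$ variables: $l^\alpha_\nu(x)=\prod_{i=1}^d l^{\alpha_i}_{\nu_i}(x_i)$, where $l^{\alpha_i}_{k}$ is a real scalar multiple, of norm one in $L^2\big((0,\infty),\frac{x^{\alpha_i}e^{-x}}{\Gamma(\alpha_i+1)}dx\big)$, of the classical polynomial $x^{-\alpha_i}e^{x}\frac{d^{k}}{dx^{k}}(x^{k+\alpha_i}e^{-x})$. They form an orthonormal basis of $Z$. Let $P^\alpha_n f=\sum_{|\nu|=n}\langle f,l^\alpha_\nu\rangle_{\mu_\alpha}l^\alpha_\nu$. The operator $A^\alpha$ is the realization in $Z$ of $\sum_{i=1}^d\big[x_i\partial_{x_i}^2+(\alpha_i+1-x_i)\partial_{x_i}\big]$,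 namely $A^\alpha f=\sum_{n=0}^\infty(-n)P^\alpha_n f$ with domain $\{f\in Z:\sum_n n^2\|P^\alpha_n f\|^2<\infty\}$; it generates the semigroup $T^\alpha(t)z=\sum_{n=0}^\infty e^{-nt}P^\alpha_n z$, $t\ge0$. The control operator is $B:l^2\to Z$, $BU=\sum_{n=0}^\infty\sum_{|\nu|=n}U_\nu\langle b,l^\alpha_\nu\rangle_{\mu_\alpha}l^\alpha_\nu$, which is linear and bounded. Jacobi setting. $\mu_{\alpha,\beta}(dx)=\prod_{i=1}^d(1-x_i)^{\alpha_i}(1+x_i)^{\beta_i}\,dx$ on $[-1,1]^d$. $p^{\alpha,\beta}_\nu$ ($\nu\in\mathbb{N}_0^d$) are the normalized Jacobi polynomials in $d$ variables: $p^{\alpha,\beta}_\nu(x)=\prod_{i=1}^d p^{\alpha_i,\beta_i}_{\nu_i}(x_i)$, where $p^{\alpha_i,\beta_i}_k$ is a real scalar multiple, of norm one in $L^2([-1,1],(1-x)^{\alpha_i}(1+x)^{\beta_i}dx)$, of the classical polynomial $(1-x)^{-\alpha_i}(1+x)^{-\beta_i}\frac{d^k}{dx^k}\{(1-x)^{\alpha_i+k}(1+x)^{\beta_i+k}\}$. They form an orthonormal basis of $W$. Let $0=r_0<r_1<r_2<\cdots$ be the increasing enumeration of the set of values $\sum_{i=1}^d\kappa_i(\kappa_i+\alpha_i+\beta_i+1)$, $\kappa\in\mathbb{N}_0^d$; let $A_n^{\alpha,\beta}=\{\kappa\in\mathbb{N}_0^d:\sum_i\kappa_i(\kappa_i+\alpha_i+\beta_i+1)=r_n\}$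 and $P^{\alpha,\beta}_n f=\sum_{\nu\in A_n^{\alpha,\beta}}\langle f,p^{\alpha,\beta}_\nu\rangle_{\mu_{\alpha,\beta}}p^{\alpha,\beta}_\nu$. The operator $A^{\alpha,\beta}$ is the realization in $W$ of $\sum_{i=1}^d\big[(1-x_i^2)\partial_{x_i}^2+(\beta_i-\alpha_i-(\alpha_i+\beta_i+2)x_i)\partial_{x_i}\big]$, namely $A^{\alpha,\beta}f=\sum_{n=0}^\infty(-r_n)P^{\alpha,\beta}_n f$ with domain $\{f\in W:\sum_n r_n^2\|P^{\alpha,\beta}_nf\|^2<\infty\}$; it generates the semigroup $T^{\alpha,\beta}(t)w=\sum_{n=0}^\infty e^{-r_nt}P^{\alpha,\beta}_n w$, $t\ge0$. The control operator is $\tilde B:l^2\to W$, $\tilde BU=\sum_{n=0}^\infty\sum_{|\nu|=n}U_\nu\langle b,p^{\alpha,\beta}_\nu\rangle_{\mu_{\alpha,\beta}}p^{\alpha,\beta}_\nu$, which is linear and bounded. Mild solutions and controllability. Let $(X,T,C)$ be $(Z,T^\alpha,B)$ or $(W,T^{\alpha,\beta},\tilde B)$. For $x_0\in X$ and $u\in L^2(0,t_1;l^2)$ the (mild) solution of the system with initial value $x_0$ is $x(t)=T(t)x_0+\int_0^tT(t-s)Cu(s)\,ds$, $0\le t\le t_1$. The system is exactly controllable on $[0,t_1]$ if for all $x_0,x_1\in X$ there is $u\in L^2(0,t_1;l^2)$ such that the solution with initial value $x_0$ satisfies $x(t_1)=x_1$. It is approximately controllable on $[0,t_1]$ if for all $x_0,x_1\in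 X$ and $\epsilon>0$ there is $u\in L^2(0,t_1;l^2)$ such that the solution with initial value $x_0$ satisfies $\|x(t_1)-x_1\|\le\epsilon$. *)

(* Defs.v *)
From HB Require Import structures.
From mathcomp Require Import all_boot all_order all_algebra.
From mathcomp Require Import all_classical all_reals all_analysis.
From mathcomp Require Import measurable_realfun.
From mathcomp.real_closed Require Import complex.

Set Implicit Arguments.
Unset Strict Implicit.
Unset Printing Implicit Defensive.
Import Order.TTheory GRing.Theory Num.Theory.
Import numFieldNormedType.Exports.

Local Open Scope classical_set_scope.
Local Open Scope ring_scope.
Local Open Scope complex_scope.

(* re-proved: the library's own instance is shadowed by the one for
   subprobabilities, which is declared first for the same key *)
Lemma sigma_finite_prod d1 d2 (T1 : measurableType d1) (T2 : measurableType d2)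
    (R : realType) (mu : {sigma_finite_measure set T1 -> \bar R})
    (nu : {sigma_finite_measure set T2 -> \bar R}) :
  sigma_finite [set: T1 * T2] (mu \x nu)%E.
Proof.
have /sigma_finiteP[F [TF ndF Foo]] := sigma_finiteT mu.
have /sigma_finiteP[G [TG ndG Goo]] := sigma_finiteT nu.
exists (fun n => F n `*` G n).
  rewrite -setXTT TF TG predeqE => -[x y]; split.
    move=> [/= [n _ Fnx] [k _ Gky]]; exists (maxn n k) => //; split.
    - by move: x Fnx; exact/subsetPset/ndF/leq_maxl.
    - by move: y Gky; exact/subsetPset/ndG/leq_maxr.
  by move=> [n _ []/= ? ?]; split; exists n.
move=> k; have [? ?] := Foo k; have [? ?] := Goo k.
split; first exact: measurableX.
by rewrite product_measure1E// lte_mul_pinfty// ge0_fin_numE.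
Qed.

Section cons_measure.
Context d (T : measurableType d) (R : realType) (n : nat).
Variable mu : {sigma_finite_measure set T -> \bar R}.
Variable nu : {sigma_finite_measure set (n.-tuple T) -> \bar R}.

(* the image of [mu \x nu] under the identification T * T^n = T^(n+1) *)
Definition cons_measure (A : set (n.+1.-tuple T)) : \bar R :=
  (mu \x nu)%E [set p : T * n.-tuple T | A [tuple of p.1 :: p.2]].

Let measurable_consp :
  measurable_fun [set: T * n.-tuple T]
    (fun p : T * n.-tuple T => [tuple of p.1 :: p.2]).
Proof. exact: measurable_cons. Qed.

Let cons_measure0 : cons_measure set0 = 0%E.
Proof. exact: measure0. Qed.

Let cons_measure_ge0 A : (0 <= cons_measure A)%E.
Proof. exact: measure_ge0. Qed.

Let cons_measure_semi_sigma_additive : semi_sigma_additive cons_measure.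
Proof.
move=> F mF tF mUF.
pose G i := [set p : T * n.-tuple T | F i [tuple of p.1 :: p.2]].
have mpre A : measurable A ->
    measurable [set p : T * n.-tuple T | A [tuple of p.1 :: p.2]].
  by move=> mA; rewrite -[X in measurable X]setTI; exact: measurable_consp.
apply: (@measure_semi_sigma_additive _ _ _ (mu \x nu)%E G).
- by move=> i; exact: mpre.
- apply/trivIsetP => i j _ _ ij; apply/seteqP; split=> // p [Gi Gj].
  by move/trivIsetP : tF => /(_ i j I I ij) => /seteqP[+ _];
    apply; split; [exact: Gi|exact: Gj].
- by apply: bigcup_measurable => i _; exact: mpre.
Qed.

HB.instance Definition _ := isMeasure.Build _ _ _ cons_measure
  cons_measure0 cons_measure_ge0 cons_measure_semi_sigma_additive.

Let cons_measure_sigma_finite : sigma_finite [set: n.+1.-tuple T] cons_measure.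
Proof.
have [F UF mF] := sigma_finite_prod mu nu.
pose unc (x : n.+1.-tuple T) := (thead x, [tuple of behead x]).
have munc : measurable_fun setT unc.
  apply/measurable_fun_pairP; split; first exact: measurable_tnth.
  exact: measurable_behead.
exists (fun k => unc @^-1` F k).
  by rewrite -preimage_bigcup -UF preimage_setT.
move=> k; have [mFk Fk] := mF k; split.
  by rewrite -[X in measurable X]setTI; exact: munc.
rewrite /cons_measure.
rewrite (_ : [set p : T * n.-tuple T | _] = F k)//; apply/seteqP; split=> -[x s] /=;
  rewrite /unc /thead tnth0 (_ : [tuple of _] = s)//; exact: val_inj.
Qed.

HB.instance Definition _ := Measure_isSigmaFinite.Build _ _ _ cons_measure
  cons_measure_sigma_finite.

End cons_measure.

Fixpoint lebesgue_tuple (R : realType) (d : nat) :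
    {sigma_finite_measure set (d.-tuple (measurableTypeR R)) -> \bar R} :=
  match d with
  | 0 => dirac [tuple]
  | d'.+1 => cons_measure lebesgue_measure (lebesgue_tuple R d')
  end.

Section density_measure.
Context d (T : measurableType d) (R : realType).
Variables (mu : {measure set T -> \bar R}) (w : T -> R).
Hypotheses (mw : measurable_fun [set: T] w) (w0 : forall x, 0 <= w x).

Definition density_measure of measurable_fun [set: T] w & (forall x, 0 <= w x) :=
  fun A : set T => (\int[mu]_(x in A) (w x)%:E)%E.

Local Notation nu := (density_measure mw w0).

Let density_measure0 : nu set0 = 0%E.
Proof. exact: integral_set0. Qed.

Let density_measure_ge0 A : (0 <= nu A)%E.
Proof. by apply: integral_ge0 => x _; rewrite lee_fin. Qed.

Let density_measure_semi_sigma_additive : semi_sigma_additive nu.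
Proof.
move=> F mF tF mUF; rewrite /density_measure ge0_integral_bigcup//.
- by apply: is_cvg_ereal_nneg_natsum_cond => n _ _; exact: density_measure_ge0.
- by apply/measurable_EFinP; exact: measurable_funTS.
- by move=> x _; rewrite lee_fin.
Qed.

HB.instance Definition _ := isMeasure.Build _ _ _ nu
  density_measure0 density_measure_ge0 density_measure_semi_sigma_additive.

End density_measure.

Section L2.
Context d (T : measurableType d) (R : realType).
Variable mu : {measure set T -> \bar R}.
Implicit Types f g : T -> R[i].

(* Elements of the Hilbert space are represented by functions, equality being
   [L2norm mu (f - g) = 0]. *)
Definition L2 : set (T -> R[i]) :=
  [set f : T -> R[i] | @complex.Re R \o f \in Lfun mu 2%:E /\
                      @complex.Im R \o f \in Lfun mu 2%:E].

Definition L2norm f : \bar R :=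
  ('N[mu]_2%:E[EFin \o (@Normc.normc R \o f)])%E.

Definition L2inner f g : R[i] :=
  (\int[mu]_x @complex.Re R (f x * (g x)^*))%R +i*
  (\int[mu]_x @complex.Im R (f x * (g x)^*))%R.

(* [0] when there is no limit; on convergent sequences the value is an
   arbitrary representative of the limit *)
Definition L2lim (F : nat -> T -> R[i]) : T -> R[i] :=
  xget 0 [set f : T -> R[i] | L2 f /\ L2norm (F n - f) @[n --> \oo] --> 0%E].

Definition L2sum (F : nat -> T -> R[i]) : T -> R[i] :=
  L2lim (fun n => \sum_(k < n) F k).

End L2.

Section l2.
Context (R : realType) (d : nat).

Definition multi_index_degree (nu : d.-tuple nat) : nat :=
  \sum_(i < d) tnth nu i.

Definition degree_set (n : nat) : set (d.-tuple nat) :=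
  [set nu | multi_index_degree nu = n].

Definition l2norm (U : d.-tuple nat -> R[i]) : \bar R :=
  ((\sum_(0 <= n <oo) \sum_(nu \in degree_set n)
      (Normc.normc (U nu) ^+ 2)%:E) `^ 2^-1)%E.

Definition l2 : set (d.-tuple nat -> R[i]) := [set U | (l2norm U < +oo)%E].

End l2.

Section bochner.
Context (R : realType) (V : lmodType R[i]).
(* [X] with the (semi)norm [N] is the target Banach space *)
Variables (X : set V) (N : V -> \bar R) (I : set R).

Record bsimple := BSimple {
  bsimple_size : nat ;
  bsimple_set : 'I_bsimple_size -> set R ;
  bsimple_val : 'I_bsimple_size -> V ;
  bsimple_measurable : forall i, measurable (bsimple_set i) ;
  bsimple_subset : forall i, bsimple_set i `<=` I ;
  bsimple_finite : forall i, (lebesgue_measure (bsimple_set i) < +oo)%E ;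
  bsimple_in : forall i, X (bsimple_val i) }.

Definition bsimple_fun (s : bsimple) (x : R) : V :=
  \sum_(i < bsimple_size s) (\1_(bsimple_set i) x : R)%:C *: bsimple_val i.

Definition bsimple_integral (s : bsimple) : V :=
  \sum_(i < bsimple_size s)
    (fine (lebesgue_measure (bsimple_set i)))%:C *: bsimple_val i.

(* The limit is required at every point of [I] rather than almost everywhere;
   every almost-everywhere class of strongly measurable functions has such a
   representative. *)
Definition strongly_measurable (g : R -> V) :=
  (forall x, I x -> X (g x)) /\
  exists s : nat -> bsimple, forall x, I x ->
    N (g x - bsimple_fun (s n) x) @[n --> \oo] --> 0%E.

Definition is_bochner_integral (g : R -> V) (y : V) :=
  [/\ strongly_measurable g, X y & exists s : nat -> bsimple,
    (\int[lebesgue_measure]_(x in I) N (g x - bsimple_fun (s n) x)%R)%E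
      @[n --> \oo] --> 0%E /\
    N (y - bsimple_integral (s n)) @[n --> \oo] --> 0%E].

(* [0] if [g] is not Bochner integrable *)
Definition bochner_integral (g : R -> V) : V :=
  xget 0 [set y | is_bochner_integral g y].

Definition bochner_L2 : set (R -> V) :=
  [set g | strongly_measurable g /\
    (\int[lebesgue_measure]_(x in I) (N (g x) ^+ 2) < +oo)%E].

End bochner.

Section control.
Context d (T : measurableType d) (R : realType) (m : nat).
Variables (mu : {measure set T -> \bar R}).
Variables (S : R -> (T -> R[i]) -> (T -> R[i])).
Variable (C : (m.-tuple nat -> R[i]) -> (T -> R[i])).

Definition control_space (t1 : R) : set (R -> m.-tuple nat -> R[i]) :=
  bochner_L2 (@l2 R m) (@l2norm R m) `]0, t1[%classic.

Definition mild_solution (x0 : T -> R[i]) (u : R -> m.-tuple nat -> R[i])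
    (t : R) : T -> R[i] :=
  S t x0 + bochner_integral (L2 mu) (L2norm mu) `]0, t[%classic
             (fun s => S (t - s) (C (u s))).

Definition exactly_controllable (t1 : R) :=
  forall x0 x1, L2 mu x0 -> L2 mu x1 ->
  exists u, control_space t1 u /\
    L2norm mu (mild_solution x0 u t1 - x1) = 0%E.

Definition approximately_controllable (t1 : R) :=
  forall x0 x1, L2 mu x0 -> L2 mu x1 -> forall e : R, 0 < e ->
  exists u, control_space t1 u /\
    (L2norm mu (mild_solution x0 u t1 - x1)%R <= e%:E)%E.

End control.

Section diagonal.
Context d (T : measurableType d) (R : realType) (m : nat).
Variables (mu : {measure set T -> \bar R}) (phi : m.-tuple nat -> T -> R[i]).

(* the sets [E n] are finite in both applications below *)
Definition spectral_proj (E : nat -> set (m.-tuple nat)) (n : nat)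
    (f : T -> R[i]) : T -> R[i] :=
  \sum_(nu \in E n) L2inner mu f (phi nu) *: phi nu.

Definition spectral_semigroup (E : nat -> set (m.-tuple nat)) (lam : nat -> R)
    (t : R) (f : T -> R[i]) : T -> R[i] :=
  L2sum mu (fun n => (expR (- lam n * t))%:C *: spectral_proj E n f).

Definition control_operator (b : T -> R[i]) (U : m.-tuple nat -> R[i]) :
    T -> R[i] :=
  L2sum mu (fun n => \sum_(nu \in @degree_set m n)
    (U nu * L2inner mu b (phi nu)) *: phi nu).

End diagonal.

Definition product_poly (R : realType) d (p : 'I_d -> nat -> {poly R})
    (nu : d.-tuple nat) (x : d.-tuple R) : R[i] :=
  (\prod_(i < d) (p i (tnth nu i)).[tnth x i])%:C.

Lemma measurable_prod_tnth (R : realType) d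
    (w : 'I_d -> measurableTypeR R -> R) :
  (forall i, measurable_fun [set: measurableTypeR R] (w i)) ->
  measurable_fun [set: d.-tuple (measurableTypeR R)]
    (fun x => \prod_(i < d) w i (tnth x i)).
Proof.
move=> mw; apply: measurable_prod => i _.
exact: (measurableT_comp (mw i) (measurable_tnth i)).
Qed.

Section laguerre.
Context (R : realType).

Definition Gamma (s : R) : R :=
  (\int[lebesgue_measure]_(x in `]0, +oo[) (x `^ (s - 1) * expR (- x)))%R.

Definition laguerre_weight1 (a : R) : measurableTypeR R -> R :=
  fun x => \1_(`]0, +oo[%classic) x * (x `^ a * expR (- x) / Gamma (a + 1)).

Lemma measurable_laguerre_weight1 a :
  measurable_fun [set: measurableTypeR R] (laguerre_weight1 a).
Proof.
apply: measurable_funM; first by apply: measurable_indic; exact: measurable_itv.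
apply: measurable_funM => //; apply: measurable_funM => //.
by apply: measurableT_comp => //; exact: oppr_measurable.
Qed.

Lemma Gamma_ge0 s : 0 <= Gamma s.
Proof.
by apply: Rintegral_ge0 => x _; rewrite mulr_ge0 ?powR_ge0 ?expR_ge0.
Qed.

Lemma laguerre_weight1_ge0 a x : 0 <= laguerre_weight1 a x.
Proof.
by rewrite !mulr_ge0 ?powR_ge0 ?expR_ge0// invr_ge0 Gamma_ge0.
Qed.

(* [p] is a real scalar multiple, of norm one, of the polynomial given by the
   Rodrigues formula x^(-a) e^x (d/dx)^k (x^(k+a) e^(-x)) *)
Definition normalized_laguerre (a : R) (k : nat) (p : {poly R}) :=
  (exists c : R, forall x : R, 0 < x ->
     p.[x] = c * (x `^ (- a) * expR x *
       derive1n k (fun y => y `^ (k%:R + a) * expR (- y)) x)) /\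
  (\int[lebesgue_measure]_x (p.[x] ^+ 2 * laguerre_weight1 a x)%:E)%E = 1%E.

Context (d : nat) (alpha : d.-tuple R).

Definition laguerre_weight (x : d.-tuple (measurableTypeR R)) : R :=
  \prod_(i < d) laguerre_weight1 (tnth alpha i) (tnth x i).

Lemma measurable_laguerre_weight : measurable_fun setT laguerre_weight.
Proof.
by apply: (@measurable_prod_tnth R d (fun i => laguerre_weight1 (tnth alpha i)))
  => i; exact: measurable_laguerre_weight1.
Qed.

Lemma laguerre_weight_ge0 x : 0 <= laguerre_weight x.
Proof. by apply: prodr_ge0 => i _; exact: laguerre_weight1_ge0. Qed.

(* mu_alpha, as a measure on R^d that does not charge the complement of
   (0, oo)^d *)
Definition laguerre_measure :
    {measure set (d.-tuple (measurableTypeR R)) -> \bar R} :=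
  density_measure (lebesgue_tuple R d)
    measurable_laguerre_weight laguerre_weight_ge0.

Variable l : 'I_d -> nat -> {poly R}.

Definition laguerre_semigroup :=
  spectral_semigroup laguerre_measure (product_poly l)
    (@degree_set d) (fun n => n%:R).

Definition laguerre_control (b : d.-tuple (measurableTypeR R) -> R[i]) :=
  control_operator laguerre_measure (product_poly l) b.

End laguerre.

Section jacobi.
Context (R : realType).

Definition jacobi_weight1 (a b : R) : measurableTypeR R -> R :=
  fun x => \1_(`[-1, 1]%classic) x * ((1 - x) `^ a * (1 + x) `^ b).

Lemma measurable_jacobi_weight1 a b :
  measurable_fun [set: measurableTypeR R] (jacobi_weight1 a b).
Proof.
apply: measurable_funM; first by apply: measurable_indic; exact: measurable_itv.
apply: measurable_funM.
  apply: (measurableT_comp (measurable_powR a)).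
  exact: measurable_funB.
apply: (measurableT_comp (measurable_powR b)).
exact: measurable_funD.
Qed.

Lemma jacobi_weight1_ge0 a b x : 0 <= jacobi_weight1 a b x.
Proof. by rewrite !mulr_ge0 ?powR_ge0. Qed.

(* [p] is a real scalar multiple, of norm one, of the polynomial given by the
   Rodrigues formula
   (1-x)^(-a) (1+x)^(-b) (d/dx)^k ((1-x)^(a+k) (1+x)^(b+k)) *)
Definition normalized_jacobi (a b : R) (k : nat) (p : {poly R}) :=
  (exists c : R, forall x : R, -1 < x < 1 ->
     p.[x] = c * ((1 - x) `^ (- a) * (1 + x) `^ (- b) *
       derive1n k (fun y => (1 - y) `^ (a + k%:R) * (1 + y) `^ (b + k%:R)) x)) /\
  (\int[lebesgue_measure]_x (p.[x] ^+ 2 * jacobi_weight1 a b x)%:E)%E = 1%E.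

Context (d : nat) (alpha beta : d.-tuple R).

Definition jacobi_weight (x : d.-tuple (measurableTypeR R)) : R :=
  \prod_(i < d) jacobi_weight1 (tnth alpha i) (tnth beta i) (tnth x i).

Lemma measurable_jacobi_weight : measurable_fun setT jacobi_weight.
Proof.
apply: (@measurable_prod_tnth R d
  (fun i => jacobi_weight1 (tnth alpha i) (tnth beta i))) => i.
exact: measurable_jacobi_weight1.
Qed.

Lemma jacobi_weight_ge0 x : 0 <= jacobi_weight x.
Proof. by apply: prodr_ge0 => i _; exact: jacobi_weight1_ge0. Qed.

(* mu_{alpha, beta}, as a measure on R^d that does not charge the complement
   of [-1, 1]^d *)
Definition jacobi_measure :
    {measure set (d.-tuple (measurableTypeR R)) -> \bar R} :=
  density_measure (lebesgue_tuple R d)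
    measurable_jacobi_weight jacobi_weight_ge0.

Definition jacobi_eigenvalue (kappa : d.-tuple nat) : R :=
  \sum_(i < d) (tnth kappa i)%:R *
    ((tnth kappa i)%:R + tnth alpha i + tnth beta i + 1).

(* the increasing enumeration r_0 = 0 < r_1 < ... of the eigenvalues: each
   term is followed by the least eigenvalue above it *)
Fixpoint jacobi_rate (n : nat) : R :=
  match n with
  | 0 => 0
  | n'.+1 => inf [set r | range jacobi_eigenvalue r /\ jacobi_rate n' < r]
  end.

Definition jacobi_index_set (n : nat) : set (d.-tuple nat) :=
  [set kappa | jacobi_eigenvalue kappa = jacobi_rate n].

Variable p : 'I_d -> nat -> {poly R}.

Definition jacobi_semigroup :=
  spectral_semigroup jacobi_measure (product_poly p)
    jacobi_index_set jacobi_rate.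

Definition jacobi_control (b : d.-tuple (measurableTypeR R) -> R[i]) :=
  control_operator jacobi_measure (product_poly p) b.

End jacobi.

(* Main.v *)
(* The coefficients along the basis decouple: writing r for the decay rate at
   an index and b for the corresponding coefficient of the given function, the
   coefficient of x(t1) - T(t1) x0 is b times the integral over (0, t1) of
   e^(-r (t1 - s)) u(s).  A target with finitely many coefficients y is reached
   by u(s) = e^(r (t1 - s)) y / (t1 b), which makes the integrand T(t1 - s) C u(s)
   of the mild solution constant; such targets are dense.  Steering 0 to the
   given function itself would require each of these integrals without the
   factor b to be 1, so, by Cauchy-Schwarz, each component of u would have
   squared norm at least 1/t1, and u would not be square-integrable.

   That the products of the polynomials are an orthonormal basis is proved from
   the Rodrigues formulas.  Orthogonality is repeated integration by parts.  For
   completeness, the indicator of a ray is the bounded limit of (1 - y^n)^(2^n),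
   which tends to 1 for 0 <= y < 1/2 and to 0 for 1/2 < y <= 1, where y is an
   affine function of x (Jacobi) or of e^(-x/8) (Laguerre); tensor products and
   a Dynkin argument then give the indicators of all Borel sets of R^d. *)

Require Import Defs.
From mathcomp Require Import all_boot all_order all_algebra.
From mathcomp Require Import all_classical all_reals all_analysis.
From mathcomp Require Import measurable_realfun.
From mathcomp.real_closed Require Import complex.
From mathcomp Require Import finmap ring lra.

Set Implicit Arguments.
Unset Strict Implicit.
Unset Printing Implicit Defensive.
Import Order.TTheory GRing.Theory Num.Theory.
Import numFieldNormedType.Exports.

Local Open Scope classical_set_scope.
Local Open Scope ring_scope.

(** * Square-integrable functions *)

(** The two halves of the theorem avoid it differently. For approximate controllability every series
    under the integral has finitely many nonzero terms, and of T(t1) x0 only membership in L2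
    matters. For the failure of exact controllability an upper bound on coefficients is enough: a
    series that falls back on [0] multiplies its coefficients by 0, a convergent one by 1, and
    either factor lies in [0, 1]. Equality of vectors means seminorm zero, so vectors are compared
    through their coefficients, which determine them because finite combinations of the basis are
    dense. Integrability of the weights, and for Laguerre positivity of the Gamma factor, is not
    computed: it is forced by the norm-one condition on the polynomial of index 0. *)

Section square_integrable.
Local Open Scope complex_scope.
Context d (T : measurableType d) (R : realType).
Variable mu : {measure set T -> \bar R}.
Implicit Types f g h : T -> R[i].

(** Only the real part of the inner product. It is symmetric and real-bilinear, and [L2innerE]
    recovers the imaginary part from it, so Cauchy-Schwarz, continuity and the Bochner functionals
    are all treated over the reals. *)
Definition rinner f g : R := (\int[mu]_x complex.Re (f x * (g x)^*))%R.

Definition rnorm f : R := Num.sqrt (rinner f f).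

Lemma ReM (a b : R[i]) :
  complex.Re (a * b) = complex.Re a * complex.Re b - complex.Im a * complex.Im b.
Proof. by case: a; case: b. Qed.

Lemma ImM (a b : R[i]) :
  complex.Im (a * b) = complex.Re a * complex.Im b + complex.Im a * complex.Re b.
Proof. by case: a; case: b. Qed.

Lemma Re_mul_conj (a b : R[i]) : complex.Re (a * b^*) =
  complex.Re a * complex.Re b + complex.Im a * complex.Im b.
Proof. by case: a; case: b => ? ? ? ? /=; rewrite mulrN opprK. Qed.

Lemma L2lin c f g : L2 mu f -> L2 mu g -> L2 mu (c *: f + g).
Proof.
have [|_ lin] := @Lfun_submod_closed _ T R mu 2%:E; first by rewrite lee_fin ler1n.
move=> [f1 f2] [g1 g2]; split.
- rewrite (_ : _ \o _ = complex.Re c *: (@complex.Re R \o f) +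
     (- complex.Im c *: (@complex.Im R \o f) + (@complex.Re R \o g))); first exact/lin/lin.
  apply/funext => x /=; rewrite raddfD/= -[(c *: f) x]/(c * f x) ReM addrA.
  by congr (_ + _ + _); rewrite -[RHS]/(- complex.Im c * _) mulNr.
- rewrite (_ : _ \o _ = complex.Im c *: (@complex.Re R \o f) +
     (complex.Re c *: (@complex.Im R \o f) + (@complex.Im R \o g))); first exact/lin/lin.
  apply/funext => x /=; rewrite raddfD/= -[(c *: f) x]/(c * f x) addrA.
  by congr (_ + _); rewrite ImM addrC.
Qed.

Lemma L20 : L2 mu 0.
Proof.
have [|lin0 _] := @Lfun_submod_closed _ T R mu 2%:E; first by rewrite lee_fin ler1n.
by split; rewrite (_ : _ \o _ = 0).
Qed.

Lemma L2D f g : L2 mu f -> L2 mu g -> L2 mu (f + g).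
Proof. by move=> Lf; rewrite -[f]scale1r; exact: L2lin. Qed.

Lemma L2Z c f : L2 mu f -> L2 mu (c *: f).
Proof. by move=> Lf; rewrite -[c *: f]addr0; apply: L2lin => //; exact: L20. Qed.

Lemma L2N f : L2 mu f -> L2 mu (- f).
Proof. by rewrite -scaleN1r; exact: L2Z. Qed.

Lemma L2B f g : L2 mu f -> L2 mu g -> L2 mu (f - g).
Proof. by move=> *; apply: L2D => //; exact: L2N. Qed.

Lemma L2_sum I (r : seq I) (F : I -> T -> R[i]) :
  (forall i, L2 mu (F i)) -> L2 mu (\sum_(i <- r) F i).
Proof. by move=> LF; elim/big_ind : _ => //; [exact: L20|exact: L2D]. Qed.

Lemma L2_integrable f g : L2 mu f -> L2 mu g ->
  mu.-integrable setT (EFin \o (fun x => complex.Re (f x * (g x)^*))).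
Proof.
move=> [f1 f2] [g1 g2].
rewrite (_ : EFin \o _ = (EFin \o ((@complex.Re R \o f) \* (@complex.Re R \o g))) \+
  (EFin \o ((@complex.Im R \o f) \* (@complex.Im R \o g)))); last first.
  by apply/funext => x /=; rewrite Re_mul_conj.
apply: integrableD => //; apply/Lfun1_integrable; exact: Lfun2_mul_Lfun1.
Qed.

Lemma rinnerD f g h : L2 mu f -> L2 mu g -> L2 mu h ->
  rinner (f + g) h = rinner f h + rinner g h.
Proof.
move=> Lf Lg Lh; rewrite /rinner -RintegralD//; try exact: L2_integrable.
by apply: eq_Rintegral => x _ /=; rewrite mulrDl raddfD.
Qed.

Lemma rinnerZ (r : R) f h : L2 mu f -> L2 mu h ->
  rinner (r%:C *: f) h = r * rinner f h.
Proof.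
move=> Lf Lh; rewrite /rinner -RintegralZl//; last exact: L2_integrable.
apply: eq_Rintegral => x _ /=.
rewrite -[(_ *: f) x]/(_ * f x) !Re_mul_conj ReM ImM /=; ring.
Qed.

Lemma rinnerC f g : rinner f g = rinner g f.
Proof.
by apply: eq_Rintegral => x _ /=; rewrite !Re_mul_conj mulrC [X in _ + X]mulrC.
Qed.

Lemma rinner0 h : rinner 0 h = 0.
Proof.
rewrite /rinner (_ : (fun=> _) = cst 0) ?Rintegral_cst ?mul0r//.
by apply/funext => x /=; rewrite mul0r.
Qed.

Lemma rinnerN f h : L2 mu f -> L2 mu h -> rinner (- f) h = - rinner f h.
Proof.
by move=> Lf Lh; rewrite -scaleN1r -[-1 in LHS](rmorphN1 (real_complex R)) rinnerZ// mulN1r.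
Qed.

Lemma rinnerB f g h : L2 mu f -> L2 mu g -> L2 mu h ->
  rinner (f - g) h = rinner f h - rinner g h.
Proof. by move=> *; rewrite rinnerD ?rinnerN//; exact: L2N. Qed.

Lemma rinner_ge0 f : 0 <= rinner f f.
Proof.
by apply: Rintegral_ge0 => x _; rewrite Re_mul_conj -!expr2 addr_ge0 ?sqr_ge0.
Qed.

Lemma rnorm_ge0 f : 0 <= rnorm f. Proof. exact: sqrtr_ge0. Qed.

Lemma sqr_rnorm f : rnorm f ^+ 2 = rinner f f.
Proof. by rewrite sqr_sqrtr ?rinner_ge0. Qed.

Lemma rinner_sqrD f g (t : R) : L2 mu f -> L2 mu g ->
  rinner (f + t%:C *: g) (f + t%:C *: g) =
  rinner f f + 2 * t * rinner f g + t ^+ 2 * rinner g g.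
Proof.
move=> Lf Lg; have LZ := L2Z t%:C Lg; have LD := L2D Lf LZ.
rewrite rinnerD// (rinnerC f) rinnerD// rinnerZ// (rinnerZ t Lg LD).
rewrite (rinnerC g (f + _)) rinnerD// rinnerZ// (rinnerC g f).
by ring.
Qed.

(** The quadratic |f + t g|^2 in t is nonnegative; Cauchy-Schwarz is read off at one well-chosen
    t. *)
Lemma ler_rinner_norm f g : L2 mu f -> L2 mu g ->
  `|rinner f g| <= rnorm f * rnorm g.
Proof.
move=> Lf Lg; rewrite -(@ler_pXn2r _ 2)// ?nnegrE ?mulr_ge0 ?rnorm_ge0//.
rewrite exprMn !sqr_rnorm real_normK ?num_real//.
have key t : 0 <= rinner f f + 2 * t * rinner f g + t ^+ 2 * rinner g g.
  by rewrite -rinner_sqrD// rinner_ge0.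
set A := rinner f f in key *; set B := rinner f g in key *.
set C := rinner g g in key *.
have C0 : 0 <= C := rinner_ge0 g.
have [C_eq0|C_neq0] := eqVneq C 0.
  have [->|B0] := eqVneq B 0; first by rewrite expr0n/= mulr_ge0// rinner_ge0.
  (* With C = 0 the quadratic is affine in t, and this t would give it the value -1. *)
  have := key (- (A + 1) / (2 * B)).
  rewrite C_eq0 mulr0 addr0 (_ : 2 * _ * B = - (A + 1)); last by field.
  lra.
(* The minimiser of the quadratic. *)
have := key (- B / C).
rewrite (_ : _ + _ + _ = (A * C - B ^+ 2) / C); last by field.
by rewrite pmulr_lge0 ?invr_gt0 ?subr_ge0// lt_def C_neq0.
Qed.

Lemma rnormZ (c : R[i]) f : L2 mu f -> rnorm (c *: f) = Normc.normc c * rnorm f.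
Proof.
move=> Lf; rewrite /rnorm.
have -> : rinner (c *: f) (c *: f) = Normc.normc c ^+ 2 * rinner f f.
  rewrite /rinner -RintegralZl//; last exact: L2_integrable.
  apply: eq_Rintegral => x _ /=; rewrite -[(c *: f) x]/(c * f x) !Re_mul_conj/=.
  case: c; case: (f x) => a b u v /=; rewrite sqr_sqrtr ?addr_ge0 ?sqr_ge0//.
  by ring.
by rewrite sqrtrM ?sqr_ge0// sqrtr_sqr ger0_norm//; case: c => *; exact: sqrtr_ge0.
Qed.

Lemma rnormN f : L2 mu f -> rnorm (- f) = rnorm f.
Proof.
move=> Lf; rewrite -scaleN1r rnormZ//= ?oppr0 /Normc.normc/= ?oppr0 expr0n/= addr0 sqrrN.
by rewrite expr1n sqrtr1 mul1r.
Qed.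

Lemma ler_rnormD f g : L2 mu f -> L2 mu g -> rnorm (f + g) <= rnorm f + rnorm g.
Proof.
move=> Lf Lg; rewrite -(@ler_pXn2r _ 2)// ?nnegrE ?addr_ge0 ?rnorm_ge0//.
have := rinner_sqrD 1 Lf Lg; rewrite rmorph1 scale1r expr1n mulr1 mul1r.
rewrite sqr_rnorm sqrrD !sqr_rnorm => ->.
have := ler_rinner_norm Lf Lg; have := ler_norm (rinner f g); lra.
Qed.

Lemma rnorm_distC f g : L2 mu f -> L2 mu g -> rnorm (f - g) = rnorm (g - f).
Proof. by move=> Lf Lg; rewrite -opprB rnormN//; exact: L2B. Qed.

Lemma L2normE f : L2 mu f -> L2norm mu f = (rnorm f)%:E.
Proof.
move=> Lf; rewrite /L2norm unlock.
have -> : (\int[mu]_x `|(EFin \o (@Normc.normc R \o f)) x| `^ 2)%E =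
    (rinner f f)%:E.
  rewrite /rinner /Rintegral fineK; last first.
    by apply: integrable_fin_num => //; exact: L2_integrable.
  apply: eq_integral => x _ /=; rewrite Re_mul_conj.
  rewrite ger0_norm; last by case: (f x) => *; exact: sqrtr_ge0.
  rewrite powR_mulrn; last by case: (f x) => *; exact: sqrtr_ge0.
  by case: (f x) => a b/=; rewrite sqr_sqrtr ?addr_ge0 ?sqr_ge0.
by rewrite poweR_EFin powR12_sqrt ?rinner_ge0.
Qed.

(** The imaginary part of z is the real part of -i z, and conjugating i g produces that factor
    -i. *)
Lemma L2innerE f g : L2inner mu f g = rinner f g +i* rinner f ('i *: g).
Proof.
rewrite /L2inner; congr (_ +i* _); apply: eq_Rintegral => x _ /=.
rewrite -[('i *: g) x]/('i * g x).
by case: (f x); case: (g x) => * /=; ring.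
Qed.

End square_integrable.

(** * Complex inner product and limits in L2 *)

Section inner_product.
Local Open Scope complex_scope.
Context d (T : measurableType d) (R : realType).
Variable mu : {measure set T -> \bar R}.
Implicit Types f g h : T -> R[i].
Local Notation L2 := (L2 mu).
Local Notation inner := (L2inner mu).

Lemma L2innerD f g h : L2 f -> L2 g -> L2 h ->
  inner (f + g) h = inner f h + inner g h.
Proof.
move=> Lf Lg Lh; have Lih := L2Z 'i Lh.
by rewrite !L2innerE !rinnerD.
Qed.

Lemma L2innerZ c f h : L2 f -> L2 h -> inner (c *: f) h = c * inner f h.
Proof.
move=> Lf Lh; have Lih := L2Z 'i Lh; have Lif := L2Z 'i Lf.
have cE : c *: f = (complex.Re c)%:C *: f + (complex.Im c)%:C *: ('i *: f).
  by rewrite scalerA -scalerDl; congr (_ *: _); case: c => a b; simpc.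
have iE : rinner mu ('i *: f) h = - rinner mu f ('i *: h).
  rewrite -rinnerN// /rinner; apply: eq_Rintegral => x _.
  rewrite -[(- f) x]/(- f x) -[('i *: f) x]/('i * f x) -[('i *: h) x]/('i * h x).
  by rewrite !Re_mul_conj/=; case: (f x); case: (h x) => * /=; ring.
have iiE : rinner mu ('i *: f) ('i *: h) = rinner mu f h.
  apply: eq_Rintegral => x _.
  rewrite -[('i *: f) x]/('i * f x) -[('i *: h) x]/('i * h x).
  by rewrite !Re_mul_conj/=; case: (f x); case: (h x) => * /=; ring.
rewrite !L2innerE cE !rinnerD ?rinnerZ//; try exact: L2Z.
by rewrite iE iiE; case: c {cE} => a b; simpc; congr (_ +i* _); ring.
Qed.

Lemma L2inner0 h : inner 0 h = 0.
Proof. by rewrite L2innerE !rinner0. Qed.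

Lemma L2innerB f g h : L2 f -> L2 g -> L2 h ->
  inner (f - g) h = inner f h - inner g h.
Proof.
move=> Lf Lg Lh; rewrite L2innerD//; last exact: L2N.
by rewrite -scaleN1r L2innerZ// mulN1r.
Qed.

Lemma L2inner_sum I (r : seq I) (F : I -> T -> R[i]) h :
  (forall i, L2 (F i)) -> L2 h ->
  inner (\sum_(i <- r) F i) h = \sum_(i <- r) inner (F i) h.
Proof.
move=> LF Lh; elim: r => [|i r IH]; first by rewrite !big_nil L2inner0.
by rewrite !big_cons L2innerD ?IH//; exact: L2_sum.
Qed.

(** Equality in the space is equality up to seminorm zero; by Cauchy-Schwarz it still gives equal
    coefficients. *)
Lemma rnorm0_inner f h : L2 f -> L2 h -> rnorm mu f = 0 -> inner f h = 0.
Proof.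
move=> Lf Lh f0; have Lih := L2Z 'i Lh.
have rinner_eq0 g : L2 g -> rinner mu f g = 0.
  move=> Lg; apply/eqP; rewrite -normr_le0 (le_trans (ler_rinner_norm Lf Lg))//.
  by rewrite f0 mul0r.
by rewrite L2innerE !rinner_eq0.
Qed.

(** Coefficients of the partial sums of an orthogonal series are eventually constant, so continuity
    of the inner product is only stated for a constant value [c] from [N] on. *)
Lemma L2inner_limit (F : nat -> T -> R[i]) f h c N :
  (forall n, L2 (F n)) -> L2 f -> L2 h -> rnorm mu (F n - f) @[n --> \oo] --> 0 ->
  (forall n, (N <= n)%N -> inner (F n) h = c) -> inner f h = c.
Proof.
move=> LF Lf Lh cF FN; have Lih := L2Z 'i Lh.
have rinner_lim g r : L2 g -> (forall n, (N <= n)%N -> rinner mu (F n) g = r) ->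
    rinner mu f g = r.
  move=> Lg Fr; apply/eqP; rewrite -subr_eq0 -normr_le0.
  have cF0 : rnorm mu (F n - f) * rnorm mu g @[n --> \oo] --> 0.
    by rewrite -[X in _ --> X](mul0r (rnorm mu g)); apply: cvgM => //; exact: cvg_cst.
  rewrite -(cvg_lim _ cF0)//; apply: limr_ge; first by apply/cvg_ex; exists 0.
  exists N => // n /= Nn; rewrite -(Fr n Nn) -[X in X <= _]normrN opprB.
  rewrite -rinnerB//; exact/ler_rinner_norm/Lg/L2B.
rewrite L2innerE; rewrite (@rinner_lim _ (complex.Re c))//; last first.
  by move=> n /FN; rewrite L2innerE => <-.
rewrite (@rinner_lim _ (complex.Im c))//; first by case: c {FN}.
by move=> n /FN; rewrite L2innerE => <-.
Qed.

Lemma L2_L2lim (F : nat -> T -> R[i]) : L2 (L2lim mu F).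
Proof.
by rewrite /L2lim; case: xgetP => [f _ []//|_]; exact: L20.
Qed.

(** The first alternative is the default value of [L2lim]; excluding it would require completeness
    of L2. *)
Lemma L2lim_cvg (F : nat -> T -> R[i]) : (forall n, L2 (F n)) ->
  L2lim mu F = 0 \/ rnorm mu (F n - L2lim mu F) @[n --> \oo] --> 0.
Proof.
move=> LF; rewrite /L2lim; case: xgetP => [f _ [Lf]|_]; last by left.
move=> cf; right; move: cf.
rewrite (_ : (fun n => _) = EFin \o (fun n => rnorm mu (F n - f))).
  by move/fine_cvgP => [].
by apply/funext => n /=; rewrite L2normE//; exact: L2B.
Qed.

(** The final value of the sequence is a limit, so the default of [L2lim] is excluded. *)
Lemma L2lim_stationary (F : nat -> T -> R[i]) N : (forall n, L2 (F n)) ->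
  (forall n, (N <= n)%N -> F n = F N) ->
  rnorm mu (F n - L2lim mu F) @[n --> \oo] --> 0.
Proof.
move=> LF FN; rewrite /L2lim; case: xgetP => [f _ [Lf]|].
  rewrite (_ : (fun n => L2norm _ _) = EFin \o (fun n => rnorm mu (F n - f))).
    by move/fine_cvgP => [].
  by apply/funext => n /=; rewrite L2normE//; exact: L2B.
move=> /(_ (F N)) []; split => //; apply: cvg_near_cst; exists N => // n /= Nn.
by rewrite FN// subrr L2normE; [rewrite /rnorm rinner0 sqrtr0|exact: L20].
Qed.

End inner_product.

(** * Coefficients of orthogonal series *)

Section orthonormal.
Local Open Scope complex_scope.
Context d (T : measurableType d) (R : realType) (I : choiceType).
Variables (mu : {measure set T -> \bar R}) (phi : I -> T -> R[i]).
Hypothesis L2phi : forall i, L2 mu (phi i).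
Hypothesis phi_orthonormal : forall i j, L2inner mu (phi i) (phi j) = (i == j)%:R.
Variable E : nat -> set I.
Hypothesis finE : forall n, finite_set (E n).
Hypothesis disjE : forall n k i, E n i -> E k i -> n = k.
Local Notation inner := (L2inner mu).

Lemma L2_fsum (A : set I) (a : I -> R[i]) : finite_set A ->
  L2 mu (\sum_(i \in A) a i *: phi i).
Proof.
by move=> finA; rewrite fsbig_finite//; apply: L2_sum => i; exact: L2Z.
Qed.

Lemma inner_fsum (A : set I) (a : I -> R[i]) j : finite_set A ->
  inner (\sum_(i \in A) a i *: phi i) (phi j) = if j \in A then a j else 0.
Proof.
move=> finA; rewrite fsbig_finite// L2inner_sum//; last by move=> i; exact: L2Z.
under eq_bigr do rewrite L2innerZ// phi_orthonormal.
rewrite -(in_fset_set finA).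
have [jA|jA] := boolP (j \in fset_set A).
  rewrite (finmap.big_fsetD1 j)//= eqxx mulr1 big1_seq ?addr0// => i /andP[_].
  by rewrite finmap.in_fsetD1 => /andP[/negPf-> _]; rewrite mulr0.
rewrite big1_seq// => i /andP[_ iA]; case: eqP => [ij|_]; last by rewrite mulr0.
by move: jA; rewrite -ij iA.
Qed.

Variable a : nat -> I -> R[i].
Let F n := \sum_(i \in E n) a n i *: phi i.
Let S n := \sum_(k < n) F k.

Let L2S n : L2 mu (S n).
Proof. by apply: L2_sum => k; exact: L2_fsum. Qed.

Let inner_S k j : E k j -> forall n, (k < n)%N -> inner (S n) (phi j) = a k j.
Proof.
move=> kj n kn; rewrite L2inner_sum//; last by move=> l; exact: L2_fsum.
rewrite (bigD1 (Ordinal kn))//= inner_fsum// mem_set// big1 ?addr0// => l lk.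
rewrite inner_fsum//; case: ifPn => //; move=> /set_mem lj.
by move: lk; rewrite -val_eqE/= (disjE lj kj) eqxx.
Qed.

(** [b] is true when the partial sums converge and false when [L2lim] returns its default. Past the
    block containing [j] every partial sum has coefficient [a k j], by orthonormality and
    disjointness of the blocks. *)
Lemma L2sum_coef : exists b : bool, forall j,
  (forall k, E k j -> inner (L2sum mu F) (phi j) = b%:R * a k j) /\
  ((forall k, ~ E k j) -> inner (L2sum mu F) (phi j) = 0).
Proof.
have [L0|cvgL] := L2lim_cvg L2S.
  by exists false => j; split => *; rewrite /L2sum L0 L2inner0 ?mul0r.
exists true => j; split => [k Ekj|Ej].
  rewrite mul1r; apply: (L2inner_limit L2S (L2_L2lim _ _) _ cvgL (N := k.+1)) => //.
  by move=> n; exact: inner_S.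
apply: (L2inner_limit L2S (L2_L2lim _ _) _ cvgL (N := 0)) => // n _.
rewrite L2inner_sum//; last by move=> l; exact: L2_fsum.
by rewrite big1// => l _; rewrite inner_fsum//; case: ifPn => // /set_mem /Ej.
Qed.

(** Finitely many nonzero blocks make the partial sums stationary, so the limit exists and the
    factor of [L2sum_coef] disappears. *)
Lemma L2sum_coef_fin N : (forall n i, (N <= n)%N -> E n i -> a n i = 0) ->
  forall k j, E k j -> inner (L2sum mu F) (phi j) = a k j.
Proof.
move=> a0 k j Ekj.
have SN n : (N <= n)%N -> S n = S N.
  move=> /subnK <-; elim: (n - N)%N => // l IH.
  rewrite addSn /S big_ord_recr/= -/(S _) IH /F fsbig1 ?addr0// => i Ei.
  by rewrite (a0 _ _ _ Ei) ?leq_addl// scale0r.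
have cvgL := L2lim_stationary L2S SN.
apply: (L2inner_limit L2S (L2_L2lim _ _) _ cvgL (N := k.+1)) => // n.
exact: inner_S.
Qed.

End orthonormal.

(** * Bochner integrals *)

(** The integral of a nonnegative function is a supremum over the simple functions below it, so
    monotonicity holds without measurability. It is applied to norms such as
    [N (g x - bsimple_fun s x)], whose measurability is not known. *)
Lemma le_integral_pointwise d (T : measurableType d) (R : realType)
    (mu : {measure set T -> \bar R}) (D : set T) (f g : T -> \bar R) :
  (forall x, D x -> 0 <= f x)%E -> (forall x, D x -> f x <= g x)%E ->
  (\int[mu]_(x in D) f x <= \int[mu]_(x in D) g x)%E.
Proof.
move=> f0 fg; have g0 x : D x -> (0 <= g x)%E.
  by move=> Dx; exact: le_trans (f0 _ Dx) (fg _ Dx).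
rewrite !ge0_integralE//; apply: ereal_sup_le => _ [h /= hf <-].
by exists h => // x; apply: le_trans (hf x) _; exact: lee_restrict.
Qed.

Lemma cvge0_near_lt (R : realType) (u : nat -> \bar R) (e : R) :
  u n @[n --> \oo] --> 0%E -> 0 < e -> \forall n \near \oo, (u n < e%:E)%E.
Proof.
move=> /fine_cvgP[ufin u0] e0; near=> n.
rewrite -[X in (X < _)%E]fineK; last by near: n.
by rewrite lte_fin; near: n; exact: (cvgr_lt _ u0).
Unshelve. all: by end_near. Qed.

Section bochner_functional.
Local Open Scope complex_scope.
Context (R : realType) (V : lmodType R[i]).
Variables (X : set V) (N : V -> \bar R) (I : set R) (l : V -> R).
Hypothesis mI : measurable I.
Hypotheses (X0 : X 0) (XD : forall v w, X v -> X w -> X (v + w))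
  (XZ : forall (r : R) v, X v -> X (r%:C *: v)).
Hypotheses (l0 : l 0 = 0) (lD : forall v w, X v -> X w -> l (v + w) = l v + l w)
  (lZ : forall (r : R) v, X v -> l (r%:C *: v) = r * l v)
  (lN : forall v, X v -> (`|l v|%:E <= N v)%E).
Implicit Types s : bsimple X I.
Local Notation lambda := (@lebesgue_measure R).

Let X_sum n (F : 'I_n -> V) : (forall i, X (F i)) -> X (\sum_(i < n) F i).
Proof. by move=> XF; elim/big_ind : _. Qed.

Let l_sum n (F : 'I_n -> V) : (forall i, X (F i)) ->
  l (\sum_(i < n) F i) = \sum_(i < n) l (F i).
Proof.
elim: n F => [|n IH] F XF; first by rewrite !big_ord0.
by rewrite !big_ord_recr/= lD ?IH//; exact: X_sum.
Qed.

Let X_bsimple s x : X (bsimple_fun s x).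
Proof. by apply: X_sum => i; apply: XZ; exact: bsimple_in. Qed.

Let lB v w : X v -> X w -> l (v - w) = l v - l w.
Proof.
move=> Xv Xw; have wE : - w = (-1 : R)%:C *: w by rewrite rmorphN1 scaleN1r.
by rewrite wE lD ?lZ ?mulN1r//; exact: XZ.
Qed.

Let XB v w : X v -> X w -> X (v - w).
Proof.
move=> Xv Xw; have -> : - w = (-1 : R)%:C *: w by rewrite rmorphN1 scaleN1r.
by apply: XD => //; exact: XZ.
Qed.

Let l_bsimple s x : l (bsimple_fun s x) =
  \sum_(i < bsimple_size s) \1_(bsimple_set i) x * l (bsimple_val i).
Proof.
rewrite l_sum => [|i]; last by apply: XZ; exact: bsimple_in.
by apply: eq_bigr => i _; rewrite lZ//; exact: bsimple_in.
Qed.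

Let integrable_indic s (i : 'I_(bsimple_size s)) : lambda.-integrable I (EFin \o \1_(bsimple_set i)).
Proof.
have mi := bsimple_measurable i.
apply/integrableP; split.
  by apply/measurable_EFinP; apply: measurable_funTS; exact: measurable_indic.
under eq_integral do rewrite /= ger0_norm//.
rewrite integral_indic// (setIidl (@bsimple_subset _ _ _ _ s i)).
exact: bsimple_finite.
Qed.

Let integrable_l_bsimple s : lambda.-integrable I (EFin \o (l \o bsimple_fun s)).
Proof.
rewrite (_ : EFin \o _ = fun x => (\sum_(i < bsimple_size s)
    ((l (bsimple_val i))%:E * (\1_(bsimple_set i) x)%:E))%E).
  apply: integrable_sum => // i _; apply: integrableZl => //; exact: integrable_indic.
apply/funext => x /=; rewrite l_bsimple -sumEFin.
by apply: eq_bigr => i _; rewrite EFinM muleC.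
Qed.

Let integral_l_bsimple s :
  (\int[lambda]_(x in I) l (bsimple_fun s x))%R = l (bsimple_integral s).
Proof.
rewrite l_sum; last by move=> i; apply: XZ; exact: bsimple_in.
rewrite /Rintegral (_ : (fun x => _) = fun x => (\sum_(i < bsimple_size s)
    ((l (bsimple_val i))%:E * (\1_(bsimple_set i) x)%:E))%E); last first.
  apply/funext => x /=; rewrite l_bsimple -sumEFin.
  by apply: eq_bigr => i _; rewrite EFinM muleC.
rewrite integral_sum//; last first.
  by move=> i; apply: integrableZl => //; exact: integrable_indic.
rewrite -sum_fine//; last first.
  move=> i _; rewrite (integralZl _ (integrable_indic _))// integral_indic//; last exact: bsimple_measurable.
  rewrite fin_numM// (setIidl (@bsimple_subset _ _ _ _ s i))//.
  by rewrite ge0_fin_numE// bsimple_finite.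
apply: eq_bigr => i _; rewrite lZ; last exact: bsimple_in.
rewrite (integralZl _ (integrable_indic _))// integral_indic//; last exact: bsimple_measurable.
rewrite (setIidl (@bsimple_subset _ _ _ _ s i))// fineM//= 1?mulrC//.
by rewrite ge0_fin_numE// bsimple_finite.
Qed.

(** A pointwise limit of measurable functions: [lN] carries the convergence of the simple functions
    from [N] to [l]. *)
Lemma measurable_functional (g : R -> V) : strongly_measurable X N I g ->
  measurable_fun I (l \o g).
Proof.
move=> [Xg [s sg]].
apply: (@measurable_fun_cvg _ _ _ _ (fun n => l \o bsimple_fun (s n))).
  by move=> n; apply/measurable_EFinP; exact: measurable_int (integrable_l_bsimple _).
move=> x Ix; apply/cvgrPdist_lt => e e0.
have := cvge0_near_lt (sg x Ix) e0; apply: filterS => n /= sn.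
rewrite -lB//; last exact: Xg.
rewrite -lte_fin (le_lt_trans _ sn)// lN//; apply: XB => //; exact: Xg.
Qed.

(** A bounded real-linear functional commutes with the Bochner integral: it does so on simple
    functions by linearity, and [lN] bounds both approximation errors by those in [N]. *)
Lemma bochner_functional (g : R -> V) (y : V) :
  is_bochner_integral X N I g y ->
  lambda.-integrable I (EFin \o (l \o g)) /\
  (\int[lambda]_(x in I) l (g x))%R = l y.
Proof.
move=> [smg Xy [s [s_int s_y]]].
have [Xg _] := smg; have mlg := measurable_functional smg.
have mlgs n : measurable_fun I (fun x => l (g x) - l (bsimple_fun (s n) x)).
  apply: measurable_funB => //.
  by apply/measurable_EFinP; exact: measurable_int (integrable_l_bsimple _).
have emlgs n : measurable_fun I (fun x => (l (g x) - l (bsimple_fun (s n) x))%:E).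
  by move/measurable_EFinP : (mlgs n).
have bound n : (\int[lambda]_(x in I) `|(l (g x) - l (bsimple_fun (s n) x))%:E| <=
    \int[lambda]_(x in I) N (g x - bsimple_fun (s n) x)%R)%E.
  apply: le_integral_pointwise => x Ix //=.
  rewrite -lB//; last exact: Xg.
  by apply: lN; apply: XB => //; exact: Xg.
have int_lg : lambda.-integrable I (EFin \o (l \o g)).
  (* One simple function within distance 1 is enough: [l \o g] is then a sum of two integrable
     functions. *)
  have [n _ /(_ n (leqnn _)) sn] := cvge0_near_lt s_int ltr01.
  rewrite (_ : EFin \o _ = (fun x => (l (g x) - l (bsimple_fun (s n) x))%:E) \+
      (EFin \o (l \o bsimple_fun (s n)))).
    apply: integrableD; [exact: mI| |exact: integrable_l_bsimple].
    apply/integrableP; split; first exact: emlgs.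
    exact: le_lt_trans (bound n) (lt_trans sn (ltry _)).
  by apply/funext => x /=; rewrite -EFinD subrK.
split=> //; apply/eqP; rewrite -subr_eq0 -normr_le0; apply/ler_addgt0Pr => e e0.
have e20 : 0 < e / 2 by rewrite divr_gt0.
near \oo => n; rewrite add0r.
have n1 : (\int[lambda]_(x in I) N (g x - bsimple_fun (s n) x)%R < (e / 2)%:E)%E.
  by near: n; exact: cvge0_near_lt.
have n2 : (N (y - bsimple_integral (s n)) < (e / 2)%:E)%E.
  by near: n; exact: cvge0_near_lt.
have Xs : X (bsimple_integral (s n)).
  by apply: X_sum => i; apply: XZ; exact: bsimple_in.
set a := (\int[lambda]_(x in I) l (g x))%R.
have h1 : `|a - l (bsimple_integral (s n))| < e / 2.
  have int_d : lambda.-integrable I (EFin \o (fun x => l (g x) - l (bsimple_fun (s n) x))).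
    rewrite (_ : EFin \o _ = ((EFin \o (l \o g)) \- (EFin \o (l \o bsimple_fun (s n))))%E)//.
    by apply: integrableB; [exact: mI| |exact: integrable_l_bsimple].
  rewrite -integral_l_bsimple -RintegralB//; last exact: integrable_l_bsimple.
  rewrite -lte_fin EFin_normr_Rintegral//; apply: le_lt_trans n1.
  apply: le_trans (bound n); apply: le_abse_integral => //; exact: emlgs.
have h2 : `|l y - l (bsimple_integral (s n))| < e / 2.
  by rewrite -lB// -lte_fin (le_lt_trans _ n2)// lN//; exact: XB.
rewrite (_ : a - l y = (a - l (bsimple_integral (s n))) - (l y - l (bsimple_integral (s n)))).
  by rewrite (le_trans (ler_normB _ _))// [e]splitr lerD// ltW.
by rewrite opprB addrA subrK.
Unshelve. all: by end_near. Qed.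

End bochner_functional.

(** * Multi-indices and square-summable families *)

Section multi_indices.
Local Open Scope complex_scope.
Context (m : nat).

Lemma finite_multi_index_box N :
  finite_set [set nu : m.-tuple nat | forall i, (tnth nu i <= N)%N].
Proof.
apply: (sub_finite_set (B := (fun x : m.-tuple 'I_N.+1 => [tuple of map val x]) @` setT));
  last by apply: finite_image; exact: finite_finset.
move=> nu nuN; exists [tuple inord (tnth nu i) | i < m] => //.
by apply: eq_from_tnth => i; rewrite tnth_map tnth_mktuple /= inordK// ltnS.
Qed.

Lemma leq_multi_index_degree (nu : m.-tuple nat) i :
  (tnth nu i <= multi_index_degree nu)%N.
Proof. by rewrite /multi_index_degree (bigD1 i)//= leq_addr. Qed.

Lemma finite_degree_set n : finite_set (@degree_set m n).
Proof.
apply: sub_finite_set (finite_multi_index_box n) => nu /= <- i.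
exact: leq_multi_index_degree.
Qed.

Lemma finite_degree_lt n :
  finite_set [set nu : m.-tuple nat | (multi_index_degree nu < n)%N].
Proof.
apply: sub_finite_set (finite_multi_index_box n) => nu /= nun i.
exact: leq_trans (leq_multi_index_degree nu i) (ltnW nun).
Qed.

Lemma degree_set_disj n k (nu : m.-tuple nat) :
  degree_set n nu -> degree_set k nu -> n = k.
Proof. by move=> <- <-. Qed.

(** For m = 0 only degree 0 is inhabited; for m > 0 the index set is infinite, which is what exact
    controllability fails on. *)
Lemma degree_set_neq0 n : (0 < m)%N -> exists nu : m.-tuple nat, degree_set n nu.
Proof.
move=> m0; exists [tuple if i == Ordinal m0 then n else 0%N | i < m].
rewrite /degree_set/= /multi_index_degree (bigD1 (Ordinal m0))//= tnth_mktuple eqxx.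
by rewrite big1 ?addn0// => i /negPf i0; rewrite tnth_mktuple i0.
Qed.

End multi_indices.

Lemma cvg_sum0 (R : realType) I (r : seq I) (f : I -> nat -> R) :
  (forall i, f i n @[n --> \oo] --> 0) -> \sum_(i <- r) f i n @[n --> \oo] --> 0.
Proof.
move=> f0; elim: r => [|i r IH].
  by under eq_fun do rewrite big_nil; exact: cvg_cst.
rewrite (_ : (fun n => _) = fun n => f i n + \sum_(j <- r) f j n).
  have h : f i n + \sum_(j <- r) f j n @[n --> \oo] --> 0 + 0 by exact: cvgD.
  by rewrite addr0 in h.
by apply/funext => n; rewrite big_cons.
Qed.

Section square_summable.
Local Open Scope complex_scope.
Context (R : realType) (m : nat).
Implicit Types U : m.-tuple nat -> R[i].
Local Notation sqn U nu := ((Normc.normc (U nu) ^+ 2)%:E).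

Let layer U n : \bar R := (\sum_(nu \in degree_set n) sqn U nu)%E.

Let layer_ge0 U n : (0 <= layer U n)%E.
Proof.
by rewrite /layer fsbig_finite ?sume_ge0//;
  [move=> *; rewrite lee_fin sqr_ge0|exact: finite_degree_set].
Qed.

Lemma l2norm_ge0 U : (0 <= l2norm U)%E. Proof. exact: poweR_ge0. Qed.

Lemma l2norm_sqr U : (l2norm U ^+ 2 = \sum_(0 <= n <oo) layer U n)%E.
Proof.
rewrite /l2norm; have : (0 <= \sum_(0 <= n <oo) layer U n)%E.
  by apply: nneseries_ge0 => *; exact: layer_ge0.
case: (\sum_(0 <= n <oo) layer U n)%E => [r r0| |//].
  by rewrite poweR_EFin powR12_sqrt// -EFin_expe sqr_sqrtr.
by move=> _; rewrite poweRyr ?invr_eq0// expe2 mulyy.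
Qed.

(** The [nu k] have pairwise distinct degrees, so each term sits in a different layer of the
    norm. *)
Lemma le_sum_l2norm U (nu : nat -> m.-tuple nat) n :
  (forall k, degree_set k (nu k)) ->
  (\sum_(k < n) sqn U (nu k) <= l2norm U ^+ 2)%E.
Proof.
move=> nuk; rewrite l2norm_sqr.
apply: le_trans (nneseries_lim_ge n _); last by move=> *; exact: layer_ge0.
rewrite big_mkord; apply: lee_sum => k _; rewrite /layer fsbig_finite//; last exact: finite_degree_set.
rewrite (big_fsetD1 (nu k))/=; last first.
  by rewrite in_fset_set; [exact/mem_set/nuk|exact: finite_degree_set].
by rewrite leeDl// sume_ge0// => *; rewrite lee_fin sqr_ge0.
Qed.

Definition l2sum (M : nat) U : R :=
  \sum_(k < M) \sum_(nu <- fset_set (@degree_set m k)) Normc.normc (U nu) ^+ 2.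

Lemma l2norm_finite_support M U :
  (forall nu, (M <= multi_index_degree nu)%N -> U nu = 0) ->
  l2norm U = (Num.sqrt (l2sum M U))%:E.
Proof.
move=> U0; have l2sum_ge0 : 0 <= l2sum M U.
  by apply: sumr_ge0 => k _; apply: sumr_ge0 => *; exact: sqr_ge0.
rewrite /l2norm -powR12_sqrt// -poweR_EFin; congr (_ `^ _)%E.
rewrite (@nneseries_split _ _ 0%N M)//=; last by move=> *; exact: layer_ge0.
rewrite [X in (_ + X)%E]eseries0 ?adde0; last first.
  move=> k Mk _; rewrite fsbig1// => nu nuk; rewrite U0 ?nuk//.
  by rewrite -[0]/(0 +i* 0) /Normc.normc expr0n/= addr0 sqrtr0 expr0n.
rewrite big_mkord /l2sum -sumEFin; apply: eq_bigr => k _.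
by rewrite fsbig_finite ?sumEFin//; exact: finite_degree_set.
Qed.

Lemma cvg_l2sum M (U : nat -> m.-tuple nat -> R[i]) :
  (forall nu, Normc.normc (U n nu) @[n --> \oo] --> 0) ->
  l2sum M (U n) @[n --> \oo] --> 0.
Proof.
move=> U0; apply: cvg_sum0 => k; apply: cvg_sum0 => nu.
have h : Normc.normc (U n nu) * Normc.normc (U n nu) @[n --> \oo] --> 0 * (0 : R).
  exact: cvgM.
by rewrite mulr0 in h.
Qed.

End square_summable.

(** * Strong measurability and constant integrands *)

Section strong_measurability.
Local Open Scope complex_scope.
Context (R : realType) (V : lmodType R[i]) (X : set V) (N : V -> \bar R).

(** On each cell of the grid of step 1/(n+1) the function is replaced by its value at the left end
    of the cell; sequential continuity gives convergence at every point. *)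
Lemma strongly_measurable_continuous (t : R) (u : R -> V) : 0 < t ->
  (forall x, X (u x)) ->
  (forall x (z : nat -> R), z n @[n --> \oo] --> x ->
    N (u x - u (z n)) @[n --> \oo] --> 0%E) ->
  strongly_measurable X N `]0, t[%classic u.
Proof.
move=> t0 Xu cu; split => [x _|]; first exact: Xu.
pose pt (n k : nat) : R := k%:R / n.+1%:R.
pose A n k := `]0, t[%classic `&` `[pt n k, pt n k.+1[%classic : set R.
(* Enough cells to cover ]0, t[. *)
pose K n := (Num.truncn (n.+1%:R * t)).+1.
have mA n (i : 'I_(K n)) : measurable (A n i : set (measurableTypeR R)).
  exact: measurableI.
have AI n (i : 'I_(K n)) : A n i `<=` `]0, t[%classic by exact: subIsetl.
have finA n (i : 'I_(K n)) : (lebesgue_measure (A n i) < +oo)%E.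
  rewrite (@le_lt_trans _ _ (lebesgue_measure `]0, t[%classic))//.
    by apply: measureIl; exact: measurable_itv.
  by rewrite lebesgue_measure_itv/= lte_fin t0 -EFinB ltry.
pose s n := @BSimple R V X `]0, t[%classic (K n) (fun i => A n i)
  (fun i => u (pt n i)) (mA n) (AI n) (finA n) (fun i => Xu _).
exists s => x; rewrite /= in_itv/= => /andP[x0 xt].
pose z n := pt n (Num.truncn (n.+1%:R * x)).
have zx n : z n <= x < pt n (Num.truncn (n.+1%:R * x)).+1.
  have nx0 : 0 <= n.+1%:R * x by rewrite mulr_ge0// ltW.
  have := truncn_itv nx0.
  by rewrite ler_pdivrMr// ltr_pdivlMr// (mulrC x).
have -> : (fun n => N (u x - bsimple_fun (s n) x)) = fun n => N (u x - u (z n)).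
  apply/funext => n; congr (N (_ - _)).
  have jK : (Num.truncn (n.+1%:R * x) < K n)%N.
    by rewrite ltnS le_truncn// ler_pM2l// ltW.
  rewrite /bsimple_fun (bigD1 (Ordinal jK))//= big1 ?addr0.
    by rewrite indicE mem_set ?scale1r//; split; rewrite /= in_itv/= ?x0 ?xt//; exact: zx.
  (* The cells are disjoint, so only the one with index truncn ((n+1) x) contributes. *)
  move=> i ij; rewrite indicE memNset ?scale0r//= => -[_] /=.
  rewrite in_itv/= /pt ler_pdivrMr// ltr_pdivlMr// (mulrC x) => /andP[i1 i2].
  move: ij; rewrite -val_eqE/= => /negP; apply; apply/eqP.
  apply/esym/truncn_def; exact/andP.
apply: cu; apply/cvgrPdist_lt => e e0.
near=> n; have /andP[z1 z2] := zx n.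
rewrite ger0_norm ?subr_ge0// ltrBlDr (lt_trans z2)// /pt -addn1 natrD mulrDl addrC ltrD2r mul1r.
by near: n; exact: (near_infty_natSinv_lt (PosNum e0)).
Unshelve. all: by end_near. Qed.

End strong_measurability.

(** As [g] equals [v] up to norm zero, the single step [v] on the whole interval serves as a
    constant approximating sequence. *)
Lemma bochner_integral_cst (R : realType) (V : lmodType R[i]) (X : set V)
    (N : V -> \bar R) (t : R) (g : R -> V) (v : V) : 0 < t ->
  X v -> X (t%:C%C *: v) -> N 0 = 0%E ->
  (forall x, 0 < x < t -> X (g x) /\ N (g x - v) = 0%E) ->
  is_bochner_integral X N `]0, t[%classic g (t%:C%C *: v).
Proof.
move=> t0 Xv Xtv N0 gv.
have finI : (lebesgue_measure (`]0%R, t[%classic : set R) < +oo)%E.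
  by rewrite lebesgue_measure_itv/= lte_fin t0 -EFinB ltry.
pose s := @BSimple R V X `]0, t[%classic 1 (fun=> `]0, t[%classic) (fun=> v)
  (fun=> measurable_itv _) (fun=> @subset_refl _ _) (fun=> finI) (fun=> Xv).
have sE x : `]0, t[%classic x -> N (g x - bsimple_fun s x) = 0%E.
  move=> xI; rewrite /bsimple_fun big_ord1 indicE mem_set// scale1r.
  by have [] := gv x; first by move: xI; rewrite /= in_itv.
split=> //.
  split=> [x xI|]; first by have [] := gv x; first by move: xI; rewrite /= in_itv.
  by exists (fun=> s) => x xI; rewrite sE//; exact: cvg_cst.
exists (fun=> s); split.
  by rewrite integral0_eq//; exact: cvg_cst.
rewrite /bsimple_integral big_ord1/= lebesgue_measure_itv/= lte_fin t0 -EFinB/= subr0.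
by rewrite subrr N0; exact: cvg_cst.
Qed.

(** * Controllability of diagonal systems *)

Section rinner_bochner.
Local Open Scope complex_scope.
Context d (T : measurableType d) (R : realType).
Variable mu : {measure set T -> \bar R}.

(** Moving the scalar to the test vector turns a normalised complex coefficient into one real
    functional, to which [bochner_rinner] applies. *)
Lemma rinner_conj (c : R[i]) (f g : T -> R[i]) : L2 mu f -> L2 mu g ->
  rinner mu f (c^* *: g) = complex.Re (c * L2inner mu f g).
Proof.
move=> Lf Lg; rewrite -L2innerZ// L2innerE/=; apply: eq_Rintegral => x _.
rewrite -[(_ *: g) x]/(c^* * g x) -[(_ *: f) x]/(c * f x).
by case: c; case: (f x); case: (g x) => * /=; ring.
Qed.

Lemma bochner_rinner (I : set R) (g : R -> T -> R[i]) (y psi : T -> R[i]) :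
  measurable (I : set (measurableTypeR R)) -> L2 mu psi ->
  is_bochner_integral (L2 mu) (L2norm mu) I g y ->
  lebesgue_measure.-integrable I (EFin \o (fun x => rinner mu (g x) psi)) /\
  (\int[lebesgue_measure]_(x in I) rinner mu (g x) psi)%R = rinner mu y psi.
Proof.
(* Dividing by [K] makes the functional bounded by the norm; the added 1 keeps [K] positive when
   [psi] is null. *)
move=> mI Lpsi gy; set K := rnorm mu psi + 1.
have K0 : 0 < K by rewrite ltr_wpDl// rnorm_ge0.
pose l (v : T -> R[i]) := K^-1 * rinner mu v psi.
have [|||||||il ly] := @bochner_functional R _ (L2 mu) (L2norm mu) I l mI _ _ _ _ _ _ _ g y gy.
- exact: L20.
- exact: L2D.
- by move=> r v; exact: L2Z.
- by rewrite /l rinner0 mulr0.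
- by move=> v w Lv Lw; rewrite /l rinnerD// mulrDr.
- by move=> r v Lv; rewrite /l rinnerZ// mulrCA.
- move=> v Lv; rewrite L2normE// lee_fin /l normrM gtr0_norm ?invr_gt0//.
  rewrite ler_pdivrMl// (le_trans (ler_rinner_norm Lv Lpsi))// mulrC.
  by rewrite ler_wpM2r ?rnorm_ge0// lerDl.
have gE x : rinner mu (g x) psi = K * l (g x) by rewrite mulVKf// gt_eqF.
split.
  rewrite (_ : EFin \o _ = fun x => (K%:E * (EFin \o (l \o g)) x)%E).
    exact: integrableZl.
  by apply/funext => x /=; rewrite gE EFinM.
under eq_Rintegral do rewrite gE.
by rewrite RintegralZl// ly mulVKf// gt_eqF.
Qed.

End rinner_bochner.

Section diagonal_control.
Local Open Scope complex_scope.
Context d (T : measurableType d) (R : realType) (m : nat).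
Variables (mu : {measure set T -> \bar R}) (phi : m.-tuple nat -> T -> R[i]).
Variables (E : nat -> set (m.-tuple nat)) (lam : nat -> R) (b : T -> R[i]).
Hypothesis L2phi : forall i, L2 mu (phi i).
Hypothesis phi_orthonormal : forall i j, L2inner mu (phi i) (phi j) = (i == j)%:R.
Hypothesis phi_dense : forall w, L2 mu w -> forall e : R, 0 < e ->
  exists s : seq (R[i] * m.-tuple nat),
    rnorm mu (w - \sum_(x <- s) x.1 *: phi x.2) <= e.
Hypothesis finE : forall n, finite_set (E n).
Hypothesis disjE : forall n k i, E n i -> E k i -> n = k.
Hypothesis coverE : forall i, exists n, E n i.
Hypothesis lam_ge0 : forall n, 0 <= lam n.
Hypothesis L2b : L2 mu b.
Hypothesis b_neq0 : forall i, L2inner mu b (phi i) != 0.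
Hypothesis m_gt0 : (0 < m)%N.

Local Notation inner := (L2inner mu).
Local Notation S := (spectral_semigroup mu phi E lam).
Local Notation C := (control_operator mu phi b).

Let L2comb (s : seq (R[i] * m.-tuple nat)) : L2 mu (\sum_(x <- s) x.1 *: phi x.2).
Proof. by apply: L2_sum => x; exact: L2Z. Qed.

(** If p is a finite combination of basis vectors within e of f, then |f|^2 = <f, f - p> <= e
    |f|. *)
Lemma orthogonal_rnorm0 f : L2 mu f -> (forall j, inner f (phi j) = 0) -> rnorm mu f = 0.
Proof.
move=> Lf f0; apply/eqP; rewrite eq_le rnorm_ge0 andbT.
apply/ler_addgt0Pr => e e0; rewrite add0r.
have [s se] := phi_dense Lf e0.
have fs : rinner mu f (\sum_(x <- s) x.1 *: phi x.2) = 0.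
  elim: s {se} => [|x s IH]; first by rewrite big_nil rinnerC rinner0.
  rewrite big_cons rinnerC rinnerD//; last exact: L2Z.
  rewrite [X in _ + X](rinnerC mu) IH addr0 rinnerC.
  by rewrite -[x.1]conjcK rinner_conj// f0 mulr0.
have [->|f_neq0] := eqVneq (rnorm mu f) 0; first exact: ltW.
have f_gt0 : 0 < rnorm mu f by rewrite lt_def f_neq0 rnorm_ge0.
rewrite -(ler_pM2l f_gt0) -expr2 sqr_rnorm.
have -> : rinner mu f f = rinner mu f (f - \sum_(x <- s) x.1 *: phi x.2).
  by rewrite [RHS]rinnerC rinnerB// [X in _ - X]rinnerC fs subr0.
rewrite (le_trans (ler_norm _))// (le_trans (ler_rinner_norm _ _))//; first exact: L2B.
by rewrite ler_wpM2l// rnorm_ge0.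
Qed.

Lemma semigroupE t f : S t f = L2sum mu (fun n => \sum_(nu \in E n)
  ((expR (- lam n * t))%:C * inner f (phi nu)) *: phi nu).
Proof.
congr L2sum; apply/funext => n; rewrite /spectral_proj !fsbig_finite// scaler_sumr.
by apply: eq_bigr => nu _; rewrite scalerA.
Qed.

Lemma L2_semigroup t f : L2 mu (S t f). Proof. exact: L2_L2lim. Qed.
(** The factor is e^(-lam t) when the series converges and 0 otherwise; as lam and t are nonnegative
    it lies in [0, 1]. *)
Lemma semigroup_coef t f j : 0 <= t ->
  exists2 theta : R, 0 <= theta <= 1 & inner (S t f) (phi j) = theta%:C * inner f (phi j).
Proof.
move=> t0; rewrite semigroupE.
have [c /(_ j)[+ _]] := L2sum_coef L2phi phi_orthonormal finE disjE
  (fun n nu => (expR (- lam n * t))%:C * inner f (phi nu)).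
have [k Ekj] := coverE j => /(_ k Ekj) ->.
exists (c%:R * expR (- lam k * t)); last by rewrite rmorphM/= rmorph_nat mulrA.
rewrite mulr_ge0 ?ler0n ?expR_ge0//= mulr_ile1 ?ler0n ?expR_ge0 ?lern1 ?leq_b1//.
by rewrite expR_le1 mulNr oppr_le0 mulr_ge0.
Qed.

(** Here the factor is 1 or 0, according to whether the series converges. *)
Lemma control_coef U j : exists2 theta : R, 0 <= theta <= 1 &
  inner (C U) (phi j) = theta%:C * (U j * inner b (phi j)).
Proof.
have [c /(_ j)[+ _]] := L2sum_coef L2phi phi_orthonormal (@finite_degree_set m) (@degree_set_disj m)
  (fun _ nu => U nu * inner b (phi nu)).
move=> /(_ (multi_index_degree j) erefl) ->; exists c%:R; last by rewrite rmorph_nat.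
by rewrite ler0n lern1 leq_b1.
Qed.

(** Only finitely many indices carry a nonzero coefficient and each lies in one block, so the terms
    of the series vanish from some point on. *)
Lemma semigroup_coef_fin M t f : 
  (forall j, (M <= multi_index_degree j)%N -> inner f (phi j) = 0) ->
  forall k j, E k j -> inner (S t f) (phi j) = (expR (- lam k * t))%:C * inner f (phi j).
Proof.
move=> f0 k j Ekj; rewrite semigroupE.
have [idx Eidx] := choice coverE.
(* [N] exceeds the block number of every multi-index of degree below [M]. *)
pose N := \max_(nu <- fset_set [set nu : m.-tuple nat | (multi_index_degree nu < M)%N]) (idx nu).+1.
apply: (L2sum_coef_fin L2phi phi_orthonormal finE disjE (N := N)
  (a := fun n nu => (expR (- lam n * t))%:C * inner f (phi nu))) => // n i Nn Eni.
have [Mi|iM] := leqP M (multi_index_degree i); first by rewrite f0// mulr0.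
have : ((idx i).+1 <= N)%N.
  apply: (@leq_bigmax_seq _ _ _ (fun nu => (idx nu).+1)) => //.
  by rewrite in_fset_set; [exact/mem_set|exact: finite_degree_lt].
by rewrite (disjE (Eidx i) Eni) ltnNge Nn.
Qed.

Lemma control_coef_fin M U :
  (forall j, (M <= multi_index_degree j)%N -> U j = 0) ->
  forall j, inner (C U) (phi j) = U j * inner b (phi j).
Proof.
move=> U0 j; have H := L2sum_coef_fin L2phi phi_orthonormal (@finite_degree_set m)
  (@degree_set_disj m) (N := M) (a := fun _ nu => U nu * inner b (phi nu)).
apply: (H _ (multi_index_degree j)) => // n i Mn ni.
by rewrite U0 ?mul0r// ni.
Qed.

Variables (t1 : R).
Hypothesis t1_gt0 : 0 < t1.
Local Notation I := (`]0, t1[%classic : set (measurableTypeR R)).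

Let mIE : lebesgue_measure I = t1%:E.
Proof. by rewrite lebesgue_measure_itv/= lte_fin t1_gt0 -EFinB subr0. Qed.

(** Integrating |h| <= 1/(2 t1) + (t1/2) h^2 over an interval of length t1 gives 1 <= 1/2 + (t1/2)
    times the integral of h^2. This form of Cauchy-Schwarz allows that integral to be infinite. *)
Lemma sqr_integral_ge (h : R -> R) :
  lebesgue_measure.-integrable I (EFin \o h) ->
  (\int[lebesgue_measure]_(x in I) h x)%R = 1 ->
  (t1^-1%:E <= \int[lebesgue_measure]_(x in I) ((h x) ^+ 2)%:E)%E.
Proof.
move=> ih h1; have mh : measurable_fun I h by apply/measurable_EFinP; exact: measurable_int ih.
have mI : measurable I by [].
have h1' : (\int[lebesgue_measure]_(x in I) (h x)%:E = 1)%E.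
  by rewrite -[LHS]fineK ?integrable_fin_num// -/(Rintegral _ _ _) h1.
have : (1 <= \int[lebesgue_measure]_(x in I) `|(h x)%:E|)%E.
  by rewrite -(@gee0_abs _ 1%E)// -[X in (`|X| <= _)%E]h1' le_abse_integral//; exact/measurable_EFinP.
have h2 : (\int[lebesgue_measure]_(x in I) `|(h x)%:E| <=
   \int[lebesgue_measure]_(x in I) ((2 * t1)^-1%:E + (t1 / 2)%:E * ((h x) ^+ 2)%:E))%E.
  apply: le_integral_pointwise => // x _; rewrite -EFinM -EFinD lee_fin.
  rewrite -(@ler_pM2l _ (2 * t1)) ?mulr_gt0// mulrDr mulfV ?gt_eqF ?mulr_gt0//.
  rewrite (_ : 2 * t1 * (t1 / 2 * h x ^+ 2) = (t1 * `|h x|) ^+ 2); last first.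
    by rewrite exprMn real_normK ?num_real//; field.
  by have := sqr_ge0 (t1 * `|h x| - 1); rewrite sqrrB; lra.
move=> /le_trans/(_ h2) {h2}.
have m2 : measurable_fun I (fun x => ((h x) ^+ 2)%:E).
  by apply/measurable_EFinP; exact: measurable_funX.
rewrite ge0_integralD//=; last first.
- by apply: emeasurable_funM.
- by move=> x _; rewrite -EFinM lee_fin mulr_ge0 ?sqr_ge0// divr_ge0// ltW.
- by move=> x _; rewrite lee_fin invr_ge0 mulr_ge0// ltW.
rewrite ge0_integralZl_EFin//; last first.
- by rewrite divr_ge0// ltW.
- by move=> x _; rewrite lee_fin sqr_ge0.
have -> : (\int[lebesgue_measure]_(x in I) (2 * t1)^-1%:E = (2 * t1)^-1%:E * t1%:E)%E.
  exact: etrans (integral_cst _ mI _) (congr1 (fun z => _ * z)%E mIE).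
rewrite -EFinM.
rewrite (_ : (2 * t1)^-1 * t1 = 2^-1); last by field; rewrite gt_eqF.
have : (0 <= \int[lebesgue_measure]_(x in I) ((h x) ^+ 2)%:E)%E.
  by apply: integral_ge0 => x _; rewrite lee_fin sqr_ge0.
case: (\int[lebesgue_measure]_(x in I) ((h x) ^+ 2)%:E)%E => [r r0| _ _|//]; last by rewrite leey.
rewrite -EFinM -EFinD !lee_fin => h3.
by rewrite -(ler_pM2l t1_gt0) mulfV ?gt_eqF//; lra.
Qed.

Lemma not_exactly_controllable : ~ exactly_controllable mu S C t1.
Proof.
move=> /(_ 0 b (L20 _) L2b)[u [[_ u2] ub]].
have LS0 : L2 mu (S t1 0) by exact: L2_semigroup.
move: ub; rewrite /mild_solution /bochner_integral.
set g := fun s => S (t1 - s) (C (u s)).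
have S0 j : inner (S t1 0) (phi j) = 0.
  by have [r _ ->] := semigroup_coef 0 j (ltW t1_gt0); rewrite L2inner0 mulr0.
(* Without a Bochner integral the default is 0, and the solution starting from 0 misses [b], whose
   coefficients are nonzero. *)
case: xgetP => [y _ gy|_]; last first.
  rewrite addr0 L2normE; last exact: L2B.
  move=> [h0]; have [nu0 _] := degree_set_neq0 0 m_gt0.
  have := rnorm0_inner (L2B LS0 L2b) (L2phi nu0) h0; rewrite L2innerB// S0 sub0r.
  by apply/eqP; rewrite oppr_eq0.
have [_ Ly _] := gy; have LSy := L2D LS0 Ly.
rewrite L2normE; last exact: L2B.
move=> [h0].
have yb j : inner y (phi j) = inner b (phi j).
  have := rnorm0_inner (L2B LSy L2b) (L2phi j) h0.
  by rewrite L2innerB// L2innerD// S0 add0r => /eqP; rewrite subr_eq0 => /eqP.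
(* Normalised so that pairing with [y], which has the coefficients of [b], gives 1. *)
pose psi j := ((inner b (phi j))^-1)^* *: phi j.
pose h j s := rinner mu (g s) (psi j).
have hy j := bochner_rinner (measurable_itv _) (L2Z _ (L2phi j) : L2 mu (psi j)) gy.
have h1 j : (\int[lebesgue_measure]_(x in I) h j x)%R = 1.
  by have [_ ->] := hy j; rewrite rinner_conj// yb mulVf.
(* [h j s] is the real part of [u s j] times a factor in [0, 1], the product of those in
   [semigroup_coef] and [control_coef]. *)
have hu j s : I s -> h j s ^+ 2 <= Normc.normc (u s j) ^+ 2.
  move=> sI; have /andP[s0 st] : 0 < s < t1 by move: sI; rewrite /= in_itv.
  have Lg : L2 mu (g s) by exact: L2_semigroup.
  rewrite /h (rinner_conj _ Lg (L2phi j)).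
  have st0 : 0 <= t1 - s by rewrite subr_ge0 ltW.
  have [r r01 ->] := semigroup_coef (C (u s)) j st0.
  have [r' r'01 ->] := control_coef (u s) j.
  rewrite (_ : _ * _ = (r * r')%:C * u s j); last first.
    by rewrite rmorphM/= mulrC -!mulrA mulfV ?mulr1.
  have /andP[rr0 rr1] : 0 <= r * r' <= 1.
    by move: r01 r'01 => /andP[? ?] /andP[? ?]; rewrite mulr_ge0// mulr_ile1.
  case: (u s j) => x z /=; rewrite mul0r subr0 sqr_sqrtr ?addr_ge0 ?sqr_ge0// exprMn.
  rewrite (@le_trans _ _ (x ^+ 2)) ?lerDl ?sqr_ge0//.
  by rewrite -[leRHS]mul1r ler_wpM2r ?sqr_ge0// exprn_ile1.
(* One multi-index in each degree: the first [n] of them force a squared norm of at least [n / t1],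
   for every [n]. *)
have [nu nudeg] := choice (fun n => degree_set_neq0 n m_gt0).
have bound n : ((n%:R / t1)%:E <= \int[lebesgue_measure]_(x in I) (l2norm (u x) ^+ 2))%E.
  apply: (@le_trans _ _ (\int[lebesgue_measure]_(x in I) \sum_(k < n) (h (nu k) x ^+ 2)%:E)%E).
    rewrite ge0_integral_sum//; last 2 first.
    - move=> k; apply/measurable_EFinP/measurable_funX/measurable_EFinP.
      by have [/measurable_int] := hy (nu k).
    - by move=> k x _; rewrite lee_fin sqr_ge0.
    rewrite (@le_trans _ _ (\sum_(k < n) t1^-1%:E)%E)//.
      by rewrite sumEFin sumr_const card_ord lee_fin mulr_natl.
    by apply: lee_sum => k _; apply: sqr_integral_ge => //; have [] := hy (nu k).
  apply: le_integral_pointwise => x Ix; first by apply: sume_ge0 => k _; rewrite lee_fin sqr_ge0.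
  apply: le_trans (le_sum_l2norm (u x) n nudeg).
  by apply: lee_sum => k _; rewrite lee_fin hu.
have [M0 Mfin] : (0 <= \int[lebesgue_measure]_(x in I) (l2norm (u x) ^+ 2))%E /\
    (\int[lebesgue_measure]_(x in I) (l2norm (u x) ^+ 2))%E \is a fin_num.
  have M0 : (0 <= \int[lebesgue_measure]_(x in I) (l2norm (u x) ^+ 2))%E.
    by apply: integral_ge0 => x _; rewrite expe_ge0// l2norm_ge0.
  by split=> //; rewrite ge0_fin_numE.
move: bound; rewrite -(fineK Mfin); set M := fine _ => bound.
have := bound (Num.truncn (M * t1)).+1.
rewrite lee_fin ler_pdivrMr// leNgt => /negP; apply.
by have := truncnS_gt (M * t1).
Qed.

Lemma l2_finite_support M (U : m.-tuple nat -> R[i]) :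
  (forall nu, (M <= multi_index_degree nu)%N -> U nu = 0) -> l2 U.
Proof. by move=> U0; rewrite /l2/= (l2norm_finite_support U0) ltry. Qed.

(** With finite support the l2 norm is a finite sum, so the control is continuous in s, hence
    strongly measurable, and it is bounded. *)
Lemma exponential_control_space M (c : m.-tuple nat -> R[i]) (r : m.-tuple nat -> R) :
  (forall nu, (M <= multi_index_degree nu)%N -> c nu = 0) -> (forall nu, 0 <= r nu) ->
  control_space t1 (fun s nu => (expR (r nu * (t1 - s)))%:C * c nu).
Proof.
move=> c0 r0; set u := fun s nu => _.
have u0 s nu : (M <= multi_index_degree nu)%N -> u s nu = 0.
  by move=> Mnu; rewrite /u c0// mulr0.
have normcM (x : R) (z : R[i]) : Normc.normc (x%:C * z) = `|x| * Normc.normc z.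
  case: z => z w; rewrite /Normc.normc/= !mul0r subr0 addr0 !exprMn -mulrDr.
  by rewrite sqrtrM ?sqr_ge0// sqrtr_sqr.
split.
  apply: strongly_measurable_continuous => // [s|s z zs].
    exact: l2_finite_support (u0 s).
  have d0 n nu : (M <= multi_index_degree nu)%N -> (u s - u (z n)) nu = 0.
    by move=> Mnu; rewrite -[LHS]/(u s nu - u (z n) nu) !u0// subr0.
  rewrite (_ : (fun n => _) = EFin \o (fun n => Num.sqrt (l2sum M (u s - u (z n))))); last first.
    by apply/funext => n; rewrite (l2norm_finite_support (d0 n)).
  apply: cvg_EFin; first by near=> n.
  rewrite (_ : _ \o _ = fun n => Num.sqrt (l2sum M (u s - u (z n))))//.
  rewrite -[X in _ --> X](@sqrtr0 R); apply: continuous_cvg; first exact: sqrt_continuous.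
  apply: cvg_l2sum => nu.
  rewrite (_ : (fun n => _) = fun n =>
      `|expR (r nu * (t1 - s)) - expR (r nu * (t1 - z n))| * Normc.normc (c nu)).
    have h : `|expR (r nu * (t1 - s)) - expR (r nu * (t1 - z n))| * Normc.normc (c nu) @[n --> \oo] -->
        `|expR (r nu * (t1 - s)) - expR (r nu * (t1 - s))| * Normc.normc (c nu).
      apply: cvgM; last exact: cvg_cst.
      apply: cvg_norm; apply: cvgB; first exact: cvg_cst.
      apply: continuous_cvg; first exact: continuous_expR.
      by apply: cvgM; [exact: cvg_cst|apply: cvgB => //; exact: cvg_cst].
    by rewrite subrr normr0 mul0r in h.
  apply/funext => n; rewrite -normcM; congr Normc.normc.
  by rewrite -[LHS]/(u s nu - u (z n) nu) /u rmorphB/= mulrBl.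
(* The squared norm at s = 0, where all the exponentials are largest on [0, t1]. *)
pose K := l2sum M (fun nu => (expR (r nu * t1))%:C * c nu).
rewrite (@le_lt_trans _ _ (\int[lebesgue_measure]_(x in I) K%:E)%E)//.
  apply: le_integral_pointwise => s sI; first by rewrite expe_ge0// l2norm_ge0.
  have /andP[s0 st] : 0 < s < t1 by move: sI; rewrite /= in_itv.
  rewrite (l2norm_finite_support (u0 s)) -EFin_expe lee_fin sqr_sqrtr; last first.
    by apply: sumr_ge0 => k _; apply: sumr_ge0 => *; exact: sqr_ge0.
  apply: ler_sum => k _; apply: ler_sum => nu _.
  rewrite /u !normcM ler_sqr ?nnegrE; last 2 first.
  - by rewrite mulr_ge0//; case: (c nu) => *; exact: sqrtr_ge0.
  - by rewrite mulr_ge0//; case: (c nu) => *; exact: sqrtr_ge0.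
  rewrite ler_wpM2r//; first by case: (c nu) => *; exact: sqrtr_ge0.
  by rewrite !ger0_norm ?expR_ge0// ler_expR ler_wpM2l// gerBl ltW.
have mI : measurable I by [].
rewrite (_ : (\int[lebesgue_measure]_(x in I) K%:E = K%:E * t1%:E)%E) ?ltry//.
exact: etrans (integral_cst _ mI _) (congr1 (fun z => _ * z)%E mIE).
Unshelve. all: by end_near. Qed.

Lemma approximate_control x0 x1 (e : R) : L2 mu x0 -> L2 mu x1 -> 0 < e ->
  exists u, control_space t1 u /\
    (L2norm mu (mild_solution mu S C x0 u t1 - x1)%R <= e%:E)%E.
Proof.
(* The part of the target that the integral has to produce. *)
move=> Lx0 Lx1 e0; pose w := x1 - S t1 x0.
have Lw : L2 mu w by apply: L2B => //; exact: L2_semigroup.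
have [s se] := phi_dense Lw e0.
set p := \sum_(x <- s) x.1 *: phi x.2 in se.
have Lp : L2 mu p by exact: L2comb.
pose M := \max_(x <- s) (multi_index_degree x.2).+1.
have p0 j : (M <= multi_index_degree j)%N -> inner p (phi j) = 0.
  move=> Mj; rewrite L2inner_sum//; last by move=> x; exact: L2Z.
  rewrite big_seq big1// => x xs; rewrite L2innerZ// phi_orthonormal.
  case: eqP => [xj|_]; last by rewrite mulr0.
  have : ((multi_index_degree x.2).+1 <= M)%N.
    exact: (@leq_bigmax_seq _ _ _ (fun x => (multi_index_degree x.2).+1)).
  by rewrite xj ltnNge Mj.
have [idx Eidx] := choice coverE.
(* Division by the coefficient of [b] undoes the control operator; division by [t1] accounts for the
   length of the interval. *)
pose c j := inner p (phi j) / (inner b (phi j) * t1%:C).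
have c0 j : (M <= multi_index_degree j)%N -> c j = 0 by move=> Mj; rewrite /c p0// mul0r.
pose u s j := (expR (lam (idx j) * (t1 - s)))%:C * c j.
exists u; split; first by apply: exponential_control_space c0 _.
pose v := (t1^-1)%:C *: p.
have Lv : L2 mu v by exact: L2Z.
pose g s := S (t1 - s) (C (u s)).
(* [g s'] and [v] have equal coefficients, which identifies them only up to norm zero: [S] and [C]
   return arbitrary representatives. *)
have gv s' : 0 < s' < t1 -> L2 mu (g s') /\ L2norm mu (g s' - v) = 0%E.
  move=> _; have Lg : L2 mu (g s') by exact: L2_semigroup.
  split=> //; rewrite L2normE; last exact: L2B.
  congr (_%:E); apply: orthogonal_rnorm0; first exact: L2B.
  move=> j; rewrite L2innerB// L2innerZ//.
  have u0 i : (M <= multi_index_degree i)%N -> u s' i = 0.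
    by move=> Mi; rewrite /u c0// mulr0.
  have Cu0 i : (M <= multi_index_degree i)%N -> inner (C (u s')) (phi i) = 0.
    by move=> Mi; rewrite (control_coef_fin u0) u0// mul0r.
  rewrite (semigroup_coef_fin _ Cu0 (Eidx j)) (control_coef_fin u0) /u !mulrA -rmorphM/=.
  rewrite -expRD mulNr addNr expR0 mul1r /c invfM -fmorphV.
  by apply/eqP; rewrite subr_eq0; apply/eqP; rewrite mulrA mulrAC divfK// mulrC.
have tv : t1%:C *: v = p.
  by rewrite scalerA -rmorphM/= mulfV ?gt_eqF// scale1r.
have gp : is_bochner_integral (L2 mu) (L2norm mu) `]0, t1[%classic g p.
  rewrite -tv; apply: bochner_integral_cst => //; first by rewrite tv.
  by rewrite L2normE; [rewrite /rnorm rinner0 sqrtr0|exact: L20].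
rewrite /mild_solution /bochner_integral -/g; case: xgetP => [y _ gy|/(_ p)]; last by [].
have [_ Ly _] := gy.
(* Bochner integrals are unique up to norm zero: |y - p|^2 is the difference of the pairings of [y]
   and [p] with [y - p], and both are integrals of the same function. *)
have yp : rnorm mu (y - p) = 0.
  have Lyp := L2B Ly Lp.
  rewrite /rnorm rinnerB//.
  have [_ <-] := bochner_rinner (measurable_itv _) Lyp gy.
  have [_ <-] := bochner_rinner (measurable_itv _) Lyp gp.
  by rewrite subrr sqrtr0.
have LS : L2 mu (S t1 x0) by exact: L2_semigroup.
rewrite (_ : S t1 x0 + y - x1 = (y - p) + (p - w)); last first.
  by rewrite [RHS]addrA subrK /w opprB [RHS]addrA (addrC y).
rewrite L2normE ?lee_fin; last by apply: L2D; exact: L2B.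
rewrite (le_trans (ler_rnormD _ _))//; try exact: L2B.
by rewrite yp add0r rnorm_distC.
Qed.

Theorem diagonal_controllability :
  approximately_controllable mu S C t1 /\ ~ exactly_controllable mu S C t1.
Proof.
split; last exact: not_exactly_controllable.
by move=> x0 x1 Lx0 Lx1 e; exact: approximate_control.
Qed.

End diagonal_control.

(** * Product measures and densities *)

Section integral_density.
Local Open Scope ereal_scope.
Context d (T : measurableType d) (R : realType).
Variables (mu : {measure set T -> \bar R}) (w : T -> R).
Hypotheses (mw : measurable_fun [set: T] w) (w0 : forall x, (0 <= w x)%R).
Local Notation nu := (density_measure mu mw w0).

Import HBNNSimple.

Let integral_density_nnsfun (h : {nnsfun T >-> R}) :
  \int[nu]_x (h x)%:E = \int[mu]_x ((h x)%:E * (w x)%:E).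
Proof.
transitivity (\sum_(r \in range h) r%:E * nu (h @^-1` [set r])).
  under eq_integral do rewrite fimfunE -fsumEFin//.
  rewrite ge0_integral_fsum//; last 2 first.
  - by move=> r; exact/measurable_EFinP/measurable_funM.
  - by move=> r x _; rewrite nnfun_muleindic_ge0.
  apply: eq_fsbigr => r _; rewrite integralZl_indic_nnsfun// integral_indic//=.
  by rewrite setIT.
transitivity (\int[mu]_x \sum_(r \in range h) ((r * \1_(h @^-1` [set r]) x * w x)%:E)).
  rewrite ge0_integral_fsum//; last 2 first.
  - by move=> r; apply/measurable_EFinP; apply: measurable_funM => //; exact: measurable_funM.
  - move=> r x _; rewrite EFinM mule_ge0 ?lee_fin//.
    by have := nnfun_muleindic_ge0 h r x; rewrite lee_fin.
  apply: eq_fsbigr => r rh; have r0 : (0 <= r)%R.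
    by move: rh => /set_mem[x _ <-].
  under [RHS]eq_integral do rewrite -mulrA EFinM.
  rewrite ge0_integralZl_EFin//; last 2 first.
  - by move=> x _; rewrite lee_fin mulr_ge0.
  - by apply/measurable_EFinP; exact: measurable_funM.
  congr (_ * _); rewrite /density_measure integral_mkcond.
  apply: eq_integral => x _; rewrite patchE indicE; case: ifPn => _.
    by rewrite mul1r.
  by rewrite mul0r.
apply: eq_integral => x _; rewrite fimfunE -EFinM fsumEFin//; congr EFin.
by rewrite !fsbig_finite// mulr_suml.
Qed.

(** From simple functions by monotone convergence. *)
Lemma ge0_integral_density (f : T -> \bar R) :
  measurable_fun [set: T] f -> (forall x, 0 <= f x) ->
  \int[nu]_x f x = \int[mu]_x (f x * (w x)%:E).
Proof.
move=> mf f0; pose f_ := nnsfun_approx measurableT mf.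
have f_f x : (f_ n x)%:E @[n --> \oo] --> f x.
  by apply: cvg_nnsfun_approx.
transitivity (limn (fun n => \int[nu]_x (f_ n x)%:E)).
  rewrite -monotone_convergence//.
  - by apply: eq_integral => x _; apply/esym/cvg_lim => //; exact: f_f.
  - by move=> n; exact/measurable_EFinP.
  - by move=> n x _; rewrite lee_fin.
  - by move=> x _ m n mn; rewrite lee_fin; exact/lefP/nd_nnsfun_approx.
transitivity (limn (fun n => \int[mu]_x ((f_ n x)%:E * (w x)%:E))).
  by congr (limn _); apply/funext => n; exact: integral_density_nnsfun.
rewrite -monotone_convergence//.
- apply: eq_integral => x _; apply/cvg_lim => //.
  by apply: cvgeZr.
- by move=> n; apply: emeasurable_funM; exact/measurable_EFinP.
- by move=> n x _; rewrite mule_ge0 ?lee_fin.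
- move=> x _ m n mn; rewrite lee_wpmul2r ?lee_fin//; exact/lefP/nd_nnsfun_approx.
Qed.

Lemma Rintegral_density (f : T -> R) : measurable_fun [set: T] f ->
  mu.-integrable [set: T] (fun x => (f x * w x)%:E) ->
  (\int[nu]_x f x = \int[mu]_x (f x * w x))%R.
Proof.
move=> mf fw; rewrite /Rintegral; congr fine.
rewrite integralE [RHS]integralE.
rewrite ge0_integral_density//; last by apply: measurable_funepos; exact/measurable_EFinP.
rewrite ge0_integral_density//; last by apply: measurable_funeneg; exact/measurable_EFinP.
congr (_ - _); apply: eq_integral => x _.
- by rewrite !funeposE -!EFin_max -EFinM maxr_pMl// mul0r.
- by rewrite !funenegE -!EFinN -!EFin_max -EFinM maxr_pMl// mul0r mulNr.
Qed.

End integral_density.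

Section integral_tuple.
Local Open Scope ereal_scope.
Context d (T : measurableType d) (R : realType) (n : nat).
Variable mu : {sigma_finite_measure set T -> \bar R}.
Variable nu : {sigma_finite_measure set (n.-tuple T) -> \bar R}.

Let cons_tuple (p : T * n.-tuple T) : n.+1.-tuple T := [tuple of p.1 :: p.2].

Let mcons_tuple : measurable_fun [set: T * n.-tuple T] cons_tuple.
Proof. exact: measurable_cons. Qed.

(** [cons_measure] is the image of a product measure, so this is Tonelli's theorem. *)
Lemma ge0_integral_cons (f : n.+1.-tuple T -> \bar R) :
  measurable_fun [set: n.+1.-tuple T] f -> (forall x, 0 <= f x) ->
  \int[cons_measure mu nu]_x f x = \int[mu]_x \int[nu]_y f [tuple of x :: y].
Proof.
move=> mf f0.
rewrite (@eq_measure_integral _ _ _ _ (pushforward (mu \x nu) cons_tuple))//.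
rewrite ge0_integral_pushforward//= fubini_tonelli1//.
by apply: measurableT_comp.
Qed.

Lemma integral_cons (f : n.+1.-tuple T -> \bar R) :
  measurable_fun [set: n.+1.-tuple T] f ->
  (cons_measure mu nu).-integrable setT f ->
  \int[cons_measure mu nu]_x f x = \int[mu]_x \int[nu]_y f [tuple of x :: y].
Proof.
move=> mf fi.
have fi' : (mu \x nu).-integrable setT (f \o cons_tuple).
  move/integrableP : fi => [_ fi]; apply/integrableP; split.
    by apply: measurableT_comp.
  rewrite (le_lt_trans _ fi)// ge0_integral_cons//; last exact: measurableT_comp.
  by rewrite fubini_tonelli1//; apply: measurableT_comp => //; exact: measurableT_comp.
rewrite (@eq_measure_integral _ _ _ _ (pushforward (mu \x nu) cons_tuple))//.
by rewrite integral_pushforward//= -integral12_prod_meas1.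
Qed.

End integral_tuple.

Section integral_prod.
Local Open Scope ereal_scope.
Context (R : realType).
Local Notation T := (measurableTypeR R).
Local Notation lambda := (@lebesgue_measure R).

Lemma measurable_prod_coord n (f : 'I_n -> T -> R) :
  (forall i, measurable_fun [set: T] (f i)) ->
  measurable_fun [set: n.-tuple T] (fun x => (\prod_(i < n) f i (tnth x i))%R).
Proof. exact: measurable_prod_tnth. Qed.

Let prod_cons n (f : 'I_n.+1 -> T -> R) x (y : n.-tuple T) :
  (\prod_(i < n.+1) f i (tnth [tuple of x :: y] i) =
   f ord0 x * \prod_(i < n) f (lift ord0 i) (tnth y i))%R.
Proof.
by rewrite big_ord_recl tnth0; congr (_ * _)%R; apply: eq_bigr => i _; rewrite tnthS.
Qed.

Lemma ge0_integral_prod n (f : 'I_n -> T -> R) :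
  (forall i, measurable_fun [set: T] (f i)) -> (forall i x, (0 <= f i x)%R) ->
  \int[lebesgue_tuple R n]_x (\prod_(i < n) f i (tnth x i))%:E =
  \prod_(i < n) \int[lambda]_x (f i x)%:E.
Proof.
elim: n f => [|n IH] f mf f0.
  rewrite big_ord0 /= integral_dirac// ?diracT ?mul1e ?big_ord0//.
  by apply/measurable_EFinP; exact: measurable_prod_coord.
rewrite big_ord_recl/= ge0_integral_cons//; last 2 first.
- by apply/measurable_EFinP; exact: measurable_prod_coord.
- by move=> x; rewrite lee_fin prodr_ge0.
set K := \prod_(i < n) _; have KE x : \int[lebesgue_tuple R n]_y
    (\prod_(i < n.+1) f i (tnth [tuple of x :: y] i))%:E = (f ord0 x)%:E * K.
  under eq_integral => y _ do rewrite prod_cons EFinM.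
  rewrite ge0_integralZl_EFin//; last 2 first.
  - by move=> y _; rewrite lee_fin prodr_ge0.
  - by apply/measurable_EFinP; exact: (measurable_prod_coord (f := fun i => f (lift ord0 i))).
  by congr (_ * _); exact: (IH (fun i => f (lift ord0 i))).
under eq_integral do rewrite KE.
rewrite ge0_integralZr//=.
- exact/measurable_EFinP.
- by move=> x _; rewrite lee_fin.
- by apply: prode_ge0 => i _; apply: integral_ge0 => x _; rewrite lee_fin.
Qed.

Lemma integrable_prod n (f : 'I_n -> T -> R) :
  (forall i, lambda.-integrable [set: T] (EFin \o f i)) ->
  (lebesgue_tuple R n).-integrable [set: n.-tuple T]
    (fun x => (\prod_(i < n) f i (tnth x i))%:E).
Proof.
move=> fi; have mf i : measurable_fun [set: T] (f i).
  by apply/measurable_EFinP; exact: measurable_int (fi i).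
apply/integrableP; split; first by apply/measurable_EFinP; exact: measurable_prod_coord.
under eq_integral do rewrite abse_EFin normr_prod.
rewrite (ge0_integral_prod (f := fun i x => `|f i x|%R))//; last first.
  by move=> i; exact: measurableT_comp.
rewrite (eq_bigr (fun i => (fine (\int[lambda]_x `|f i x|%:E))%:E)) ?prodEFin ?ltry// => i _.
by rewrite fineK// ge0_fin_numE ?integral_ge0//; have /integrableP[] := fi i.
Qed.

Lemma integral_prod n (f : 'I_n -> T -> R) :
  (forall i, lambda.-integrable [set: T] (EFin \o f i)) ->
  \int[lebesgue_tuple R n]_x (\prod_(i < n) f i (tnth x i))%:E =
  (\prod_(i < n) (\int[lambda]_x (f i x))%R)%:E.
Proof.
elim: n f => [|n IH] f fi; have mf i : measurable_fun [set: T] (f i)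
  by apply/measurable_EFinP; exact: measurable_int (fi i).
  rewrite big_ord0 /= integral_dirac// ?diracT ?mul1e ?big_ord0//.
  by apply/measurable_EFinP; exact: measurable_prod_coord.
have fI := integrable_prod fi.
rewrite big_ord_recl/= integral_cons//; last first.
  by apply/measurable_EFinP; exact: measurable_prod_coord.
have fi' : (lebesgue_tuple R n).-integrable [set: n.-tuple T]
    (fun x => (\prod_(i < n) f (lift ord0 i) (tnth x i))%:E).
  exact: (integrable_prod (f := fun i => f (lift ord0 i))).
set K := (\prod_(i < n) _)%R; have KE x : \int[lebesgue_tuple R n]_y
    (\prod_(i < n.+1) f i (tnth [tuple of x :: y] i))%:E = (f ord0 x)%:E * K%:E.
  under eq_integral => y _ do rewrite prod_cons EFinM.
  rewrite integralZl//.
  by congr (_ * _); exact: (IH (fun i => f (lift ord0 i))).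
under eq_integral do rewrite KE.
rewrite (integralZr measurableT (fi ord0)) EFinM; congr (_ * _).
rewrite /Rintegral fineK//; apply: integrable_fin_num => //; exact: fi.
Qed.

End integral_prod.

(** * Mean-square closure of a span *)

Section span.
Context (R : realType) (T I : Type) (F : I -> T -> R).

Definition rspan : set (T -> R) :=
  [set g | exists s : seq (R * I), g = fun t => \sum_(x <- s) x.1 * F x.2 t].

Lemma rspan1 i : rspan (F i).
Proof. by exists [:: (1, i)]; apply/funext => t; rewrite big_seq1 mul1r. Qed.

Lemma rspan0 : rspan (fun=> 0).
Proof. by exists [::]; apply/funext => t; rewrite big_nil. Qed.

Lemma rspanD f g : rspan f -> rspan g -> rspan (fun t => f t + g t).
Proof.
by move=> [s ->] [s' ->]; exists (s ++ s'); apply/funext => t; rewrite big_cat.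
Qed.

Lemma rspanZ a f : rspan f -> rspan (fun t => a * f t).
Proof.
move=> [s ->]; exists [seq (a * x.1, x.2) | x <- s]; apply/funext => t.
by rewrite big_map mulr_sumr; apply: eq_bigr => x _; rewrite mulrA.
Qed.

End span.

Section mean_square_closure.
Context d (T : measurableType d) (R : realType) (I : Type).
Variables (mu : {measure set T -> \bar R}) (F : I -> T -> R).
Hypothesis mF : forall i, measurable_fun [set: T] (F i).
Implicit Types f g : T -> R.

Definition sqint f : \bar R := (\int[mu]_x ((f x) ^+ 2)%:E)%E.

(** Distances are squared and extended-real, so membership of [f] in L2 is not presupposed; it
    follows once the generators are square-integrable ([sqint_msclosure_lty]). *)
Definition msclosure : set (T -> R) := [set f : T -> R | measurable_fun [set: T] f /\
  forall e : R, 0 < e -> exists2 g, rspan F g & (sqint (fun x => f x - g x)%R <= e%:E)%E].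

Lemma sqint_ge0 f : (0 <= sqint f)%E.
Proof. by apply: integral_ge0 => x _; rewrite lee_fin sqr_ge0. Qed.

Lemma measurable_sqr f : measurable_fun [set: T] f ->
  measurable_fun [set: T] (fun x => ((f x) ^+ 2)%:E).
Proof. by move=> mf; apply/measurable_EFinP; exact: measurable_funX. Qed.

(** (f + g)^2 <= 2 f^2 + 2 g^2 stands in for the triangle inequality and avoids square roots; it is
    the origin of the bounds e / 4 below. *)
Lemma sqintD f g : measurable_fun [set: T] f -> measurable_fun [set: T] g ->
  (sqint (fun x => f x + g x)%R <= 2%:E * sqint f + 2%:E * sqint g)%E.
Proof.
move=> mf mg; have mf2 := measurable_sqr mf; have mg2 := measurable_sqr mg.
have sq0 (h : T -> R) x : (0 <= ((h x) ^+ 2)%:E)%E by rewrite lee_fin sqr_ge0.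
rewrite /sqint -!ge0_integralZl_EFin// -ge0_integralD//=; last 4 first.
- by move=> x _; rewrite -EFinM lee_fin mulr_ge0// sqr_ge0.
- by apply/measurable_EFinP; apply: measurable_funM => //; exact: measurable_funX.
- by move=> x _; rewrite -EFinM lee_fin mulr_ge0// sqr_ge0.
- by apply/measurable_EFinP; apply: measurable_funM => //; exact: measurable_funX.
apply: ge0_le_integral => //.
- by move=> x _; rewrite lee_fin sqr_ge0.
- by apply: measurable_sqr; exact: measurable_funD.
- by apply: emeasurable_funD; apply: emeasurable_funM.
- move=> x _; rewrite -!EFinM -EFinD lee_fin.
  by have := sqr_ge0 (f x - g x); rewrite sqrrB sqrrD; lra.
Qed.

Lemma sqintZ a f : measurable_fun [set: T] f ->
  sqint (fun x => a * f x)%R = ((a ^+ 2)%:E * sqint f)%E.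
Proof.
move=> mf; rewrite /sqint -ge0_integralZl_EFin ?sqr_ge0//.
- by apply: eq_integral => x _; rewrite exprMn.
- by move=> x _; rewrite lee_fin sqr_ge0.
- exact: measurable_sqr.
Qed.

Lemma measurable_rspan g : rspan F g -> measurable_fun [set: T] g.
Proof.
move=> [s ->]; apply: measurable_sum => x.
by apply: measurable_funM.
Qed.

Lemma msclosure_rspan g : rspan F g -> msclosure g.
Proof.
move=> Fg; split; first exact: measurable_rspan.
move=> e e0; exists g => //; rewrite /sqint; under eq_integral do rewrite subrr expr0n/=.
by rewrite integral0 lee_fin ltW.
Qed.

Lemma msclosureD f g : msclosure f -> msclosure g -> msclosure (fun x => f x + g x).
Proof.
move=> [mf cf] [mg cg]; split; first exact: measurable_funD.
move=> e e0; have e4 : 0 < e / 4 by rewrite divr_gt0.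
have [p Fp fp] := cf _ e4; have [q Fq gq] := cg _ e4.
exists (fun x => p x + q x); first exact: rspanD.
have mp := measurable_rspan Fp; have mq := measurable_rspan Fq.
rewrite (_ : (fun x => _) = (fun x => (f x - p x) + (g x - q x))); last first.
  by apply/funext => x; ring.
apply: (le_trans (sqintD _ _)); try exact: measurable_funB.
rewrite (_ : e%:E = 2%:E * (e / 4)%:E + 2%:E * (e / 4)%:E)%E; last first.
  by rewrite -!EFinM -EFinD; congr EFin; field.
by apply: leeD; rewrite lee_pmul2l.
Qed.

Lemma msclosureZ a f : msclosure f -> msclosure (fun x => a * f x).
Proof.
move=> [mf cf]; split; first exact: measurable_funM.
(* Dividing by a^2 + 1 instead of a^2 avoids a separate case a = 0. *)
move=> e e0; have ea : 0 < e / (a ^+ 2 + 1).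
  by rewrite divr_gt0// ltr_wpDl ?sqr_ge0.
have [p Fp fp] := cf _ ea; exists (fun x => a * p x); first exact: rspanZ.
have mp := measurable_rspan Fp.
rewrite (_ : (fun x => _) = (fun x => a * (f x - p x))); last first.
  by apply/funext => x; rewrite mulrBr.
rewrite sqintZ; last exact: measurable_funB.
apply: (@le_trans _ _ ((a ^+ 2)%:E * (e / (a ^+ 2 + 1))%:E)%E).
  by rewrite lee_wpmul2l// lee_fin sqr_ge0.
rewrite -EFinM lee_fin mulrA ler_pdivrMr ?ltr_wpDl ?sqr_ge0//.
by rewrite mulrC ler_wpM2l ?lerDl// ltW.
Qed.

Lemma msclosureB f g : msclosure f -> msclosure g -> msclosure (fun x => f x - g x).
Proof.
move=> cf cg; have := msclosureD cf (msclosureZ (-1) cg).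
by under eq_fun do rewrite mulN1r.
Qed.

Lemma msclosure_sum J (r : seq J) (f : J -> T -> R) :
  (forall j, msclosure (f j)) -> msclosure (fun x => \sum_(j <- r) f j x).
Proof.
move=> cf; elim: r => [|j r IH].
  under eq_fun do rewrite big_nil; apply: msclosure_rspan; exact: rspan0.
by under eq_fun do rewrite big_cons; exact: msclosureD.
Qed.

Lemma msclosure_limit f : measurable_fun [set: T] f ->
  (forall e : R, 0 < e -> exists2 g, msclosure g & (sqint (fun x => f x - g x)%R <= e%:E)%E) ->
  msclosure f.
Proof.
move=> mf cf; split => // e e0; have e4 : 0 < e / 4 by rewrite divr_gt0.
have [g cg fg] := cf _ e4; have [mg _] := cg.
have [p Fp gp] := cg.2 _ e4; exists p => //; have mp := measurable_rspan Fp.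
rewrite (_ : (fun x => _) = (fun x => (f x - g x) + (g x - p x))); last first.
  by apply/funext => x; ring.
apply: (le_trans (sqintD _ _)); try exact: measurable_funB.
rewrite (_ : e%:E = 2%:E * (e / 4)%:E + 2%:E * (e / 4)%:E)%E; last first.
  by rewrite -!EFinM -EFinD; congr EFin; field.
by apply: leeD; rewrite lee_pmul2l.
Qed.

(** Dominated convergence for (f - f_n)^2 <= 4 G^2; the bound on [f] itself is inherited in the
    limit. *)
Lemma msclosure_dominated (f_ : nat -> T -> R) f G : (forall n, msclosure (f_ n)) ->
  measurable_fun [set: T] f -> measurable_fun [set: T] G ->
  {ae mu, forall x, f_ n x @[n --> \oo] --> f x} ->
  {ae mu, forall x n, `|f_ n x| <= G x} ->
  (sqint G < +oo)%E -> msclosure f.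
Proof.
move=> cf mf mG f_f f_G G2; apply: msclosure_limit => // e e0.
have mf_ n : measurable_fun [set: T] (f_ n) by have [] := cf n.
have [_ _ lim0] : [/\ mu.-integrable setT (cst 0%E : T -> \bar R),
    (\int[mu]_x `|((f x - f_ n x) ^+ 2)%:E - 0%E| @[n --> \oo] --> 0)%E &
    (\int[mu]_x ((f x - f_ n x) ^+ 2)%:E @[n --> \oo] --> \int[mu]_x cst 0%E x)%E].
  apply: (@dominated_convergence _ _ _ _ _ _ _ _ (fun x => (4 * (G x) ^+ 2)%:E)) => //.
  - by move=> n; apply: measurable_sqr; exact: measurable_funB.
  - apply: filterS f_f => x f_fx _ /=.
    have h : (f x - f_ n x) ^+ 2 @[n --> \oo] --> (f x - f x) ^+ 2.
      by apply: cvgM; apply: cvgB => //; exact: cvg_cst.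
    by rewrite subrr expr0n/= in h; apply: cvg_EFin => //; near=> n.
  - apply/integrableP; split.
      by apply/measurable_EFinP; apply: measurable_funM => //; exact: measurable_funX.
    under eq_integral => x _.
      rewrite gee0_abs; last by rewrite lee_fin mulr_ge0// sqr_ge0.
      rewrite EFinM; over.
    rewrite ge0_integralZl_EFin//; last 2 first.
    + by move=> x _; rewrite lee_fin sqr_ge0.
    + exact: measurable_sqr.
    by rewrite lte_mul_pinfty.
  - apply: filterS2 f_f f_G => x f_fx f_Gx n _.
    have fG : `|f x| <= G x.
      have h : `|f_ n x| @[n --> \oo] --> `|f x| by apply: cvg_norm.
      rewrite -(cvg_lim _ h)//; apply: limr_le; first by apply/cvg_ex; exists `|f x|.
      by near=> k.
    rewrite gee0_abs ?lee_fin ?sqr_ge0//.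
    rewrite (_ : 4 * _ = (2 * G x) ^+ 2); last by rewrite exprMn -natrX.
    rewrite -[leLHS]real_normK ?num_real// ler_sqr ?nnegrE//; last first.
      by rewrite mulr_ge0// (le_trans _ fG).
    by rewrite (le_trans (ler_normB _ _))// mulr_natl mulr2n lerD.
rewrite integral0 in lim0.
have [n _ /(_ n (leqnn _)) sn] := cvge0_near_lt lim0 e0.
by exists (f_ n) => //; exact: ltW.
Unshelve. all: by end_near. Qed.

End mean_square_closure.

Section finite_mean_square.
Context d (T : measurableType d) (R : realType) (I : Type).
Variables (mu : {measure set T -> \bar R}) (F : I -> T -> R).
Hypothesis mF : forall i, measurable_fun [set: T] (F i).
Hypothesis F2 : forall i, (sqint mu (F i) < +oo)%E.

Lemma sqint_rspan_lty g : rspan F g -> (sqint mu g < +oo)%E.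
Proof.
move=> [s ->]; elim: s => [|x s IH].
  under eq_fun do rewrite big_nil.
  by rewrite /sqint; under eq_integral do rewrite expr0n/=; rewrite integral0.
under eq_fun do rewrite big_cons.
have m1 : measurable_fun [set: T] (fun t => x.1 * F x.2 t) by exact: measurable_funM.
have m2 : measurable_fun [set: T] (fun t => \sum_(y <- s) y.1 * F y.2 t).
  by apply: measurable_sum => y; exact: measurable_funM.
apply: le_lt_trans (sqintD _ m1 m2) _.
rewrite sqintZ// lte_add_pinfty// lte_mul_pinfty//.
by rewrite lte_mul_pinfty// lee_fin sqr_ge0.
Qed.

Lemma sqint_msclosure_lty f : msclosure mu F f -> (sqint mu f < +oo)%E.
Proof.
move=> [mf /(_ _ ltr01)[g Fg fg]]; have mg := measurable_rspan mF Fg.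
rewrite (_ : f = fun x => (f x - g x) + g x); last by apply/funext => x; rewrite subrK.
apply: le_lt_trans (sqintD _ _ mg) _; first exact: measurable_funB.
rewrite lte_add_pinfty// lte_mul_pinfty//; first by rewrite (le_lt_trans fg) ?ltry.
exact: sqint_rspan_lty.
Qed.

End finite_mean_square.

(** * Tensor products and density in several variables *)

Section tensor.
Context (R : realType) (d : nat).
Local Notation T := (measurableTypeR R).
Local Notation lambda := (@lebesgue_measure R).
Variables (w : 'I_d -> T -> R).
Hypotheses (mw : forall i, measurable_fun [set: T] (w i)) (w0 : forall i x, 0 <= w i x).
Hypotheses
  (mW : measurable_fun [set: d.-tuple T] (fun x => \prod_(i < d) w i (tnth x i)))
  (W0 : forall x : d.-tuple T, 0 <= \prod_(i < d) w i (tnth x i)).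
Local Notation mu := (density_measure (lebesgue_tuple R d) mW W0).
Local Notation nu i := (density_measure lambda (mw i) (w0 i)).

Definition tensor (f : 'I_d -> T -> R) (x : d.-tuple T) : R :=
  \prod_(i < d) f i (tnth x i).

Lemma measurable_tensor f : (forall i, measurable_fun [set: T] (f i)) ->
  measurable_fun [set: d.-tuple T] (tensor f).
Proof. exact: measurable_prod_tnth. Qed.

Lemma sqint_tensor f : (forall i, measurable_fun [set: T] (f i)) ->
  sqint mu (tensor f) = (\prod_(i < d) sqint (nu i) (f i))%E.
Proof.
move=> mf; rewrite /sqint ge0_integral_density; last 2 first.
- by apply: measurable_sqr; exact: measurable_tensor.
- by move=> x; rewrite lee_fin sqr_ge0.
under eq_integral do rewrite -EFinM /tensor -prodrXl -big_split/=.
rewrite (ge0_integral_prod (f := fun i x => f i x ^+ 2 * w i x)).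
- apply: eq_bigr => i _; rewrite ge0_integral_density; last 2 first.
  + exact: measurable_sqr.
  + by move=> x; rewrite lee_fin sqr_ge0.
  by apply: eq_integral => x _; rewrite EFinM.
- by move=> i; apply: measurable_funM => //; exact: measurable_funX.
- by move=> i x; rewrite mulr_ge0// sqr_ge0.
Qed.

Variable l : 'I_d -> nat -> T -> R.
Hypothesis ml : forall i k, measurable_fun [set: T] (l i k).
Hypothesis l2 : forall i k, (sqint (nu i) (l i k) < +oo)%E.

Definition tensor_basis (ks : d.-tuple nat) : d.-tuple T -> R :=
  tensor (fun i => l i (tnth ks i)).

Lemma measurable_tensor_basis ks : measurable_fun [set: d.-tuple T] (tensor_basis ks).
Proof. exact: measurable_tensor. Qed.

Let subst (f : 'I_d -> T -> R) j (h : T -> R) i := if i == j then h else f i.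

Let tensor_subst f j h x : tensor (subst f j h) x =
  h (tnth x j) * \prod_(i < d | i != j) f i (tnth x i).
Proof.
rewrite /tensor (bigD1 j)//= /subst eqxx; congr (_ * _).
by apply: eq_bigr => i /negPf ->.
Qed.

Let subst_id f j : subst f j (f j) = f.
Proof. by apply/funext => i; rewrite /subst; case: eqP => [->|]. Qed.

(* one coordinate after the other is moved from the generators to the closure *)
Lemma msclosure_tensor f : (forall i, msclosure (nu i) (l i) (f i)) ->
  msclosure mu tensor_basis (tensor f).
Proof.
suff key j (g : 'I_d -> T -> R) : (forall i : 'I_d, (i < j)%N -> msclosure (nu i) (l i) (g i)) ->
    (forall i : 'I_d, (j <= i)%N -> exists k, g i = l i k) -> msclosure mu tensor_basis (tensor g).
  by move=> cf; apply: (key d) => // i; rewrite leqNgt ltn_ord.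
elim: j g => [|j IH] g cg lg.
  have [k gk] := choice (fun i => lg i (leq0n i)).
  rewrite (_ : tensor g = tensor_basis [tuple k i | i < d]); last first.
    by rewrite /tensor_basis; congr tensor; apply/funext => i; rewrite tnth_mktuple gk.
  by apply: msclosure_rspan; [exact: measurable_tensor_basis|exact: rspan1].
have [jd|dj] := ltnP j d; last first.
  apply: IH => i ij; last by have := leq_trans dj ij; rewrite leqNgt ltn_ord.
  by apply: cg; rewrite ltnS ltnW.
pose J := Ordinal jd.
have cgall i : msclosure (nu i) (l i) (g i).
  have [ij|ji] := ltnP i j.+1; first exact: cg.
  by have [k ->] := lg i ji; apply: msclosure_rspan; [exact: ml|exact: rspan1].
have mg i : measurable_fun [set: T] (g i) by have [] := cgall i.
apply: msclosure_limit; [exact: measurable_tensor_basis|exact: measurable_tensor|].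
(* The squared norm of a tensor product is the product of those of its factors; [C] collects all but
   the [J]-th, and the 1 in [C + 1] covers C = 0. *)
move=> e e0; set C := (\prod_(i < d | i != J) fine (sqint (nu i) (g i))).
have C0 : 0 <= C by apply: prodr_ge0 => i _; rewrite fine_ge0// sqint_ge0.
have eC : 0 < e / (C + 1) by rewrite divr_gt0// ltr_wpDl.
have [q [s qE] gq] := (cgall J).2 _ eC.
have mq : measurable_fun [set: T] q by apply: (measurable_rspan (ml J)); exists s.
exists (tensor (subst g J q)).
  rewrite (_ : tensor _ = fun x => \sum_(y <- s) y.1 * tensor (subst g J (l J y.2)) x); last first.
    apply/funext => x; rewrite tensor_subst qE mulr_suml.
    by apply: eq_bigr => y _; rewrite tensor_subst mulrA.
  apply: msclosure_sum => [|y]; first exact: measurable_tensor_basis.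
  apply: msclosureZ; first exact: measurable_tensor_basis.
  apply: IH => i ij.
    rewrite /subst; case: eqP => [iJ|_]; last exact: cgall.
    by move: ij; rewrite iJ ltnn.
  rewrite /subst; case: eqP => [->|/eqP iJ]; first by exists y.2.
  by apply: lg; rewrite ltn_neqAle ij andbT; move: iJ; rewrite -val_eqE/= eq_sym.
have -> : (fun x => tensor g x - tensor (subst g J q) x) =
    tensor (subst g J (fun x => g J x - q x)).
  by apply/funext => x; rewrite -{1}(subst_id g J) !tensor_subst mulrBl.
rewrite sqint_tensor; last first.
  by move=> i; rewrite /subst; case: eqP => // _; exact: measurable_funB.
rewrite (bigD1 J)//= {1}/subst eqxx.
rewrite (eq_bigr (fun i => (fine (sqint (nu i) (g i)))%:E)); last first.
  move=> i /negPf iJ; rewrite /subst iJ fineK// ge0_fin_numE ?sqint_ge0//.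
  exact: (sqint_msclosure_lty (mu := nu i) (ml i) (l2 i) (cgall i)).
rewrite prodEFin -/C (@le_trans _ _ ((e / (C + 1))%:E * C%:E)%E)//.
  by rewrite lee_wpmul2r.
rewrite -EFinM lee_fin mulrAC ler_pdivrMr ?ltr_wpDl//.
by rewrite ler_wpM2l ?lerDl// ltW.
Qed.

Hypothesis ray_closure : forall i (B : set T),
  B = setT \/ (exists c : R, B = `]c, +oo[%classic) -> msclosure (nu i) (l i) (\1_B).

(** A pi-system generating the measurable sets: the intersection of two rays is a ray, and [setT]
    leaves a coordinate free. *)
Let boxes : set (set (d.-tuple T)) := [set A | exists B : 'I_d -> set T,
  (forall i, B i = setT \/ exists c : R, B i = `]c, +oo[%classic) /\
  A = [set x | forall i, B i (tnth x i)]].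

Let boxes_setI : setI_closed boxes.
Proof.
move=> _ _ [B [hB ->]] [B' [hB' ->]]; exists (fun i => B i `&` B' i); split => [i|].
  have [->|[c ->]] := hB i; first by rewrite setTI; exact: hB'.
  have [->|[c' ->]] := hB' i; first by rewrite setIT; right; exists c.
  right; exists (Num.max c c'); apply/seteqP; split => x /=; rewrite !in_itv/= !andbT.
    by move=> [? ?]; rewrite gt_max; apply/andP.
  by rewrite gt_max => /andP.
apply/seteqP; split => x /=; first by move=> [h1 h2] i; split.
by move=> h; split=> i; have [] := h i.
Qed.

Let measurable_boxes : @measurable _ (d.-tuple T) = <<s boxes >>.
Proof.
apply/seteqP; split; last first.
  apply: smallest_sub; first exact: sigma_algebra_measurable.
  move=> _ [B [hB ->]].
  rewrite (_ : [set x | _] = 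
      \bigcap_(i in [set: 'I_d]) ((fun x : d.-tuple T => tnth x i) @^-1` B i)); last first.
    by apply/seteqP; split => x /= h i; [move=> _; exact: h|exact: (h i)].
  apply: fin_bigcap_measurable; first exact: finite_finset.
  move=> i _; rewrite -[X in measurable X]setTI; apply: measurable_tnth => //.
  by have [->//|[c ->]] := hB i; exact: measurable_itv.
apply: smallest_sub; first exact: smallest_sigma_algebra.
elim/big_ind : _ => [|X Y hX hY A [/hX//|/hY//]|i _]; first exact: sub0set.
move=> _ [B + <-]; rewrite setTI RGenOInfty.measurableE => mB.
have [S0 SC SU] := smallest_sigma_algebra [set: d.-tuple T] boxes.
(* Sets whose cylinder in direction [i] is generated by boxes: a sigma-algebra containing the
   rays. *)
pose pre := [set B : set T | <<s boxes >> ((fun x : d.-tuple T => tnth x i) @^-1` B)].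
have : <<s @RGenOInfty.G R >> `<=` pre.
  apply: smallest_sub.
    split=> [|C preC|F preF]; first exact: S0.
    - by have := SC _ preC; rewrite !setTD.
    - by rewrite /pre/= preimage_bigcup; exact: SU.
  move=> _ [c ->]; apply: sub_sigma_algebra.
  exists (fun j => if j == i then `]c, +oo[%classic else setT); split.
    by move=> j; case: ifP => _; [right; exists c|left].
  apply/seteqP; split => x /= h; last by have := h i; rewrite eqxx.
  by move=> j; case: eqP => // ->.
by apply.
Qed.

Let tensor_indic (B : 'I_d -> set T) :
  tensor (fun i => \1_(B i)) = \1_[set x : d.-tuple T | forall i, B i (tnth x i)].
Proof.
apply/funext => x; rewrite /tensor indicE.
have [hx|hx] := boolP (x \in [set x : d.-tuple T | forall i, B i (tnth x i)]).
  by rewrite big1// => i _; rewrite indicE mem_set//; move/set_mem : hx.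
have /existsNP[i Bi] : ~ forall i, B i (tnth x i).
  by move=> h; move/negP : hx; apply; exact/mem_set.
by rewrite (bigD1 i)//= indicE memNset// mul0r.
Qed.

Hypothesis w_fin : forall i, (\int[lambda]_x (w i x)%:E < +oo)%E.

Let mu_fin : (mu [set: d.-tuple T] < +oo)%E.
Proof.
have := sqint_tensor (f := fun=> cst 1) (fun=> measurable_cst _).
rewrite /sqint (_ : (fun x => _) = cst 1%E); last first.
  by apply/funext => x; rewrite /tensor big1 ?expr1n.
rewrite integral_cst// mul1e => ->.
rewrite (eq_bigr (fun i => (fine (\int[lambda]_x (w i x)%:E))%:E)) ?prodEFin ?ltry// => i _.
rewrite ge0_integral_density; last 2 first.
- exact: measurable_sqr (measurable_cst _).
- by move=> x; rewrite lee_fin sqr_ge0.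
under eq_integral do rewrite expr1n mul1e.
by rewrite fineK// ge0_fin_numE// integral_ge0// => x _; rewrite lee_fin.
Qed.

Let mbasis := measurable_tensor_basis.

Let cst_closure : msclosure mu tensor_basis (cst 1).
Proof.
rewrite (_ : cst 1 = tensor (fun i => \1_([set: T]))).
  by apply: msclosure_tensor => i; apply: ray_closure; left.
by apply/funext => x; rewrite /tensor big1// => i _; rewrite indicE mem_set.
Qed.

Let sqint_cst1 : (sqint mu (cst 1%R) < +oo)%E.
Proof.
apply: le_lt_trans mu_fin; rewrite -[leRHS]mul1e -integral_cst//.
by apply: le_integral_pointwise => x _; rewrite lee_fin ?sqr_ge0// expr1n.
Qed.

(** Constants handle complements; for disjoint unions the partial sums of indicators are bounded by
    1, which is square-integrable since [mu] is finite. *)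
Lemma msclosure_indic (A : set (d.-tuple T)) : measurable A ->
  msclosure mu tensor_basis (\1_A).
Proof.
rewrite measurable_boxes; move: A; apply: (dynkin_induction measurable_boxes boxes_setI) => //.
- by rewrite (_ : \1_(_) = cst 1)//; apply/funext => x; rewrite indicE mem_set.
- move=> _ [B [hB ->]]; rewrite -tensor_indic; apply: msclosure_tensor => i.
  exact: ray_closure.
- move=> A mA cA; rewrite (_ : \1_(_) = fun x => 1 - \1_A x).
    exact: msclosureB.
  by apply/funext => x; rewrite !indicE in_setC; case: (x \in A); rewrite ?subrr ?subr0.
- move=> A mA tA cA.
  apply: (@msclosure_dominated _ _ _ _ mu tensor_basis mbasis
    (fun n x => \sum_(k < n) \1_(A k) x) _ (cst 1)) => //.
  + by move=> n; apply: msclosure_sum.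
  + by apply: measurable_indic; exact: bigcup_measurable.
  + apply: aeW => x; have [[k _ Akx]|nAx] := pselect ((\bigcup_k A k) x).
      rewrite indicE mem_set; last by exists k.
      apply: cvg_near_cst; exists k.+1 => // n /= kn.
      rewrite (bigD1 (Ordinal kn))//= indicE mem_set// big1 ?addr0// => j jk.
      rewrite indicE memNset// => Ajx.
      move: jk; rewrite -val_eqE/= => /eqP; apply.
      by apply: (tA j k) => //; exists x.
    rewrite indicE memNset//; apply: cvg_near_cst; near=> n.
    by rewrite big1// => k _; rewrite indicE memNset// => Akx; apply: nAx; exists k.
  + apply: aeW => x n /=; rewrite ger0_norm ?sumr_ge0//.
    have [[k Akx]|nAx] := pselect (exists k : 'I_n, A k x).
      rewrite (bigD1 k)//= indicE mem_set// big1 ?addr0// => j jk.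
      rewrite indicE memNset// => Ajx.
      move: jk; rewrite -val_eqE/= => /eqP; apply.
      by apply: (tA j k) => //; exists x.
    by rewrite big1// => k _; rewrite indicE memNset// => Akx; apply: nAx; exists k.
Unshelve. all: by end_near. Qed.

Import HBNNSimple.

(** The increasing simple approximations are dominated by [f] itself. *)
Let msclosure_ge0 (f : d.-tuple T -> R) : measurable_fun [set: d.-tuple T] f ->
  (forall x, 0 <= f x) -> (sqint mu f < +oo)%E -> msclosure mu tensor_basis f.
Proof.
move=> mf f0 f2.
have mef : measurable_fun [set: d.-tuple T] (EFin \o f) by exact/measurable_EFinP.
pose f_ := nnsfun_approx measurableT mef.
have f_f x : f_ n x @[n --> \oo] --> f x.
  have : (f_ n x)%:E @[n --> \oo] --> (f x)%:E.
    by apply: (cvg_nnsfun_approx measurableT mef) => // y _; rewrite lee_fin.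
  by move/fine_cvgP => [].
apply: (@msclosure_dominated _ _ _ _ mu tensor_basis mbasis f_ f f) => //.
- move=> n; rewrite (_ : (f_ n : _ -> _) = fun x =>
    \sum_(r <- fset_set (range (f_ n))) r * \1_(f_ n @^-1` [set r]) x).
    by apply: msclosure_sum => // r; apply: msclosureZ => //; exact: msclosure_indic.
  by apply/funext => x; rewrite fimfunE fsbig_finite.
- exact: aeW.
- apply: aeW => x n; rewrite ger0_norm// -(cvg_lim _ (f_f x))//.
  apply: nondecreasing_cvgn_le => [a b ab|]; first exact/lefP/nd_nnsfun_approx.
  by apply/cvg_ex; exists (f x).
Qed.

Lemma msclosure_sqint (f : d.-tuple T -> R) : measurable_fun [set: d.-tuple T] f ->
  (sqint mu f < +oo)%E -> msclosure mu tensor_basis f.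
Proof.
move=> mf f2; rewrite (_ : f = fun x => Num.max (f x) 0 - Num.max (- f x) 0); last first.
  by apply/funext => x; have [|] := leP 0 (f x) => ?; case: (leP (- f x) 0) => ?; lra.
have sq_max (g : d.-tuple T -> R) : measurable_fun [set: d.-tuple T] g ->
    (sqint mu g < +oo)%E -> msclosure mu tensor_basis (fun x => Num.max (g x) 0).
  move=> mg g2; have mmax : measurable_fun [set: d.-tuple T] (fun x => Num.max (g x) 0).
    exact: measurable_maxr.
  apply: msclosure_ge0 => // [x|]; first by rewrite le_max lexx orbT.
  apply: le_lt_trans g2; apply: ge0_le_integral => //.
  - by move=> x _; rewrite lee_fin sqr_ge0.
  - exact: measurable_sqr.
  - exact: measurable_sqr.
  - by move=> x _; rewrite lee_fin; case: (leP (g x) 0) => // _; rewrite expr2 mulr0 sqr_ge0.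
apply: msclosureB => //; apply: sq_max => //; first exact: measurableT_comp.
by rewrite /sqint; under eq_integral do rewrite sqrrN.
Qed.

End tensor.

(** * From real to complex square-integrable functions *)

Section complex_mean_square.
Local Open Scope complex_scope.
Context d (T : measurableType d) (R : realType).
Variable mu : {measure set T -> \bar R}.

Lemma Lfun2P (f : T -> R) :
  f \in Lfun mu 2%:E <-> measurable_fun [set: T] f /\ (sqint mu f < +oo)%E.
Proof.
split=> [Lf|[mf f2]].
  have /integrableP[_ f2] := Lfun2_integrable_sqr Lf; split.
    by have := sub_Lfun_mfun Lf; rewrite classical_sets.inE.
  apply: le_lt_trans f2; rewrite le_eqVlt; apply/orP; left; apply/eqP.
  by apply: eq_integral => x _; rewrite /= ger0_norm// sqr_ge0.
rewrite classical_sets.inE; apply/andP; split; rewrite classical_sets.inE//= /finite_norm unlock.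
apply: poweR_lty; apply: le_lt_trans f2; rewrite le_eqVlt; apply/orP; left; apply/eqP.
by apply: eq_integral => x _ /=; rewrite powR_mulrn// real_normK ?num_real.
Qed.

Lemma L2_real (f : T -> R) : measurable_fun [set: T] f -> (sqint mu f < +oo)%E ->
  L2 mu (fun x => (f x)%:C).
Proof.
move=> mf f2; split; first by apply/Lfun2P.
apply/Lfun2P; split; first by rewrite (_ : _ \o _ = cst 0)//; exact: measurable_cst.
by rewrite /sqint/=; under eq_integral do rewrite expr0n/=; rewrite integral0.
Qed.

Lemma sqr_rnorm_sqint (f : T -> R[i]) : L2 mu f ->
  ((rnorm mu f ^+ 2)%:E =
   sqint mu (@complex.Re R \o f) + sqint mu (@complex.Im R \o f))%E.
Proof.
move=> Lf; have [/Lfun2P[m1 _] /Lfun2P[m2 _]] := Lf.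
rewrite sqr_rnorm /rinner /Rintegral fineK; last first.
  by apply: integrable_fin_num => //; exact: L2_integrable.
rewrite /sqint -ge0_integralD//; last 4 first.
- by move=> x _; rewrite lee_fin sqr_ge0.
- exact: measurable_sqr.
- by move=> x _; rewrite lee_fin sqr_ge0.
- exact: measurable_sqr.
by apply: eq_integral => x _; rewrite Re_mul_conj -!expr2 EFinD.
Qed.

(** Real and imaginary parts are approximated separately and the two lists are joined, the second
    with weights multiplied by i. *)
Lemma rspan_dense_complex (I : Type) (F : I -> T -> R) (phi : I -> T -> R[i]) :
  (forall i x, phi i x = (F i x)%:C) -> (forall i, L2 mu (phi i)) ->
  (forall f : T -> R, measurable_fun [set: T] f -> (sqint mu f < +oo)%E -> msclosure mu F f) ->
  forall w, L2 mu w -> forall e : R, 0 < e -> exists s : seq (R[i] * I),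
    rnorm mu (w - \sum_(x <- s) x.1 *: phi x.2) <= e.
Proof.
move=> phiE L2phi dense w Lw e e0; have [/Lfun2P[m1 w1] /Lfun2P[m2 w2]] := Lw.
(* The squared norm is the sum of those of the real and imaginary parts, so each may use half of
   e^2. *)
have e2 : 0 < e ^+ 2 / 2 by rewrite divr_gt0// exprn_gt0.
have [p [s pE] wp] := (dense _ m1 w1).2 _ e2.
have [q [s' qE] wq] := (dense _ m2 w2).2 _ e2.
exists ([seq (x.1%:C, x.2) | x <- s] ++ [seq ('i * x.1%:C, x.2) | x <- s']).
set g := \sum_(x <- _) _; have Lg : L2 mu g by apply: L2_sum => x; exact: L2Z.
have sumE (c : R[i]) (r : seq (R * I)) x :
    \sum_(y <- r) ((c * y.1%:C) *: phi y.2) x = c * (\sum_(y <- r) y.1 * F y.2 x)%:C.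
  elim: r => [|y r IH]; first by rewrite !big_nil rmorph0 mulr0.
  rewrite !big_cons IH rmorphD/= mulrDr; congr (_ + _).
  by rewrite -[LHS]/(c * y.1%:C * phi y.2 x) phiE rmorphM/= mulrA.
have gE x : g x = p x +i* q x.
  rewrite /g fct_sumE big_cat/= !big_map/= pE qE sumE.
  under eq_bigr do rewrite -[X in X *: _]mul1r.
  by rewrite sumE mul1r; simpc.
have Lwg : L2 mu (w - g) by exact: L2B.
suff : rnorm mu (w - g) ^+ 2 <= e ^+ 2.
  by rewrite ler_pXn2r// nnegrE ?rnorm_ge0// ltW.
rewrite -lee_fin sqr_rnorm_sqint//.
rewrite (splitr (e ^+ 2)) EFinD; apply: leeD.
- rewrite (_ : @complex.Re R \o (w - g) = fun x => (@complex.Re R \o w) x - p x)//.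
  by apply/funext => x /=; rewrite -[(w - g) x]/(w x - g x) gE raddfB.
- rewrite (_ : @complex.Im R \o (w - g) = fun x => (@complex.Im R \o w) x - q x)//.
  by apply/funext => x /=; rewrite -[(w - g) x]/(w x - g x) gE raddfB.
Qed.

End complex_mean_square.

(** * Orthonormal bases of products of polynomials *)

Section product_poly.
Local Open Scope complex_scope.
Context (R : realType) (d : nat).
Local Notation T := (measurableTypeR R).
Local Notation lambda := (@lebesgue_measure R).
Variables (w : 'I_d -> T -> R).
Hypotheses (mw : forall i, measurable_fun [set: T] (w i)) (w0 : forall i x, 0 <= w i x).
Hypotheses
  (mW : measurable_fun [set: d.-tuple T] (fun x => \prod_(i < d) w i (tnth x i)))
  (W0 : forall x : d.-tuple T, 0 <= \prod_(i < d) w i (tnth x i)).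
Local Notation mu := (density_measure (lebesgue_tuple R d) mW W0).
Local Notation nu i := (density_measure lambda (mw i) (w0 i)).
Variable p : 'I_d -> nat -> {poly R}.
Let l i k : T -> R := fun x => (p i k).[x].

Hypothesis p_integrable : forall i j k,
  lambda.-integrable [set: T] (fun x => ((p i j).[x] * (p i k).[x] * w i x)%:E).
Hypothesis p_orthonormal : forall i j k,
  (\int[lambda]_x ((p i j).[x] * (p i k).[x] * w i x))%R = (j == k)%:R.
Hypothesis p_dense : forall i (B : set T),
  B = setT \/ (exists c : R, B = `]c, +oo[%classic) -> msclosure (nu i) (l i) (\1_B).
Hypothesis w_fin : forall i, (\int[lambda]_x (w i x)%:E < +oo)%E.

Lemma measurable_horner (q : {poly R}) : measurable_fun [set: T] (fun x : T => q.[x]).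
Proof. by apply: continuous_measurable_fun; exact: continuous_horner. Qed.

Let ml i k : measurable_fun [set: T] (l i k).
Proof. exact: measurable_horner. Qed.

Let l2 i k : (sqint (nu i) (l i k) < +oo)%E.
Proof.
rewrite /sqint ge0_integral_density; last 2 first.
- exact: measurable_sqr.
- by move=> x; rewrite lee_fin sqr_ge0.
have /integrableP[_] := p_integrable i k k; apply: le_lt_trans.
apply: le_integral_pointwise => x _; first by rewrite mule_ge0 ?lee_fin ?sqr_ge0.
by rewrite -EFinM -expr2 gee0_abs// lee_fin mulr_ge0// sqr_ge0.
Qed.

Let product_polyE ks x : product_poly p ks x = (tensor_basis l ks x)%:C.
Proof. by []. Qed.

Lemma L2_product_poly ks : L2 mu (product_poly p ks).
Proof.
rewrite (_ : product_poly p ks = fun x => (tensor_basis l ks x)%:C)//.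
apply: L2_real; first exact: measurable_tensor_basis.
rewrite sqint_tensor//.
rewrite (eq_bigr (fun i => (fine (sqint (nu i) (l i (tnth ks i))))%:E)) ?prodEFin ?ltry//.
by move=> i _; rewrite fineK// ge0_fin_numE ?sqint_ge0//; exact: l2.
Qed.

(** The integral factors over the coordinates, and distinct multi-indices differ in some coordinate,
    where the factor is 0. *)
Lemma product_poly_orthonormal ks ks' :
  L2inner mu (product_poly p ks) (product_poly p ks') = (ks == ks')%:R.
Proof.
have ReE x : complex.Re (product_poly p ks x * (product_poly p ks' x)^*) =
    \prod_(i < d) (l i (tnth ks i) (tnth x i) * l i (tnth ks' i) (tnth x i)).
  by rewrite Re_mul_conj !product_polyE/= mulr0 addr0 big_split.
have ImE x : complex.Im (product_poly p ks x * (product_poly p ks' x)^*) = 0.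
  by rewrite !product_polyE/=; ring.
rewrite /L2inner; under [X in _ +i* X]eq_Rintegral do rewrite ImE.
under [X in X +i* _]eq_Rintegral do rewrite ReE.
rewrite Rintegral_cst// mul0r.
have prodE (x : d.-tuple T) : \prod_(i < d) (l i (tnth ks i) (tnth x i) * l i (tnth ks' i) (tnth x i)) *
   \prod_(i < d) w i (tnth x i) =
   \prod_(i < d) ((p i (tnth ks i)).[tnth x i] * (p i (tnth ks' i)).[tnth x i] * w i (tnth x i)).
  by rewrite -big_split.
rewrite Rintegral_density; last 2 first.
- apply: (measurable_prod_coord (f := fun i x => l i (tnth ks i) x * l i (tnth ks' i) x)).
  by move=> i; exact: measurable_funM.
- under eq_fun do rewrite prodE.
  apply: (integrable_prod (f := fun i x =>
    (p i (tnth ks i)).[x] * (p i (tnth ks' i)).[x] * w i x)) => i.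
  exact: p_integrable.
under eq_Rintegral do rewrite prodE.
rewrite /Rintegral (integral_prod (f := fun i x =>
    (p i (tnth ks i)).[x] * (p i (tnth ks' i)).[x] * w i x))/=; last first.
  by move=> i; exact: p_integrable.
under eq_bigr do rewrite p_orthonormal.
have [->|ksks'] := eqVneq ks ks'; first by rewrite big1// => i _; rewrite eqxx.
have [i ii] : exists i, tnth ks i != tnth ks' i.
  apply/existsP; apply: contraR ksks' => /existsPn h; apply/eqP/eq_from_tnth => i.
  by apply/eqP; have := h i; rewrite negbK.
by rewrite (bigD1 i)//= (negPf ii) mul0r.
Qed.

Lemma product_poly_dense f : L2 mu f -> forall e : R, 0 < e ->
  exists s : seq (R[i] * d.-tuple nat),
    rnorm mu (f - \sum_(x <- s) x.1 *: product_poly p x.2) <= e.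
Proof.
have dense (g : d.-tuple T -> R) : measurable_fun [set: d.-tuple T] g ->
    (sqint mu g < +oo)%E -> msclosure mu (tensor_basis l) g.
  exact: (msclosure_sqint ml l2 p_dense w_fin).
exact: (@rspan_dense_complex _ _ _ mu _ (tensor_basis l) (product_poly p) product_polyE
  L2_product_poly dense).
Qed.

Theorem product_poly_controllability (E : nat -> set (d.-tuple nat)) (lam : nat -> R)
    (b : d.-tuple T -> R[i]) (t1 : R) : (0 < d)%N -> 0 < t1 ->
  (forall n, finite_set (E n)) -> (forall n k i, E n i -> E k i -> n = k) ->
  (forall i, exists n, E n i) -> (forall n, 0 <= lam n) -> L2 mu b ->
  (forall ks, L2inner mu b (product_poly p ks) != 0) ->
  approximately_controllable mu (spectral_semigroup mu (product_poly p) E lam)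
    (control_operator mu (product_poly p) b) t1 /\
  ~ exactly_controllable mu (spectral_semigroup mu (product_poly p) E lam)
    (control_operator mu (product_poly p) b) t1.
Proof.
move=> d0 t0 finE disjE covE lam0 Lb b0.
exact: (diagonal_controllability L2_product_poly product_poly_orthonormal product_poly_dense).
Qed.

End product_poly.

(** * Polynomials given by a Rodrigues formula *)

Section improper_integral.
Context (R : realType).
Local Notation T := (measurableTypeR R).
Local Notation lambda := (@lebesgue_measure R).

(** The fundamental theorem of calculus on the compact intervals [A n, B n] exhausting [J]: the
    boundary values tend to 0, and |f| dominates the truncations. *)
Lemma integral_derivative_eq0 (A B : nat -> R) (J : set T) (F f : R -> R) :
  measurable J -> (forall n, A n < B n) ->
  (forall n, `[A n, B n]%classic `<=` J) ->
  (forall x, J x -> \forall n \near \oo, A n <= x <= B n) ->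
  (forall x, J x -> is_derive x 1 F (f x)) ->
  (forall x, J x -> {for x, continuous f}) ->
  lambda.-integrable J (EFin \o f) ->
  F (A n) @[n --> \oo] --> 0 -> F (B n) @[n --> \oo] --> 0 ->
  (\int[lambda]_(x in J) (f x)%:E = 0)%E.
Proof.
move=> mJ AB ABJ exhaust dF cf fi FA FB.
have mf : measurable_fun J (EFin \o f) by exact: measurable_int fi.
pose I n : set T := `[A n, B n]%classic.
have mI n : measurable (I n) by exact: measurable_itv.
have FTC n : (\int[lambda]_(x in I n) (f x)%:E = (F (B n) - F (A n))%:E)%E.
  have JI x : x \in `[A n, B n] -> J x by move=> xI; apply: (ABJ n).
  have cF x : J x -> {for x, continuous F}.
    move=> Jx; apply: differentiable_continuous; apply/derivable1_diffP.
    by have := dF _ Jx.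
  have An : J (A n) by apply: JI; rewrite in_itv/= lexx ltW.
  have Bn : J (B n) by apply: JI; rewrite in_itv/= lexx ltW.
  rewrite EFinB; apply: continuous_FTC2 => //.
  - apply: continuous_in_subspaceT => x /set_mem xI; apply: cf; exact: JI.
  - split.
    + move=> x xI; have := dF x (JI _ (subset_itv_oo_cc xI)) => -[].
      by [].
    + apply: cvg_at_right_filter; exact: cF.
    + apply: cvg_at_left_filter; exact: cF.
  - move=> x xI; have dFx := dF x (JI _ (subset_itv_oo_cc xI)).
    by rewrite derive1E derive_val.
have lim1 : (\int[lambda]_(x in I n) (f x)%:E @[n --> \oo] --> 0)%E.
  under eq_fun do rewrite FTC.
  apply: cvg_EFin; first by near=> n.
  have h : F (B n) - F (A n) @[n --> \oo] --> (0 : R) - 0 by exact: cvgB.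
  by rewrite subr0 in h.
have [|||||_ _ lim2] := @dominated_convergence _ _ _ lambda J mJ
    (fun n => (EFin \o f) \_ (I n)) (EFin \o f) (abse \o (EFin \o f)).
- move=> n; apply/measurable_restrict => //.
  by apply: measurable_funS mf => // x [].
- exact: mf.
- apply: aeW => x Jx; apply: cvg_near_cst; have := exhaust x Jx.
  by apply: filterS => n xI; rewrite patchE mem_set// /I/= in_itv.
- exact: integrable_abse fi.
- apply: aeW => x n Jx; rewrite patchE; case: ifPn => //= _.
  by rewrite normr0 lee_fin.
have lim3 : (\int[lambda]_(x in I n) (f x)%:E @[n --> \oo] --> \int[lambda]_(x in J) (f x)%:E)%E.
  rewrite (_ : (fun n => _) = (fun n => \int[lambda]_(x in J) ((EFin \o f) \_ (I n)) x)%E).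
    exact: lim2.
  by apply/funext => n; rewrite -integral_mkcondr setIidr//; exact: ABJ.
by rewrite -(cvg_lim _ lim3)// (cvg_lim _ lim1).
Unshelve. all: by end_near. Qed.

End improper_integral.

(** * Orthogonality from an abstract Rodrigues formula *)

Section rodrigues.
Context (R : realType).
Local Notation T := (measurableTypeR R).
Local Notation lambda := (@lebesgue_measure R).
Variables (J : set T) (A B : nat -> R) (sigma : {poly R}) (tau : nat -> {poly R}).
Variable v : nat -> R -> R.
Hypotheses (mJ : measurable J) (openJ : open (J : set R)) (AB : forall n, A n < B n)
  (ABJ : forall n, `[A n, B n]%classic `<=` J)
  (exhaustJ : forall x, J x -> \forall n \near \oo, A n <= x <= B n).
Hypotheses (size_sigma : (size sigma <= 3)%N) (size_tau : forall j, (size (tau j) <= 2)%N).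
Hypothesis v_gt0 : forall j x, J x -> 0 < v j x.
Hypothesis vS : forall j x, J x -> v j.+1 x = v j x * sigma.[x].
Hypothesis dv : forall j x, J x -> is_derive x 1 (v j.+1) (v j x * (tau j).[x]).
Hypothesis cv : forall j x, J x -> {for x, continuous (v j)}.
Hypothesis v_int : forall j (q : {poly R}),
  lambda.-integrable J (fun x => (v j x * q.[x])%:E).
Hypothesis vA : forall j (q : {poly R}), v j.+1 (A n) * q.[A n] @[n --> \oo] --> 0.
Hypothesis vB : forall j (q : {poly R}), v j.+1 (B n) * q.[B n] @[n --> \oo] --> 0.

(** Chosen so that [v j * L j q] is the derivative of [v j.+1 * q]; [vS] and [dv] together form a
    Pearson equation for the weights. *)
Let L j (q : {poly R}) : {poly R} := sigma * q^`() + tau j * q.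

Let M j (q : {poly R}) : R := (\int[lambda]_(x in J) (v j x * q.[x]))%R.

Let derive_vq j q x : J x ->
  is_derive x 1 (fun y => v j.+1 y * q.[y]) (v j x * (L j q).[x]).
Proof.
move=> Jx; have dq : is_derive x 1 (horner q) q^`().[x].
  by apply: DeriveDef; [exact: derivable_horner|rewrite -derive1E -derivE].
have := is_deriveM (dv j Jx) dq.
rewrite (_ : _ *: _ + _ = v j x * (L j q).[x])//.
transitivity (v j.+1 x * q^`().[x] + q.[x] * (v j x * (tau j).[x])) => //.
by rewrite /L hornerD !hornerM vS//; ring.
Qed.

Let continuous_vq j (q : {poly R}) x : J x -> {for x, continuous (fun y => v j y * q.[y])}.
Proof. by move=> Jx; apply: cvgM; [exact: cv|exact: continuous_horner]. Qed.

Let M_L j q : M j (L j q) = 0.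
Proof.
suff h : (\int[lambda]_(x in J) (v j x * (L j q).[x])%:E = 0)%E by rewrite /M /Rintegral h.
apply: (@integral_derivative_eq0 R A B J (fun x => v j.+1 x * q.[x])) => //.
- by move=> x; exact: derive_vq.
- by move=> x; exact: continuous_vq.
- exact: v_int.
Qed.

Let MD j q r : M j (q + r) = M j q + M j r.
Proof.
rewrite /M -RintegralD//; [|exact: v_int|exact: v_int].
by apply: eq_Rintegral => x _; rewrite hornerD mulrDr.
Qed.

(** Integration by parts: [v j * L j r] is the derivative of [v j.+1 * r], and the boundary terms
    are gone by [M_L]. *)
Let M_mul_L j q r : M j (q * L j r) = - M j.+1 (q^`() * r).
Proof.
apply/eqP; rewrite -subr_eq0 opprK; apply/eqP.
rewrite -(M_L j (q * r)) (_ : L j (q * r) = q * L j r + sigma * (q^`() * r)); last first.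
  by rewrite /L derivM; ring.
rewrite MD; congr (_ + _); apply: eq_Rintegral => x Jx.
by rewrite vS ?hornerM ?mulrA//; exact/set_mem.
Qed.

(** The polynomial factor in the k-th derivative of [v (j + k)]: each differentiation lowers the
    index of the weight by one, so the innermost [L] has the highest index. *)
Fixpoint rodrigues_poly (j k : nat) : {poly R} :=
  if k is k'.+1 then L j (rodrigues_poly j.+1 k') else 1.

Lemma derive1n_rodrigues k j x : J x ->
  derive1n k (v (j + k)) x = v j x * (rodrigues_poly j k).[x].
Proof.
elim: k j x => [|k IH] j x Jx; first by rewrite addn0 /= hornerE mulr1.
rewrite derive1nS derive1E.
rewrite (@near_eq_derive _ _ _ _ (fun y => v j.+1 y * (rodrigues_poly j.+1 k).[y])).
- by have := derive_vq j (rodrigues_poly j.+1 k) Jx => -[].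
- have : nbhs x J by exact: open_nbhs_nbhs.
  by apply: filterS => y Jy; rewrite -addSnnS IH.
Qed.

Lemma size_rodrigues_poly j k : (size (rodrigues_poly j k) <= k.+1)%N.
Proof.
elim: k j => [|k IH] j /=; first by rewrite size_poly1.
have s := IH j.+1; set r := rodrigues_poly _ _ in s *.
rewrite (leq_trans (size_polyD _ _))// geq_max; apply/andP; split.
  have [->|r0] := eqVneq (r^`()) 0; first by rewrite mulr0 size_poly0.
  have r'0 : (size r^`() <= k)%N.
    have [->|rn0] := eqVneq r 0; first by rewrite deriv0 size_poly0.
    by rewrite -ltnS (leq_trans (lt_size_deriv rn0)).
  rewrite (leq_trans (size_polyMleq _ _))// -subn1 leq_subLR add1n.
  by rewrite (leq_trans (leq_add size_sigma r'0)).
rewrite (leq_trans (size_polyMleq _ _))// -subn1 leq_subLR add1n.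
by rewrite (leq_trans (leq_add (size_tau j) s)).
Qed.

(** Each integration by parts removes one [L] and differentiates [q]; after [k] of them nothing is
    left of [q]. *)
Lemma moment_rodrigues j k (q : {poly R}) : (size q <= k)%N ->
  M j (q * rodrigues_poly j k) = 0.
Proof.
elim: k j q => [|k IH] j q qk.
  move: qk; rewrite leqn0 size_poly_eq0 => /eqP ->.
  rewrite mul0r /M -[RHS](Rintegral_set0 lambda (fun=> 0)).
  rewrite /Rintegral integral_set0 integral0_eq// => x _.
  by rewrite hornerE mulr0.
rewrite /= M_mul_L IH ?oppr0//.
have [->|q0] := eqVneq q 0; first by rewrite deriv0 size_poly0.
by rewrite -ltnS (leq_trans (lt_size_deriv q0)).
Qed.

Variables (w : T -> R) (C : R) (p : nat -> {poly R}).
Hypothesis mw : measurable_fun [set: T] w.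
Hypothesis wJ : forall x, J x -> w x = C * v 0 x.
Hypothesis wNJ : {ae lambda, forall x : T, ~ J x -> w x = 0}.
Hypothesis p_rodrigues : forall k, exists c, forall x, J x ->
  (p k).[x] = c * (v 0 x)^-1 * derive1n k (v k) x.
Hypothesis p_norm : forall k, (\int[lambda]_x (((p k).[x] ^+ 2 * w x)%:E) = 1)%E.

Let aeJ (q : {poly R}) :
  {ae lambda, forall x : T, setT x -> (q.[x] * w x)%:E = ((fun x => (C * (v 0 x * q.[x]))%:E) \_ J) x}.
Proof.
apply: filterS wNJ => x wNJx _; rewrite patchE; case: ifPn => [/set_mem Jx|/negP Jx].
  by congr EFin; rewrite wJ//; ring.
by rewrite wNJx ?mulr0// => /mem_set.
Qed.

Let measurable_qw (q : {poly R}) : measurable_fun [set: T] (fun x => (q.[x] * w x)%:E).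
Proof.
by apply/measurable_EFinP; apply: measurable_funM => //; exact: measurable_horner.
Qed.

Let int_J (q : {poly R}) : lambda.-integrable J (fun x => (C * (v 0 x * q.[x]))%:E).
Proof.
rewrite (_ : (fun x => _) = fun x => (C%:E * (v 0 x * q.[x])%:E)%E)//.
by apply: integrableZl => //; exact: v_int.
Qed.

Lemma integrable_poly_weight (q : {poly R}) :
  lambda.-integrable [set: T] (fun x => (q.[x] * w x)%:E).
Proof.
have := int_J q; rewrite (integrable_mkcond _ mJ) => /integrableP[m i].
apply/integrableP; split=> //; apply: le_lt_trans i; rewrite le_eqVlt; apply/orP; left.
apply/eqP/ae_eq_integral => //; first exact: measurableT_comp.
- exact: measurableT_comp.
- have h : {ae lambda, forall x : T, setT x -> `|(q.[x] * w x)%:E|%E =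
      `|((fun x => (C * (v 0 x * q.[x]))%:E) \_ J) x|%E}.
    by apply: filterS (aeJ q) => x h xT; rewrite h.
  exact: h.
Qed.

Lemma integral_poly_weight (q : {poly R}) :
  (\int[lambda]_x (q.[x] * w x))%R = C * M 0 q.
Proof.
have := int_J q; rewrite (integrable_mkcond _ mJ) => /integrableP[m _].
rewrite /M -RintegralZl//; last exact: v_int.
rewrite /Rintegral; congr fine; rewrite [RHS]integral_mkcond.
by apply: ae_eq_integral => //; exact: aeJ.
Qed.

(** Both sides agree on [J], which is infinite, so they are the same polynomial. *)
Lemma normalized_rodrigues k : exists c, p k = c *: rodrigues_poly 0 k.
Proof.
have [c pc] := p_rodrigues k; exists c.
apply/eqP; rewrite -subr_eq0; apply/eqP.
set r := p k - _; have rJ x : J x -> r.[x] = 0.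
  move=> Jx; rewrite hornerD hornerN hornerZ pc//.
  have := derive1n_rodrigues k 0 Jx; rewrite add0n => ->.
  by rewrite -mulrA mulKf ?subrr// gt_eqF// v_gt0.
apply/eqP; apply: contraT => r0.
(* As many distinct roots in [A 0, B 0] as the size of [r], one more than its degree. *)
pose s := [seq A 0 + (B 0 - A 0) * (i.+1%:R)^-1 | i <- iota 0 (size r)].
have BA : 0 < B 0 - A 0 by rewrite subr_gt0.
have us : uniq s.
  rewrite map_inj_uniq ?iota_uniq// => i j /addrI/(mulfI (lt0r_neq0 BA))/invr_inj/eqP.
  by rewrite eqr_nat => /eqP[].
have rs : all (root r) s.
  have AJ y : A 0 <= y <= B 0 -> J y.
    by move=> yAB; apply: (ABJ (n := 0%N)); rewrite /= in_itv.
  apply/allP => _ /mapP[i _ ->]; apply/eqP/rJ/AJ.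
  have i0 : 0 <= i.+1%:R^-1 :> R by rewrite invr_ge0.
  have i1 : i.+1%:R^-1 <= 1 :> R by rewrite invf_le1 ?ler1n ?ltr0n.
  apply/andP; split; first by rewrite lerDl mulr_ge0// ltW.
  by rewrite -lerBrDl; exact: ler_piMr (ltW BA) i1.
by have := max_poly_roots r0 rs us; rewrite size_map size_iota ltnn.
Qed.

Lemma size_normalized k : (size (p k) <= k.+1)%N.
Proof.
have [c ->] := normalized_rodrigues k.
exact: leq_trans (size_scale_leq _ _) (size_rodrigues_poly 0 k).
Qed.

Let M_lower k (q : {poly R}) : (size q <= k)%N -> M 0 (q * p k) = 0.
Proof.
move=> qk; have [c ->] := normalized_rodrigues k.
rewrite -scalerAr (_ : M 0 _ = c * M 0 (q * rodrigues_poly 0 k)).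
  by rewrite moment_rodrigues// mulr0.
rewrite /M -RintegralZl//; last exact: v_int.
by apply: eq_Rintegral => x _; rewrite hornerZ mulrCA.
Qed.

Lemma normalized_orthonormal j k :
  (\int[lambda]_x ((p j).[x] * (p k).[x] * w x))%R = (j == k)%:R.
Proof.
have [->|jk] := eqVneq j k.
  rewrite -[1%:R]/(fine 1%E) -(p_norm k) /Rintegral; congr fine.
under eq_Rintegral do rewrite -hornerM.
rewrite integral_poly_weight; have [jk'|kj] := ltnP j k.
  by rewrite M_lower ?mulr0// (leq_trans (size_normalized j)).
rewrite (mulrC (p j)) M_lower ?mulr0// (leq_trans (size_normalized k))//.
by rewrite ltn_neqAle eq_sym jk.
Qed.

(** Of smaller degree, [p k] would be orthogonal to itself, against norm one. *)
Lemma size_normalized_eq k : size (p k) = k.+1.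
Proof.
apply/eqP; rewrite eqn_leq size_normalized ltnNge; apply/negP => pk.
have := normalized_orthonormal k k; under eq_Rintegral do rewrite -hornerM.
by rewrite integral_poly_weight M_lower// mulr0 eqxx => /eqP; rewrite eq_sym oner_eq0.
Qed.

(** The degree of [p k] is exactly [k]: cancel the leading coefficient and descend on the size. *)
Lemma rspan_normalized (q : {poly R}) : rspan (fun k (x : T) => (p k).[x]) (fun x => q.[x]).
Proof.
have [n qn] : exists n, (size q <= n)%N by exists (size q).
elim: n q qn => [|n IH] q qn.
  move: qn; rewrite leqn0 size_poly_eq0 => /eqP ->.
  by rewrite (_ : horner _ = fun=> 0); [exact: rspan0|apply/funext => x; rewrite horner0].
have pn0 : (p n)`_n != 0.
  have := lead_coef_eq0 (p n); rewrite lead_coefE size_normalized_eq => ->.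
  by rewrite -size_poly_eq0 size_normalized_eq.
pose a := q`_n / (p n)`_n.
have sq : (size (q - a *: p n)%R <= n)%N.
  apply/leq_sizeP => i; rewrite leq_eqVlt => /predU1P[<-|ni].
    by rewrite coefB coefZ /a divfK ?subrr.
  have qi : q`_i = 0 by apply: nth_default; exact: leq_trans qn ni.
  have pi : (p n)`_i = 0 by apply: nth_default; rewrite size_normalized_eq.
  by rewrite coefB coefZ qi pi mulr0 subr0.
have -> : horner q = fun t => (q - a *: p n).[t] + a * (p n).[t].
  by apply/funext => t; rewrite hornerD hornerN hornerZ subrK.
exact: rspanD (IH _ sq) (rspanZ a (rspan1 (fun k (x : T) => (p k).[x]) n)).
Qed.

End rodrigues.

(** * Approximation of rays *)

Section step.
Context (R : realType).

(** Bernoulli's inequality. *)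
Lemma bernoulli_ge (t : R) m : 0 <= t <= 1 -> 1 - m%:R * t <= (1 - t) ^+ m.
Proof.
move=> /andP[t0 t1]; elim: m => [|m IH]; first by rewrite mul0r subr0.
rewrite exprS; apply: le_trans (ler_wpM2l _ IH); last by rewrite subr_ge0.
rewrite -addn1 natrD; have : 0 <= m%:R * t ^+ 2 by rewrite mulr_ge0// sqr_ge0.
rewrite expr2; lra.
Qed.

(** Bernoulli's inequality gives the lower bound 1 - (2 y)^n. These are the polynomials of the
    Brosowski-Deutsch proof of the Stone-Weierstrass theorem. *)
Lemma step_poly_small (y : R) : 0 <= y -> y < 2^-1 ->
  (1 - y ^+ n) ^+ (2 ^ n) @[n --> \oo] --> (1 : R).
Proof.
move=> y0 y2; have y1 : y <= 1 by lra.
apply: (@squeeze_cvgr _ _ _ _ (fun n => 1 - (2 * y) ^+ n) (cst 1)).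
- near=> n.
  have yn : 0 <= y ^+ n <= 1 by rewrite exprn_ge0//= exprn_ile1.
  have := bernoulli_ge (2 ^ n) yn; rewrite natrX -exprMn => -> /=.
  by rewrite exprn_ile1// ?subr_ge0; case/andP: yn => //; lra.
- have h : 1 - (2 * y) ^+ n @[n --> \oo] --> (1 - 0 : R).
    apply: cvgB; first exact: cvg_cst.
    by apply: cvg_expr; rewrite ger0_norm ?mulr_ge0//; lra.
  by rewrite subr0 in h.
- exact: cvg_cst.
Unshelve. all: by end_near. Qed.

(** From (1 - y^n)(1 + y^n) <= 1 and (1 + y^n)^(2^n) >= 1 + 2^n y^n >= (2 y)^n. *)
Lemma step_poly_large (y : R) : 2^-1 < y -> y <= 1 ->
  (1 - y ^+ n) ^+ (2 ^ n) @[n --> \oo] --> (0 : R).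
Proof.
move=> y2 y1; have y0 : 0 < y by lra.
apply: (@squeeze_cvgr _ _ _ _ (cst 0) (fun n => ((2 * y)^-1) ^+ n)).
- near=> n.
  have yn : 0 <= y ^+ n <= 1 by rewrite exprn_ge0 ?exprn_ile1// ltW.
  have yn' : 0 <= 1 - y ^+ n <= 1 by lra.
  have [a0 a1] := andP yn; have [b0 b1] := andP yn'.
  rewrite exprn_ge0//= exprVn -[leRHS]mul1r ler_pdivlMr ?exprn_gt0 ?mulr_gt0//.
  rewrite exprMn -natrX.
  have : (1 - y ^+ n) ^+ (2 ^ n) * (1 + y ^+ n) ^+ (2 ^ n) <= 1.
    by rewrite -exprMn exprn_ile1//; nra.
  apply: le_trans; rewrite ler_wpM2l ?exprn_ge0//.
  have : (2 ^ n)%:R * y ^+ n <= 1 + (2 ^ n)%:R * y ^+ n by rewrite lerDr.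
  move/le_trans; apply.
  elim: (2 ^ n)%N => [|m IH]; first by rewrite mul0r addr0.
  rewrite exprS; apply: le_trans (ler_wpM2l _ IH); last by rewrite addr_ge0.
  rewrite -addn1 natrD; have : 0 <= m%:R * (y ^+ n) ^+ 2 by rewrite mulr_ge0// sqr_ge0.
  rewrite [in X in X -> _]expr2; lra.
- exact: cvg_cst.
- apply: cvg_expr; rewrite ger0_norm ?invr_ge0 ?mulr_ge0 ?ltW//.
  by rewrite invf_lt1 ?mulr_gt0//; lra.
Unshelve. all: by end_near. Qed.

End step.

Section ray_density.
Context (R : realType).
Local Notation T := (measurableTypeR R).
Local Notation lambda := (@lebesgue_measure R).
Variables (w : T -> R) (mw : measurable_fun [set: T] w) (w0 : forall x, 0 <= w x).
Hypothesis w_fin : (\int[lambda]_x (w x)%:E < +oo)%E.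
Local Notation nu := (density_measure lambda mw w0).

(** The zero set of the weight is null for the density measure, and so is a single point. *)
Lemma ae_density (c : R) (P : T -> Prop) :
  (forall x : T, w x != 0 -> x != c -> P x) -> {ae nu, forall x, P x}.
Proof.
move=> wP; pose N := [set x : T | w x = 0].
have mN : measurable N.
  have -> : N = setT `&` w @^-1` [set 0] by rewrite setTI.
  by apply: mw.
exists (N `|` [set c]); split; first exact: measurableU.
  apply/eqP; rewrite eq_le measure_ge0 andbT.
  apply: (@le_trans _ _ (nu N + nu [set c])%E); first exact: measureU2.
  rewrite [X in (X + _)%E](_ : _ = 0%E) ?add0e; last first.
    by rewrite /= /density_measure integral0_eq// => x ->.
  by rewrite /= /density_measure integral_set1.
move=> x /= nP; apply: contrapT => /not_orP[h1 h2]; apply: nP.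
by apply: wP; apply/eqP.
Qed.

Variable F : nat -> T -> R.
Hypothesis mF : forall k, measurable_fun [set: T] (F k).

Lemma sqint_bounded (C : R) : (sqint nu (cst C) < +oo)%E.
Proof.
rewrite /sqint ge0_integral_density; last 2 first.
- exact: measurable_sqr (measurable_cst _).
- by move=> x; rewrite lee_fin sqr_ge0.
rewrite /= ge0_integralZl_EFin ?sqr_ge0//; last 2 first.
- by move=> x _; rewrite lee_fin.
- exact/measurable_EFinP.
by rewrite lte_mul_pinfty// lee_fin sqr_ge0.
Qed.

(** At [c] the limit is not controlled, but a point is null; elsewhere on the support of the weight
    all values lie in [0, 1], so the constant 1 dominates. *)
Lemma msclosure_ray (y : T -> R) (c : R) : measurable_fun [set: T] y ->
  (forall q : {poly R}, msclosure nu F (fun x => q.[y x])) ->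
  (forall x : T, w x != 0 -> 0 <= y x <= 1) ->
  (forall x : T, w x != 0 -> c < x -> y x < 2^-1) ->
  (forall x : T, w x != 0 -> x < c -> 2^-1 < y x) ->
  msclosure nu F (\1_(`]c, +oo[%classic)).
Proof.
move=> my cq y01 yr yl.
apply: (@msclosure_dominated _ _ _ _ nu F mF
  (fun n x => ((1 - 'X^n) ^+ (2 ^ n)).[y x]) _ (cst 1)) => //.
- apply: (ae_density (c := c)) => x wx xc.
  have /andP[yx0 yx1] := y01 x wx.
  rewrite (_ : (fun n => _) = fun n => (1 - y x ^+ n) ^+ (2 ^ n)); last first.
    by apply/funext => n; rewrite !hornerE.
  rewrite indicE; have [xc'|cx] := ltP x c.
    rewrite memNset; first exact: step_poly_large (yl x wx xc') yx1.
    by rewrite /= in_itv/= andbT => /(lt_trans xc'); rewrite ltxx.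
  have {}cx : c < x by rewrite lt_neqAle eq_sym xc.
  rewrite mem_set; first exact: step_poly_small yx0 (yr x wx cx).
  by rewrite /= in_itv/= andbT.
- apply: (ae_density (c := c)) => x wx xc n.
  have /andP[yx0 yx1] := y01 x wx.
  have yn : 0 <= y x ^+ n <= 1 by rewrite exprn_ge0//= exprn_ile1.
  rewrite !hornerE; have yn' : 0 <= 1 - y x ^+ n <= 1 by lra.
  have [b0 b1] := andP yn'.
  by rewrite ger0_norm ?exprn_ge0// exprn_ile1.
- exact: sqint_bounded.
Qed.

End ray_density.

(** * Laguerre polynomials *)

Section inverse_succ.
Context (R : realType).

Lemma cvg_invS2 : (n.+2%:R : R)^-1 @[n --> \oo] --> (0 : R).
Proof.
apply: (@squeeze_cvgr _ _ _ _ (cst 0) (fun n => n.+1%:R^-1)).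
- near=> n; rewrite invr_ge0 ler0n/= lef_pV2 ?posrE ?ltr0n// ler_nat.
  exact: leqnSn.
- exact: cvg_cst.
- exact: cvg_harmonic.
Unshelve. all: by end_near. Qed.

Lemma cvg_powR_invS2 (r : R) : 0 < r -> (n.+2%:R : R)^-1 `^ r @[n --> \oo] --> (0 : R).
Proof.
move=> r0; have /cvg_at_rightP := powR_cvg0 r0; apply; split; last exact: cvg_invS2.
by move=> n; rewrite invr_gt0.
Qed.

(** One term of the exponential series. *)
Lemma ler_expr_expR (x : R) n : 0 <= x -> x ^+ n.+1 <= n.+1`!%:R * expR x.
Proof.
move=> x0; rewrite mulrC -ler_pdivrMr ?ltr0n ?fact_gt0//.
by apply: le_trans (expR_ge1Dxn n x0); rewrite lerDr.
Qed.

Lemma cvg_expR_series (x : R) :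
  \sum_(j < n) x ^+ j / j`!%:R @[n --> \oo] --> expR x.
Proof.
rewrite (_ : (fun n => _) = series (exp_coeff x)); first exact: is_cvg_series_exp_coeff.
by apply/funext => n; rewrite /series/= big_mkord.
Qed.

Lemma expR_series_le (x : R) n : `|\sum_(j < n) x ^+ j / j`!%:R| <= expR `|x|.
Proof.
rewrite (le_trans (ler_norm_sum _ _ _))//.
have h : \sum_(j < m) `|x| ^+ j / j`!%:R @[m --> \oo] --> expR `|x|.
  exact: cvg_expR_series.
rewrite -(cvg_lim _ h)//.
rewrite (eq_bigr (fun j : 'I_n => `|x| ^+ j / j`!%:R)); last first.
  by move=> j _; rewrite normrM normrX normfV normr_nat.
apply: (@nondecreasing_cvgn_le _ (fun n => \sum_(j < n) `|x| ^+ j / j`!%:R)).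
  apply/nondecreasing_seqP => k; rewrite big_ord_recr/= lerDl.
  by rewrite divr_ge0// exprn_ge0.
by apply/cvg_ex; exists (expR `|x|).
Qed.

End inverse_succ.

Section laguerre1.
Context (R : realType).
Local Notation T := (measurableTypeR R).
Local Notation lambda := (@lebesgue_measure R).
Variables (a : R) (p : nat -> {poly R}).
Hypothesis a_gt : -1 < a.
Hypothesis p_laguerre : forall k, normalized_laguerre a k (p k).
Local Notation w := (laguerre_weight1 a).
Local Notation J := (`]0, +oo[%classic : set T).
Let C := (Gamma (a + 1))^-1.
Let v (j : nat) (x : R) : R := x `^ (a + j%:R) * expR (- x).
Let mw := measurable_laguerre_weight1 a.
Let w0 := laguerre_weight1_ge0 a.
Local Notation nu := (density_measure lambda mw w0).

Let JP (x : T) : J x <-> 0 < x.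
Proof. by rewrite /= in_itv/= andbT. Qed.

Let wJ (x : T) : J x -> w x = C * v 0 x.
Proof.
move=> Jx; rewrite /laguerre_weight1 indicE mem_set// mul1r /v addr0 mulrC.
by rewrite /C mulrC.
Qed.

Let wNJ (x : T) : ~ J x -> w x = 0.
Proof. by move=> Jx; rewrite /laguerre_weight1 indicE memNset// mul0r. Qed.

Let wneq0 (x : T) : w x != 0 -> 0 < x.
Proof. by move=> wx; apply/JP; apply: contrapT => /wNJ/eqP; rewrite (negPf wx). Qed.

Let vk_rodrigues k : (fun y : R => y `^ (k%:R + a) * expR (- y)) = v k.
Proof. by apply/funext => y; rewrite /v addrC. Qed.

Let v_gt0 j (x : T) : J x -> 0 < v j x.
Proof. by move=> /JP x0; rewrite mulr_gt0 ?expR_gt0 ?powR_gt0. Qed.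

Let v0V (x : T) : J x -> (v 0 x)^-1 = x `^ (- a) * expR x.
Proof.
by move=> Jx; rewrite /v addr0 invfM powRN expRN invrK.
Qed.

Let p_rodrigues k : exists c, forall x : T, J x ->
  (p k).[x] = c * (v 0 x)^-1 * derive1n k (v k) x.
Proof.
have [[c pc] _] := p_laguerre k; exists c => x Jx.
by rewrite pc; [rewrite v0V// -vk_rodrigues mulrA|exact/JP].
Qed.

Let p_norm k : (\int[lambda]_x (((p k).[x] ^+ 2 * w x)%:E) = 1)%E.
Proof. by have [] := p_laguerre k. Qed.

(** Read off the norm of [p 0], which is a constant c on [J], so that c^2 times the integral of [w]
    is 1. An infinite integral contradicts this, and so does C = 0, which would make [w] vanish. *)
Let w_int : (\int[lambda]_x (w x)%:E < +oo)%E /\ 0 < C.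
Proof.
have [c pc] := p_rodrigues 0.
have pw x : (p 0).[x] ^+ 2 * w x = c ^+ 2 * w x.
  have [Jx|Jx] := pselect (J x); last by rewrite wNJ// !mulr0.
  by rewrite pc// derive1n0 -mulrA mulVf ?mulr1// gt_eqF// v_gt0.
have := p_norm 0; under eq_integral do rewrite pw EFinM.
rewrite ge0_integralZl_EFin ?sqr_ge0//; last 2 first.
- by move=> x _; rewrite lee_fin.
- exact/measurable_EFinP.
move=> h; have c0 : 0 < c ^+ 2.
  rewrite lt_def sqr_ge0 andbT; apply/eqP => c0; move: h; rewrite c0 mul0e => /eqP.
  by rewrite eq_sym onee_eq0.
split.
  move: h; case: (\int[lambda]_x _)%E => [r _|h|h]; rewrite ?ltry//.
  by move: h; rewrite gt0_muley ?lte_fin.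
rewrite lt_def invr_ge0 Gamma_ge0 andbT; apply/eqP => C0.
move: h; rewrite integral0_eq ?mule0; first by move=> /eqP; rewrite eq_sym onee_eq0.
move=> x _; have [Jx|Jx] := pselect (J x); last by rewrite wNJ.
by rewrite wJ// C0 mul0r.
Qed.

Let C_gt0 : 0 < C. Proof. by case: w_int. Qed.

Let v0_int : lambda.-integrable J (fun x => (v 0 x)%:E).
Proof.
have iw : lambda.-integrable J (fun x => (w x)%:E).
  apply: (@integrableS _ _ _ _ setT) => //; apply/integrableP; split.
    exact/measurable_EFinP.
  under eq_integral do rewrite gee0_abs ?lee_fin//.
  by case: w_int.
apply: (@eq_integrable _ _ _ _ _ _ (fun x => C^-1%:E * (w x)%:E)%E) => //.
  by move=> x /set_mem Jx; rewrite wJ// -EFinM mulKf// gt_eqF.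
exact: integrableZl.
Qed.

Let measurable_term N (r : R) :
  measurable_fun [set: T] (fun x : T => x ^+ N * (x `^ a * expR (- (r * x)))).
Proof.
apply: measurable_funM; first exact: measurable_funX.
apply: measurable_funM => //; apply: measurableT_comp => //.
by apply: measurableT_comp => //; exact: measurable_funM.
Qed.

(** For x >= 1 the powers of x are at most x^(M+1), which one term of the exponential series at x/4
    bounds by 4^(M+1) (M+1)! e^(x/4); half of the decay e^(-x/2) remains. *)
Let exp_bound N : exists2 K, 0 <= K & forall x : R, 1 <= x ->
  x ^+ N * (x `^ a * expR (- (2^-1 * x))) <= K * expR (- (4^-1 * x)).
Proof.
pose m := Num.truncn `|a|; pose M := (N + m)%N.
exists (4 ^+ M.+1 * M.+1`!%:R); first by rewrite mulr_ge0// exprn_ge0.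
move=> x x1; have x0 : 0 <= x by rewrite (le_trans _ x1).
have xa : x `^ a <= x ^+ m.+1.
  rewrite -powR_mulrn// ler_powR// (le_trans (ler_norm a))//.
  by rewrite ltW// truncnS_gt.
have hx := ler_expr_expR M (mulr_ge0 (ltac:(by []) : 0 <= 4^-1 :> R) x0).
have xM : x ^+ M.+1 <= 4 ^+ M.+1 * M.+1`!%:R * expR (4^-1 * x).
  rewrite -mulrA -ler_pdivrMl ?exprn_gt0//.
  by move: hx; rewrite exprMn exprVn.
rewrite mulrA (@le_trans _ _ (x ^+ M.+1 * expR (- (2^-1 * x))))//.
  rewrite ler_wpM2r ?expR_ge0// /M -addnS exprD.
  by rewrite ler_wpM2l// exprn_ge0.
apply: le_trans (ler_wpM2r (expR_ge0 _) xM) _; rewrite -[leLHS]mulrA ler_wpM2l ?mulr_ge0 ?exprn_ge0//.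
by rewrite -expRD ler_expR; lra.
Qed.

(** The decay e^(-x/2) instead of e^(-x) leaves room for the square of e^(x/8). Below 1 the
    comparison is with the weight itself, since -x/2 <= 1/2 - x there; above 1 it is with
    e^(-x/4). *)
Lemma integrable_half_weight N :
  lambda.-integrable J (fun x => (x ^+ N * (x `^ a * expR (- (2^-1 * x))))%:E).
Proof.
have [K K0 hK] := exp_bound N.
have iE : lambda.-integrable J (fun x => (expR (- (4^-1 * x)))%:E).
  have h4 : (0 : R) < 4^-1 by [].
  have := integrable_exponential_pdf h4.
  move=> /(@integrableS _ _ _ _ setT J) => /(_ measurableT (measurable_itv _) (@subsetT _ _)).
  move=> i4.
  (* The factor 4 undoes the normalisation of the exponential density of rate 1/4. *)
  apply: (@eq_integrable _ _ _ _ _ _ (fun x : T => 4%:E * (exponential_pdf 4^-1 x)%:E)%E) => //.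
    move=> x /set_mem/JP x0; rewrite exponential_pdfE ?ltW// -EFinM.
    by congr EFin; rewrite mulrA mulfV// mul1r mulNr.
  exact: integrableZl.
apply: (@le_integrable _ _ _ _ _ _ _ (fun x : T =>
    ((expR 2^-1)%:E * (v 0 x)%:E + K%:E * (expR (- (4^-1 * x)))%:E)%E)) => //.
- by apply/measurable_EFinP; apply: measurable_funTS; exact: measurable_term.
- move=> x /JP x0; rewrite -!EFinM -EFinD !abse_EFin lee_fin.
  rewrite !ger0_norm; last 2 first.
  + by rewrite addr_ge0// mulr_ge0 ?expR_ge0// ltW// v_gt0//; exact/JP.
  + by rewrite !mulr_ge0 ?exprn_ge0 ?powR_ge0 ?expR_ge0// ltW.
  have [x1|x1] := ltP x 1.
    rewrite ler_wpDr ?mulr_ge0 ?expR_ge0// /v addr0 mulrCA [leRHS]mulrCA ler_wpM2l ?powR_ge0//.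
    rewrite (@le_trans _ _ (1 * expR (- (2^-1 * x))))//.
      by rewrite ler_wpM2r ?expR_ge0// exprn_ile1// ltW.
    by rewrite mul1r -expRD ler_expR; lra.
  by rewrite ler_wpDl ?hK// mulr_ge0 ?expR_ge0// ltW// v_gt0//; exact/JP.
- apply: integrableD => //; exact: integrableZl.
Qed.

Let v_monomial j i (x : T) : J x -> v j x * x ^+ i = x ^+ (j + i) * (x `^ a * expR (- (1 * x))).
Proof.
move=> /JP x0; rewrite /v powRD ?(gt_eqF x0) ?implybT// powR_mulrn ?ltW//.
by rewrite exprD mul1r; ring.
Qed.

Let integrable_monomial N :
  lambda.-integrable J (fun x => (x ^+ N * (x `^ a * expR (- (1 * x))))%:E).
Proof.
apply: le_integrable (integrable_half_weight N) => //.
  by apply/measurable_EFinP; apply: measurable_funTS; exact: measurable_term.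
move=> x /JP x0; rewrite !abse_EFin lee_fin.
have ge0 (r : R) : 0 <= x ^+ N * (x `^ a * expR (- (r * x))).
  by rewrite !mulr_ge0 ?exprn_ge0 ?powR_ge0 ?expR_ge0// ltW.
have xge0 := ltW x0.
rewrite !ger0_norm// !ler_wpM2l ?exprn_ge0 ?powR_ge0//.
by rewrite ler_expR; lra.
Qed.

Let v_int j (q : {poly R}) : lambda.-integrable J (fun x => (v j x * q.[x])%:E).
Proof.
apply: (@eq_integrable _ _ _ _ _ _ (fun x : T => \sum_(i < size q)
   ((q`_i)%:E * (x ^+ (j + i) * (x `^ a * expR (- (1 * x))))%:E))%E) => //.
  move=> x /set_mem Jx; rewrite horner_coef mulr_sumr.
  under eq_bigr do rewrite -EFinM.
  rewrite sumEFin; congr EFin; apply: eq_bigr => i _.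
  by rewrite -v_monomial// mulrCA.
by apply: integrable_sum => // i _; apply: integrableZl => //; exact: integrable_monomial.
Qed.

(** The shift by 2 makes the interval nondegenerate already for n = 0. *)
Let A (n : nat) : R := n.+2%:R^-1.
Let B (n : nat) : R := n.+2%:R.

Let vA j (q : {poly R}) : v j.+1 (A n) * q.[A n] @[n --> \oo] --> 0.
Proof.
(* The assumption a > -1 makes the exponent at the boundary point 0 positive. *)
have aj : 0 < a + j.+1%:R.
  by have j0 : 0 <= j%:R :> R := ler0n _ _; rewrite -natr1; move: a_gt; lra.
have h : v j.+1 (A n) * q.[A n] @[n --> \oo] --> 0 * expR (- 0) * q.[0].
  apply: cvgM; last by apply: continuous_cvg; [exact: continuous_horner|exact: cvg_invS2].
  apply: cvgM; first exact: cvg_powR_invS2.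
  by apply: continuous_cvg; [exact: continuous_expR|apply: cvgN; exact: cvg_invS2].
by rewrite !mul0r in h.
Qed.

Let vB j (q : {poly R}) : v j.+1 (B n) * q.[B n] @[n --> \oo] --> 0.
Proof.
rewrite (_ : (fun n => _) = fun n => \sum_(i <- iota 0 (size q))
    (q`_i * (B n ^+ (j.+1 + i) * (B n `^ a * expR (- (1 * B n)))))); last first.
  apply/funext => n; rewrite horner_coef mulr_sumr.
  rewrite -(big_mkord xpredT (fun i => v j.+1 (B n) * (q`_i * B n ^+ i))).
  rewrite /index_iota subn0; apply: eq_bigr => i _.
  by rewrite mulrCA v_monomial//; apply/JP.
apply: cvg_sum0 => i; have [K K0 hK] := exp_bound (j.+1 + i).
have h : B n ^+ (j.+1 + i) * (B n `^ a * expR (- (1 * B n))) @[n --> \oo] --> 0.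
  apply: (@squeeze_cvgr _ _ _ _ (cst 0) (fun n => K * 4 * n.+2%:R^-1)).
  - near=> n; have B1 : 1 <= B n by rewrite ler1n.
    have B0 : 0 <= B n by [].
    rewrite !mulr_ge0 ?exprn_ge0 ?powR_ge0 ?expR_ge0//=.
    rewrite (@le_trans _ _ (K * expR (- (4^-1 * B n))))//.
      apply: le_trans (hK _ B1); rewrite !ler_wpM2l ?exprn_ge0 ?powR_ge0//.
      by rewrite ler_expR; lra.
    (* e^(B/4) >= B/4 turns the exponential bound into 4 K / B. *)
    rewrite -mulrA ler_wpM2l// expRN -[X in _ <= X * _]invrK -invfM.
    rewrite lef_pV2 ?posrE ?expR_gt0 ?mulr_gt0 ?invr_gt0//.
    by apply: le_trans (expR_ge1Dx _); rewrite lerDr.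
  - exact: cvg_cst.
  - rewrite -[X in _ --> X](mulr0 (K * 4)); apply: cvgM; [exact: cvg_cst|exact: cvg_invS2].
by rewrite -[X in _ --> X](mulr0 q`_i); apply: cvgM => //; exact: cvg_cst.
Unshelve. all: by end_near. Qed.

(** The weights x^(a+j) e^(-x) satisfy a Pearson equation with sigma = X. *)
Let tau j : {poly R} := (a + j.+1%:R)%:P - 'X.

Let dv j (x : T) : J x -> is_derive (x : R) 1 (v j.+1) (v j x * (tau j).[x]).
Proof.
move=> /JP x0; have d1 := is_derive1_powR (a + j.+1%:R) x0.
have d2 : is_derive (x : R) 1 (fun y : R => expR (- y)) (- expR (- x)).
  have := is_derive1_comp (is_derive_expR (- x)) (is_deriveN (is_derive_id (x : R) 1)).
  by rewrite mulrN1.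
have := is_deriveM d1 d2.
rewrite (_ : _ *: _ + _ = v j x * (tau j).[x])//.
transitivity (x `^ (a + j.+1%:R) * - expR (- x) +
   expR (- x) * ((a + j.+1%:R) * x `^ (a + j.+1%:R - 1))) => //.
have -> : a + j.+1%:R - 1 = a + j%:R by rewrite -natr1; lra.
have -> : x `^ (a + j.+1%:R) = x `^ (a + j%:R) * x.
  by rewrite -natr1 addrA (@powRD _ _ (a + j%:R) 1) ?(gt_eqF x0) ?implybT// powRr1 ?ltW.
rewrite (_ : (tau j).[x] = a + j.+1%:R - x); last by rewrite hornerD hornerN hornerC hornerX.
rewrite /v; set P := _ `^ (a + _); set E := expR _; ring.
Qed.

Let cv j (x : T) : J x -> {for (x : R), continuous (v j)}.
Proof.
move=> /JP x0; apply: differentiable_continuous; apply/derivable1_diffP.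
apply: derivableM; first by apply: derivable_powR; rewrite in_itv/= x0.
by apply: ex_derive.
Qed.

Let vS j (x : T) : J x -> v j.+1 x = v j x * ('X : {poly R}).[x].
Proof.
move=> /JP x0; rewrite hornerX /v -natr1 addrA (@powRD _ _ (a + j%:R) 1) ?(gt_eqF x0) ?implybT//.
by rewrite powRr1 ?ltW// mulrAC.
Qed.

Let AB n : A n < B n.
Proof. by rewrite /A /B (@lt_trans _ _ 1) ?ltr1n// invf_lt1 ?ltr1n. Qed.

Let ABJ n : `[A n, B n]%classic `<=` J.
Proof.
move=> x; rewrite /= !in_itv/= andbT => /andP[Ax _].
by apply: lt_le_trans Ax; rewrite invr_gt0.
Qed.

Let exhaust (x : T) : J x -> \forall n \near \oo, A n <= x <= B n.
Proof.
move=> /JP x0; near=> n; apply/andP; split.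
  by near: n; apply: (cvgr_le _ (@cvg_invS2 R)).
rewrite /B (@le_trans _ _ n%:R)//; last by rewrite ler_nat ltnW.
by near: n; exact: nbhs_infty_ger.
Unshelve. all: by end_near. Qed.

Let openJ : open (J : set R). Proof. exact: interval_open. Qed.

Let wNJ_ae : {ae lambda, forall x : T, ~ J x -> w x = 0}.
Proof. by apply: aeW => x; exact: wNJ. Qed.

Let size_tau j : (size (tau j) <= 2)%N.
Proof.
rewrite /tau (leq_trans (size_polyD _ _))// geq_max size_polyN size_polyX andbT.
by rewrite (leq_trans (size_polyC_leq1 _)).
Qed.

Let size_X : (size ('X : {poly R}) <= 3)%N. Proof. by rewrite size_polyX. Qed.

Lemma laguerre_integrable j k :
  lambda.-integrable [set: T] (fun x => ((p j).[x] * (p k).[x] * w x)%:E).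
Proof.
have := integrable_poly_weight (measurable_itv _) v_int mw wJ wNJ_ae (p j * p k).
by under eq_fun do rewrite hornerM.
Qed.

Lemma laguerre_orthonormal j k :
  (\int[lambda]_x ((p j).[x] * (p k).[x] * w x))%R = (j == k)%:R.
Proof.
exact: (normalized_orthonormal (measurable_itv _) openJ AB ABJ exhaust size_X
  size_tau v_gt0 vS dv cv v_int vA vB mw wJ wNJ_ae p_rodrigues p_norm).
Qed.

Let rspan_p (q : {poly R}) : rspan (fun k (x : T) => (p k).[x]) (fun x => q.[x]).
Proof.
exact: (rspan_normalized (measurable_itv _) openJ AB ABJ exhaust size_X
  size_tau v_gt0 vS dv cv v_int vA vB mw wJ wNJ_ae p_rodrigues p_norm).
Qed.

Let F k (x : T) := (p k).[x].

Let mF k : measurable_fun [set: T] (F k). Proof. exact: measurable_horner. Qed.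

(* the partial sums of the series of [expR (- x / 8)] are dominated by
   [expR (x / 8)], whose square is integrable for the weight *)
Let expR_closure m k : msclosure nu F (fun x : T => x ^+ m * expR (- (k%:R * (8^-1 * x)))).
Proof.
(* For all [m] at once, because expanding one more factor e^(-x/8) in its series raises the power of
   x. *)
elim: k m => [|k IH] m.
  rewrite (_ : (fun x => _) = fun x => ('X^m : {poly R}).[x]).
    by apply: msclosure_rspan => //; exact: rspan_p.
  by apply/funext => x; rewrite mul0r oppr0 expR0 mulr1 hornerXn.
have stepE (x : R) : expR (- (k.+1%:R * (8^-1 * x))) =
    expR (- (k%:R * (8^-1 * x))) * expR (- (8^-1 * x)).
  by rewrite -expRD -natr1; congr expR; ring.
apply: (@msclosure_dominated _ _ _ _ nu F mF
  (fun n x => \sum_(j < n) ((- 8^-1) ^+ j / j`!%:R) * (x ^+ (m + j) * expR (- (k%:R * (8^-1 * x)))))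
  _ (fun x => x ^+ m * expR (8^-1 * x))) => //.
- by move=> n; apply: msclosure_sum => // j; apply: msclosureZ.
- apply: measurable_funM; first exact: measurable_funX.
  apply: measurableT_comp => //; apply: measurableT_comp => //.
  by apply: measurable_funM => //; exact: measurable_funM.
- apply: measurable_funM; first exact: measurable_funX.
  by apply: measurableT_comp => //; exact: measurable_funM.
- apply: aeW => x.
  rewrite (_ : (fun n => _) = fun n => x ^+ m * expR (- (k%:R * (8^-1 * x))) *
      \sum_(j < n) (- (8^-1 * x)) ^+ j / j`!%:R).
    have -> : x ^+ m * expR (- (k.+1%:R * (8^-1 * x))) =
        x ^+ m * expR (- (k%:R * (8^-1 * x))) * expR (- (8^-1 * x)).
      by rewrite stepE mulrA.
    exact: (cvgM (cvg_cst _) (cvg_expR_series (x := _))).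
  apply/funext => n; rewrite mulr_sumr; apply: eq_bigr => j _.
  by rewrite -(mulNr 8^-1) exprMn exprD; ring.
- apply: (@ae_density _ _ _ _ 0) => x /wneq0 x0 _ n.
  rewrite (_ : \sum_(j < n) _ = x ^+ m * expR (- (k%:R * (8^-1 * x))) *
      \sum_(j < n) (- (8^-1 * x)) ^+ j / j`!%:R); last first.
    rewrite mulr_sumr; apply: eq_bigr => j _.
    by rewrite -(mulNr 8^-1) exprMn exprD; ring.
  have x8 : 0 <= 8^-1 * x by rewrite mulr_ge0// ltW.
  have xm : 0 <= x ^+ m by rewrite exprn_ge0// ltW.
  rewrite !normrM -[leLHS]mulrA (ger0_norm xm) ler_wpM2l//.
  rewrite ger0_norm ?expR_ge0// -[leRHS]mul1r ler_pM ?expR_ge0//.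
    by rewrite expR_le1 oppr_le0 mulr_ge0.
  by rewrite (le_trans (expR_series_le _ _))// normrN ger0_norm.
- rewrite /sqint ge0_integral_density; last 2 first.
  + apply: measurable_sqr; apply: measurable_funM; first exact: measurable_funX.
    by apply: measurableT_comp => //; exact: measurable_funM.
  + by move=> x; rewrite lee_fin sqr_ge0.
  have mJ : measurable J by exact: measurable_itv.
  (* The squared bound is x^(2m) e^(x/4), and multiplied by e^(-x) it stays below x^(2m)
     e^(-x/2). *)
  have /integrableP[_] := integrableZl mJ C (integrable_half_weight (m + m)).
  rewrite integral_mkcond; apply: le_lt_trans.
  apply: le_integral_pointwise => x _; first by rewrite mule_ge0 ?lee_fin ?sqr_ge0.
  rewrite patchE; case: ifPn => [/set_mem Jx|/negP Jx]; last first.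
    by rewrite wNJ ?mule0// => /mem_set.
  have x0 : 0 < x by exact/JP.
  rewrite wJ// -!EFinM abse_EFin lee_fin ger0_norm; last first.
    by rewrite !mulr_ge0 ?exprn_ge0 ?powR_ge0 ?expR_ge0// ltW.
  rewrite mulrCA ler_wpM2l ?(ltW C_gt0)//.
  rewrite exprMn -exprM muln2 -addnn -mulrA ler_wpM2l ?exprn_ge0 ?(ltW x0)//.
  rewrite /v addr0 mulrCA ler_wpM2l ?powR_ge0// expr2 -!expRD ler_expR; lra.
Qed.

Lemma laguerre_ray_closure (B' : set T) :
  B' = setT \/ (exists c : R, B' = `]c, +oo[%classic) -> msclosure nu F (\1_B').
Proof.
move=> [->|[c ->]].
  rewrite (_ : \1_(_) = fun x => (1%:P : {poly R}).[x]).
    by apply: msclosure_rspan => //; exact: rspan_p.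
  by apply/funext => x; rewrite indicE mem_set// hornerC.
pose ec := expR (- (8^-1 * c)); have ec0 : 0 < ec by exact: expR_gt0.
(* For x > 0 the distance between e^(-x/8) and [ec] is less than 1 + ec, so [y] stays within 1/4 of
   1/2, which is its value at [c]. *)
pose K := 4 * (1 + ec); have K0 : 0 < K by rewrite mulr_gt0// addr_gt0.
pose y (x : T) := 2^-1 + K^-1 * (expR (- (8^-1 * x)) - ec).
have yK (x : T) : K * (y x - 2^-1) = expR (- (8^-1 * x)) - ec.
  by rewrite /y addrC addKr mulVKf// gt_eqF.
have Kdef : K = 4 * (1 + ec) by [].
have wfin := proj1 w_int.
apply: (@msclosure_ray _ _ mw w0 wfin F mF y c) => //.
- apply: measurable_funD => //; apply: measurable_funM => //; apply: measurable_funB => //.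
  apply: measurableT_comp => //; apply: measurableT_comp => //; exact: measurable_funM.
(* A polynomial in [y] is one in e^(-x/8), whose powers are covered by [expR_closure]. *)
- move=> q; pose q' := q \Po ((2^-1 - K^-1 * ec)%:P + K^-1 *: 'X).
  rewrite (_ : (fun x => _) = fun x : T =>
      \sum_(k < size q') q'`_k * (x ^+ 0 * expR (- (k%:R * (8^-1 * x))))).
    by apply: msclosure_sum => // k; apply: msclosureZ => //; exact: expR_closure 0 k.
  apply/funext => x; transitivity q'.[expR (- (8^-1 * x))].
    by rewrite /q' horner_comp; congr horner; rewrite /y !hornerE; ring.
  rewrite horner_coef; apply: eq_bigr => k _.
  by rewrite expr0 mul1r -expRM_natl mulrN.
- move=> x /wneq0 x0; have e0 := expR_gt0 (- (8^-1 * x)).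
  have e1 : expR (- (8^-1 * x)) <= 1 by rewrite expR_le1 oppr_le0 mulr_ge0// ltW.
  by have := yK x; move=> yKx; apply/andP; split; nra.
- move=> x /wneq0 x0 cx.
  have e1 : expR (- (8^-1 * x)) < ec by rewrite ltr_expR; lra.
  by have := yK x; move=> yKx; nra.
- move=> x /wneq0 x0 cx.
  have e1 : ec < expR (- (8^-1 * x)) by rewrite ltr_expR; lra.
  by have := yK x; move=> yKx; nra.
Qed.

Lemma laguerre_weight_lty : (\int[lambda]_x (w x)%:E < +oo)%E.
Proof. by case: w_int. Qed.

End laguerre1.

(** * Jacobi polynomials *)

Section jacobi1.
Context (R : realType).
Local Notation T := (measurableTypeR R).
Local Notation lambda := (@lebesgue_measure R).
Variables (a b : R) (p : nat -> {poly R}).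
Hypotheses (a_gt : -1 < a) (b_gt : -1 < b).
Hypothesis p_jacobi : forall k, normalized_jacobi a b k (p k).
Local Notation w := (jacobi_weight1 a b).
Local Notation J := (`]-1, 1[%classic : set T).
Let v (j : nat) (x : R) : R := (1 - x) `^ (a + j%:R) * (1 + x) `^ (b + j%:R).
Let mw := measurable_jacobi_weight1 a b.
Let w0 := jacobi_weight1_ge0 a b.
Local Notation nu := (density_measure lambda mw w0).

Let JP (x : T) : J x <-> -1 < x < 1.
Proof. by rewrite /= in_itv. Qed.

Let J_gt0 (x : T) : J x -> 0 < 1 - x /\ 0 < 1 + x.
Proof. by move=> /JP/andP[]; split; lra. Qed.

Let mJ : measurable J. Proof. exact: measurable_itv. Qed.

Let wneq0 (x : T) : w x != 0 -> -1 <= x <= 1.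
Proof.
rewrite /jacobi_weight1 indicE; have [/set_mem|] := boolP (x \in _).
  by rewrite /= in_itv.
by rewrite mul0r eqxx.
Qed.

Let wJ (x : T) : J x -> w x = 1 * v 0 x.
Proof.
move=> Jx; rewrite /jacobi_weight1 indicE mem_set ?mul1r /v ?addr0//.
exact: subset_itv_oo_cc.
Qed.

(** Only almost everywhere: at the endpoints the indicator is 1 and 0 to the power 0 is 1, so [w]
    may be nonzero there. *)
Let wNJ : {ae lambda, forall x : T, ~ J x -> w x = 0}.
Proof.
exists [set -1; 1]; split; first exact: measurableU.
  apply: countable_lebesgue_measure0; apply: finite_set_countable.
  by rewrite finite_setU; split; exact: finite_set1.
move=> x /= /not_implyP[nJ wx]; apply: contrapT => /not_orP[x1 x2].
have /andP[h1 h2] : -1 <= x <= 1 by apply: wneq0; exact/eqP.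
by apply: nJ; apply/JP; rewrite !lt_neqAle h1 h2 !andbT; apply/andP; split;
  apply/eqP => // /esym.
Qed.

Let v_gt0 j (x : T) : J x -> 0 < v j x.
Proof. by move=> /J_gt0[h1 h2]; rewrite mulr_gt0 ?powR_gt0. Qed.

Let p_rodrigues k : exists c, forall x : T, J x ->
  (p k).[x] = c * (v 0 x)^-1 * derive1n k (v k) x.
Proof.
have [[c pc] _] := p_jacobi k; exists c => x Jx.
by rewrite pc; [rewrite /v !addr0 invfM !powRN !mulrA|exact/JP].
Qed.

Let p_norm k : (\int[lambda]_x (((p k).[x] ^+ 2 * w x)%:E) = 1)%E.
Proof. by have [] := p_jacobi k. Qed.

(** As for Laguerre, from the norm of [p 0], which is constant on [J]. *)
Lemma jacobi_weight_lty : (\int[lambda]_x (w x)%:E < +oo)%E.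
Proof.
have [c pc] := p_rodrigues 0.
have mpw (f : T -> R) : measurable_fun [set: T] f ->
    measurable_fun [set: T] (fun x => (f x ^+ 2 * w x)%:E).
  move=> mf; apply/measurable_EFinP; apply: measurable_funM => //.
  exact: measurable_funX.
have /ae_eq_integral pw : {ae lambda, forall x : T, setT x ->
    ((p 0).[x] ^+ 2 * w x)%:E = ((cst c x) ^+ 2 * w x)%:E}.
  apply: filterS wNJ => x wx _; have [Jx|/wx ->] := pselect (J x); last by rewrite !mulr0.
  by rewrite pc// derive1n0 -mulrA mulVf ?mulr1// gt_eqF// v_gt0.
have := p_norm 0; rewrite pw//; last 2 first.
- apply: mpw; exact: measurable_horner.
- by apply: mpw; exact: measurable_cst.
under eq_integral do rewrite /= EFinM.
rewrite ge0_integralZl_EFin ?sqr_ge0//; last 2 first.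
- by move=> x _; rewrite lee_fin.
- exact/measurable_EFinP.
move=> h; have c0 : 0 < c ^+ 2.
  rewrite lt_def sqr_ge0 andbT; apply/eqP => c0; move: h; rewrite c0 mul0e => /eqP.
  by rewrite eq_sym onee_eq0.
move: h; case: (\int[lambda]_x _)%E => [r _|h|h]; rewrite ?ltry//.
by move: h; rewrite gt0_muley ?lte_fin.
Qed.

Let v0_int : lambda.-integrable J (fun x => (v 0 x)%:E).
Proof.
have iw : lambda.-integrable J (fun x => (w x)%:E).
  apply: (@integrableS _ _ _ _ setT) => //; apply/integrableP; split.
    exact/measurable_EFinP.
  under eq_integral do rewrite gee0_abs ?lee_fin//.
  exact: jacobi_weight_lty.
apply: eq_integrable iw => //.
by move=> x /set_mem Jx; rewrite wJ// mul1r.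
Qed.

Let horner_bound (q : {poly R}) (x : R) : -1 <= x <= 1 ->
  `|q.[x]| <= \sum_(i < size q) `|q`_i|.
Proof.
move=> x1; rewrite horner_coef; apply: le_trans (ler_norm_sum _ _ _) _.
apply: ler_sum => i _; rewrite normrM -[leRHS]mulr1 ler_wpM2l// normrX.
by rewrite exprn_ile1// ler_norml.
Qed.

Let sigma : {poly R} := 1 - 'X^2.

Let sigmaE (x : R) : sigma.[x] = (1 - x) * (1 + x).
Proof. by rewrite !hornerE; ring. Qed.

Let vS j (x : T) : J x -> v j.+1 x = v j x * sigma.[x].
Proof.
move=> /J_gt0[x1 x2]; rewrite sigmaE /v -natr1 !addrA.
rewrite (@powRD _ _ (a + j%:R) 1) ?(gt_eqF x1) ?implybT//.
rewrite (@powRD _ _ (b + j%:R) 1) ?(gt_eqF x2) ?implybT// !powRr1 ?ltW//.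
ring.
Qed.

(** Factors [sigma] are absorbed into [q], down to index 0, where a polynomial is bounded on
    [-1, 1]. *)
Let v_int j (q : {poly R}) : lambda.-integrable J (fun x => (v j x * q.[x])%:E).
Proof.
elim: j q => [|j IH] q; last first.
  apply: eq_integrable (IH (sigma * q)) => //.
  by move=> x /set_mem Jx; rewrite vS// hornerM mulrA.
pose K := \sum_(i < size q) `|q`_i|.
apply: le_integrable (integrableZl mJ K v0_int) => //.
  apply/measurable_EFinP; apply: measurable_funM.
    by apply/measurable_EFinP; exact: measurable_int v0_int.
  apply: measurable_funTS; exact: measurable_horner.
move=> x Jx; rewrite -EFinM !abse_EFin lee_fin !normrM mulrC ler_wpM2r//.
apply: le_trans (ler_norm _); apply: horner_bound.
by have /JP/andP[] := Jx; lra.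
Qed.

Let A (n : nat) : R := - 1 + n.+2%:R^-1.
Let B (n : nat) : R := 1 - n.+2%:R^-1.

Let invS2 n : 0 < n.+2%:R^-1 :> R /\ n.+2%:R^-1 < 1 :> R.
Proof. by rewrite invr_gt0 invf_lt1 ?ltr1n. Qed.

Let continuous_powR_pos (r x : R) : 0 < x -> {for x, continuous (@powR R ^~ r)}.
Proof.
move=> x0; apply: differentiable_continuous; apply/derivable1_diffP.
by apply: derivable_powR; rewrite in_itv/= x0.
Qed.

(** At either endpoint one factor is the distance 1/(n+2) to a positive power, while the base of the
    other tends to 2. *)
Let cvg_powR_boundary (r s : R) (q : {poly R}) (y : nat -> R) (l : R) : 0 < r ->
  y n @[n --> \oo] --> l ->
  n.+2%:R^-1 `^ r * (2 - n.+2%:R^-1) `^ s * q.[y n] @[n --> \oo] --> 0.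
Proof.
move=> r0 yl.
have h : n.+2%:R^-1 `^ r * (2 - n.+2%:R^-1) `^ s * q.[y n] @[n --> \oo] -->
    0 * (2 - 0) `^ s * q.[l].
  apply: cvgM; last by apply: continuous_cvg => //; exact: continuous_horner.
  apply: cvgM; first exact: cvg_powR_invS2.
  have h2 : 2 - n.+2%:R^-1 @[n --> \oo] --> (2 - 0 : R).
    by apply: cvgB; [exact: cvg_cst|exact: cvg_invS2].
  have c2 : {for (2 - 0 : R), continuous (@powR R ^~ s)}.
    by apply: continuous_powR_pos; rewrite subr0.
  exact: (cvg_comp _ _ h2 c2).
by rewrite !mul0r in h.
Qed.

Let ltr_addS (r : R) j : -1 < r -> 0 < r + j.+1%:R.
Proof. by move=> r1; have j0 : 0 <= j%:R :> R := ler0n _ _; rewrite -natr1; lra. Qed.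

Let vA j (q : {poly R}) : v j.+1 (A n) * q.[A n] @[n --> \oo] --> 0.
Proof.
have yA : A n @[n --> \oo] --> (-1 + 0 : R).
  by apply: cvgD; [exact: cvg_cst|exact: cvg_invS2].
rewrite (_ : (fun n => _) = fun n =>
    n.+2%:R^-1 `^ (b + j.+1%:R) * (2 - n.+2%:R^-1) `^ (a + j.+1%:R) * q.[A n]).
  exact: cvg_powR_boundary (ltr_addS j b_gt) yA.
apply/funext => n; rewrite /v /A.
rewrite (_ : 1 - (-1 + _) = 2 - n.+2%:R^-1); last by ring.
by rewrite addrA subrr add0r; ring.
Qed.

Let vB j (q : {poly R}) : v j.+1 (B n) * q.[B n] @[n --> \oo] --> 0.
Proof.
have yB : B n @[n --> \oo] --> (1 - 0 : R).
  by apply: cvgB; [exact: cvg_cst|exact: cvg_invS2].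
rewrite (_ : (fun n => _) = fun n =>
    n.+2%:R^-1 `^ (a + j.+1%:R) * (2 - n.+2%:R^-1) `^ (b + j.+1%:R) * q.[B n]).
  exact: cvg_powR_boundary (ltr_addS j a_gt) yB.
apply/funext => n; rewrite /v /B.
rewrite (_ : 1 + (1 - _) = 2 - n.+2%:R^-1); last by ring.
by rewrite (_ : 1 - (1 - _) = n.+2%:R^-1)//; ring.
Qed.

(** The expansion of (b+j+1)(1-x) - (a+j+1)(1+x): a Pearson equation with sigma = 1 - X^2. *)
Let tau j : {poly R} := (b - a)%:P - (a + b + j.+1%:R *+ 2) *: 'X.

Let dv j (x : T) : J x -> is_derive (x : R) 1 (v j.+1) (v j x * (tau j).[x]).
Proof.
move=> /J_gt0[x1 x2].
have d1 : is_derive (x : R) 1 (fun y : R => (1 - y) `^ (a + j.+1%:R))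
    ((a + j.+1%:R) * (1 - x) `^ (a + j.+1%:R - 1) * (0 - 1)).
  have d0 : is_derive (x : R) 1 (fun y : R => 1 - y) (0 - 1).
    exact: (is_deriveB (is_derive_cst (1 : R) (x : R) 1) (is_derive_id (x : R) 1)).
  exact: (@is_derive1_comp _ _ (fun y : R => 1 - y) _ _ _
    (is_derive1_powR (a + j.+1%:R) x1) d0).
have d2 : is_derive (x : R) 1 (fun y : R => (1 + y) `^ (b + j.+1%:R))
    ((b + j.+1%:R) * (1 + x) `^ (b + j.+1%:R - 1) * (0 + 1)).
  have d0 : is_derive (x : R) 1 (fun y : R => 1 + y) (0 + 1).
    exact: (is_deriveD (is_derive_cst (1 : R) (x : R) 1) (is_derive_id (x : R) 1)).
  exact: (@is_derive1_comp _ _ (fun y : R => 1 + y) _ _ _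
    (is_derive1_powR (b + j.+1%:R) x2) d0).
have := is_deriveM d1 d2.
rewrite (_ : _ *: _ + _ = v j x * (tau j).[x])//.
transitivity ((1 - x) `^ (a + j.+1%:R) * ((b + j.+1%:R) * (1 + x) `^ (b + j.+1%:R - 1) * (0 + 1)) +
   (1 + x) `^ (b + j.+1%:R) * ((a + j.+1%:R) * (1 - x) `^ (a + j.+1%:R - 1) * (0 - 1))) => //.
have -> : a + j.+1%:R - 1 = a + j%:R by rewrite -natr1; lra.
have -> : b + j.+1%:R - 1 = b + j%:R by rewrite -natr1; lra.
have -> : (1 - x) `^ (a + j.+1%:R) = (1 - x) `^ (a + j%:R) * (1 - x).
  by rewrite -natr1 addrA (@powRD _ _ (a + j%:R) 1) ?(gt_eqF x1) ?implybT// powRr1 ?ltW.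
have -> : (1 + x) `^ (b + j.+1%:R) = (1 + x) `^ (b + j%:R) * (1 + x).
  by rewrite -natr1 addrA (@powRD _ _ (b + j%:R) 1) ?(gt_eqF x2) ?implybT// powRr1 ?ltW.
rewrite (_ : (tau j).[x] = b - a - (a + b + j.+1%:R *+ 2) * x); last first.
  by rewrite hornerD hornerN hornerC hornerZ hornerX.
rewrite /v; set P := _ `^ (a + _); set Q := _ `^ (b + _); ring.
Qed.

Let cv j (x : T) : J x -> {for (x : R), continuous (v j)}.
Proof.
move=> /J_gt0[x1 x2]; apply: cvgM.
- apply: (@continuous_cvg _ _ _ _ _ (fun y : R => 1 - y) (@powR R ^~ _)).
    exact: continuous_powR_pos.
  by apply: cvgB; [exact: cvg_cst|exact: cvg_id].
- apply: (@continuous_cvg _ _ _ _ _ (fun y : R => 1 + y) (@powR R ^~ _)).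
    exact: continuous_powR_pos.
  by apply: cvgD; [exact: cvg_cst|exact: cvg_id].
Qed.

Let AB n : A n < B n.
Proof.
by have [h0 h1] := invS2 n; rewrite /A /B; move: (n.+2%:R^-1) h0 h1 => h h0 h1; lra.
Qed.

Let ABJ n : `[A n, B n]%classic `<=` J.
Proof.
have [h0 h1] := invS2 n; move=> x; rewrite /= !in_itv/= /A /B.
by move: (n.+2%:R^-1) h0 h1 => h h0 h1 /andP[h2 h3]; apply/andP; split; lra.
Qed.

Let exhaust (x : T) : J x -> \forall n \near \oo, A n <= x <= B n.
Proof.
move=> /J_gt0[x1 x2]; near=> n.
have h1 : n.+2%:R^-1 <= 1 - x :> R by near: n; apply: (cvgr_le _ (@cvg_invS2 R)).
have h2 : n.+2%:R^-1 <= 1 + x :> R by near: n; apply: (cvgr_le _ (@cvg_invS2 R)).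
by rewrite /A /B; move: (n.+2%:R^-1) h1 h2 => h h1 h2; apply/andP; split; lra.
Unshelve. all: by end_near. Qed.

Let openJ : open (J : set R). Proof. exact: interval_open. Qed.

Let size_tau j : (size (tau j) <= 2)%N.
Proof.
rewrite /tau (leq_trans (size_polyD _ _))// geq_max size_polyN.
rewrite (leq_trans (size_polyC_leq1 _))//=.
by rewrite (leq_trans (size_scale_leq _ _))// size_polyX.
Qed.

Let size_sigma : (size sigma <= 3)%N.
Proof.
by rewrite (leq_trans (size_polyD _ _))// geq_max size_poly1 size_polyN size_polyXn.
Qed.

Lemma jacobi_integrable j k :
  lambda.-integrable [set: T] (fun x => ((p j).[x] * (p k).[x] * w x)%:E).
Proof.
have := integrable_poly_weight mJ v_int mw wJ wNJ (p j * p k).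
by under eq_fun do rewrite hornerM.
Qed.

Lemma jacobi_orthonormal j k :
  (\int[lambda]_x ((p j).[x] * (p k).[x] * w x))%R = (j == k)%:R.
Proof.
exact: (normalized_orthonormal mJ openJ AB ABJ exhaust size_sigma
  size_tau v_gt0 vS dv cv v_int vA vB mw wJ wNJ p_rodrigues p_norm).
Qed.

Let rspan_p (q : {poly R}) : rspan (fun k (x : T) => (p k).[x]) (fun x => q.[x]).
Proof.
exact: (rspan_normalized mJ openJ AB ABJ exhaust size_sigma
  size_tau v_gt0 vS dv cv v_int vA vB mw wJ wNJ p_rodrigues p_norm).
Qed.

Lemma jacobi_ray_closure (B' : set T) :
  B' = setT \/ (exists c : R, B' = `]c, +oo[%classic) ->
  msclosure nu (fun k (x : T) => (p k).[x]) (\1_B').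
Proof.
have mp k : measurable_fun [set: T] (fun x => (p k).[x]) by exact: measurable_horner.
move=> [->|[c ->]].
  rewrite (_ : \1_(_) = fun x => (1%:P : {poly R}).[x]).
    by apply: msclosure_rspan => //; exact: rspan_p.
  by apply/funext => x; rewrite indicE mem_set// hornerC.
(* On [-1, 1] the distance |x - c| is at most 1 + |c|, so the affine [r] stays within 1/4 of 1/2,
   which is its value at [c]. *)
pose K := 4 * (1 + `|c|); have K0 : 0 < K by rewrite mulr_gt0// ltr_wpDr.
pose r : {poly R} := (2^-1 + K^-1 * c)%:P - K^-1 *: 'X.
have rK (x : R) : K * (2^-1 - r.[x]) = x - c.
  rewrite hornerD hornerN hornerC hornerZ hornerX.
  rewrite (_ : 2^-1 - _ = K^-1 * (x - c)); last by ring.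
  by rewrite mulVKf// gt_eqF.
have c0 : 0 <= `|c| by [].
have cc : - `|c| <= c <= `|c| by rewrite -ler_norml.
have Kdef : K = 4 * (1 + `|c|) by [].
apply: (@msclosure_ray _ _ mw w0 jacobi_weight_lty _ mp (fun x => r.[x]) c) => //.
- exact: measurable_horner.
- move=> q; rewrite (_ : (fun x => _) = fun x => (q \Po r).[x]).
    by apply: msclosure_rspan => //; exact: rspan_p.
  by apply/funext => x; rewrite horner_comp.
- by move=> x /wneq0 x1; have := rK x => rKx; apply/andP; split; nra.
- by move=> x _ cx; have := rK x => rKx; nra.
- by move=> x _ cx; have := rK x => rKx; nra.
Qed.

End jacobi1.

(** * The Jacobi spectrum *)

Lemma seq_min (R : realDomainType) (s : seq R) (x : R) : x \in s ->
  exists2 m, m \in s & forall r, r \in s -> m <= r.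
Proof.
elim: s x => // y s IH x _; case: s IH => [_|z s IH].
  by exists y => [|r]; [exact: mem_head|rewrite mem_seq1 => /eqP ->].
have [m ms mmin] := IH z (mem_head _ _).
have [ym|my] := leP y m.
- exists y; first exact: mem_head.
  by move=> r; rewrite in_cons => /predU1P[->//|/mmin]; exact: le_trans.
- exists m; first by rewrite in_cons ms orbT.
  by move=> r; rewrite in_cons => /predU1P[->|/mmin//]; exact: ltW.
Qed.

(** * Increasing enumeration of a discrete unbounded set *)

Section enumeration.
Context (R : realType) (S : set R) (rate : nat -> R).
Hypotheses (S_ge0 : forall r, S r -> 0 <= r) (S0 : S 0).
Hypothesis S_finite : forall M, finite_set [set r | S r /\ r <= M].
Hypothesis S_unbounded : forall M, exists2 r, S r & M < r.
Hypothesis rate0 : rate 0 = 0.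
Hypothesis rateS : forall n, rate n.+1 = inf [set r | S r /\ rate n < r].

(** Up to some [r0] in [S] beyond [x] there are only finitely many candidates, so the infimum is a
    minimum. *)
Lemma inf_above x : let m := inf [set r | S r /\ x < r] in
  [/\ S m, x < m & forall r, S r -> x < r -> m <= r].
Proof.
move=> m; have [r0 Sr0 xr0] := S_unbounded x.
have [s sE] : exists s : seq R, [set r | S r /\ r <= r0] `&` [set r | x < r] = [set` s].
  by apply/finite_seqP; apply: finite_setIl; exact: S_finite.
have sP r : r \in s <-> (S r /\ r <= r0) /\ x < r.
  by have /= <- := congr1 (fun A : set R => A r) sE.
have [y /sP[[Sy yr0] xy] ymin] : exists2 y, y \in s & forall r, r \in s -> y <= r.
  by apply: (@seq_min _ _ r0); apply/sP.
have ylb r : S r -> x < r -> y <= r.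
  move=> Sr xr; have [rr0|/ltW r0r] := leP r r0; first by apply: ymin; apply/sP.
  exact: le_trans r0r.
suff -> : m = y by [].
apply/eqP; rewrite eq_le; apply/andP; split.
- by apply: ge_inf => //; exists y => r [] *; exact: ylb.
- by apply: lb_le_inf; [exists y|move=> r []; exact: ylb].
Qed.

Lemma rate_in n : S (rate n).
Proof. by case: n => [|n]; rewrite ?rate0// rateS; have [] := inf_above (rate n). Qed.

Lemma rate_lt m n : (m < n)%N -> rate m < rate n.
Proof.
have step k : rate k < rate k.+1 by rewrite rateS; have [] := inf_above (rate k).
elim: n => // n IH; rewrite ltnS leq_eqVlt => /predU1P[->//|/IH mn].
exact: lt_trans (step n).
Qed.

Lemma rate_inj m n : rate m = rate n -> m = n.
Proof.
by move=> mn; case: (ltngtP m n) => // /rate_lt; rewrite mn ltxx.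
Qed.

(** A missed [r] would stay above every [rate n], giving infinitely many elements of [S] up to
    [r]. *)
Lemma rate_surj r : S r -> exists n, r = rate n.
Proof.
move=> Sr; apply: contrapT => nr.
have lt_r n : rate n < r.
  rewrite lt_neqAle; apply/andP; split; first by apply/eqP => rn; apply: nr; exists n.
  elim: n => [|n IH]; first by rewrite rate0 S_ge0.
  rewrite rateS; have [_ _] := inf_above (rate n); apply => //.
  by rewrite lt_neqAle IH andbT; apply/eqP => rn; apply: nr; exists n.
have [s sE] : exists s : seq R, [set x | S x /\ x <= r] = [set` s].
  by apply/finite_seqP; exact: S_finite.
have us : uniq [seq rate i | i <- iota 0 (size s).+1].
  by rewrite map_inj_uniq ?iota_uniq//; exact: rate_inj.
have /(uniq_leq_size us) : {subset [seq rate i | i <- iota 0 (size s).+1] <= s}.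
  move=> _ /mapP[n _ ->]; have /= <- := congr1 (fun A : set R => A (rate n)) sE.
  by split; [exact: rate_in|exact: ltW].
by rewrite size_map size_iota ltnn.
Qed.

End enumeration.

Section jacobi_spectrum.
Context (R : realType) (d : nat) (alpha beta : d.-tuple R).
Hypotheses (d0 : (0 < d)%N) (alpha_gt : forall i, -1 < tnth alpha i)
  (beta_gt : forall i, -1 < tnth beta i).
Local Notation eigenvalue := (jacobi_eigenvalue alpha beta).

(** Since alpha_i, beta_i > -1, the second factor exceeds k - 1, so for k >= 1 the term is at least
    k (k - 1) >= k - 1. This growth makes the sets of bounded eigenvalues finite. *)
Let term_ge (k : nat) i : 0 <= k%:R * (k%:R + tnth alpha i + tnth beta i + 1) :> R /\
  k%:R - 1 <= k%:R * (k%:R + tnth alpha i + tnth beta i + 1) :> R.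
Proof.
have a1 := alpha_gt i; have b1 := beta_gt i; case: k => [|k]; first by rewrite !mul0r; lra.
have k0 : 0 <= k%:R :> R := ler0n _ _; rewrite -natr1; split; nra.
Qed.

Lemma jacobi_eigenvalue_ge0 kappa : 0 <= eigenvalue kappa.
Proof. by apply: sumr_ge0 => i _; have [] := term_ge (tnth kappa i) i. Qed.

Lemma jacobi_eigenvalue_ge kappa i : (tnth kappa i)%:R - 1 <= eigenvalue kappa.
Proof.
rewrite /jacobi_eigenvalue (bigD1 i)//=; have [_ h] := term_ge (tnth kappa i) i.
apply: (le_trans h); rewrite lerDl sumr_ge0// => j _.
by have [] := term_ge (tnth kappa j) j.
Qed.

Lemma finite_jacobi_eigenvalue M : finite_set [set kappa | eigenvalue kappa <= M].
Proof.
(* An entry k satisfies k - 1 <= M, hence k < truncn |M| + 2. *)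
apply: sub_finite_set (finite_multi_index_box d (Num.truncn `|M|).+2) => kappa /= kM i.
have h := le_trans (jacobi_eigenvalue_ge kappa i) kM.
have := truncnS_gt `|M|; have := ler_norm M => M1 M2.
by rewrite -(ler_nat R) -natr1; lra.
Qed.

Let eigenvalue0 : range eigenvalue 0.
Proof.
exists [tuple 0%N | i < d] => //; rewrite /jacobi_eigenvalue big1// => i _.
by rewrite tnth_mktuple mul0r.
Qed.

Let range_ge0 r : range eigenvalue r -> 0 <= r.
Proof. by move=> [kappa _ <-]; exact: jacobi_eigenvalue_ge0. Qed.

Let range_finite M : finite_set [set r | range eigenvalue r /\ r <= M].
Proof.
apply: sub_finite_set (finite_image eigenvalue (finite_jacobi_eigenvalue M)).
by move=> r [[kappa _ <-] kM]; exists kappa.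
Qed.

Let range_unbounded M : exists2 r, range eigenvalue r & M < r.
Proof.
pose kappa : d.-tuple nat := [tuple (Num.truncn `|M|).+2 | i < d].
exists (eigenvalue kappa); first by exists kappa.
have := jacobi_eigenvalue_ge kappa (Ordinal d0); rewrite tnth_mktuple -natr1.
by have := truncnS_gt `|M|; have := ler_norm M; lra.
Qed.

Lemma jacobi_rate_ge0 n : 0 <= jacobi_rate alpha beta n.
Proof.
by apply: range_ge0; apply: (rate_in eigenvalue0 range_finite range_unbounded).
Qed.

Lemma jacobi_index_set_finite n : finite_set (jacobi_index_set alpha beta n).
Proof.
apply: sub_finite_set (finite_jacobi_eigenvalue (jacobi_rate alpha beta n)).
by move=> kappa /= ->.
Qed.

Lemma jacobi_index_set_disj n k kappa : jacobi_index_set alpha beta n kappa ->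
  jacobi_index_set alpha beta k kappa -> n = k.
Proof.
move=> /= h; rewrite /jacobi_index_set/= h.
by apply: (rate_inj range_finite range_unbounded).
Qed.

Lemma jacobi_index_set_cover kappa : exists n, jacobi_index_set alpha beta n kappa.
Proof.
apply: (rate_surj range_ge0 eigenvalue0 range_finite range_unbounded) => //.
Qed.

End jacobi_spectrum.

Theorem theorem3p1 (R : realType) (d : nat) (d_ge1 : (1 <= d)%N)
    (t1 : R) (t1_gt0 : 0 < t1) :
  (forall (alpha : d.-tuple R) (l : 'I_d -> nat -> {poly R})
      (b : d.-tuple (measurableTypeR R) -> R[i]),
    (forall i, -1 < tnth alpha i) ->
    (forall i k, normalized_laguerre (tnth alpha i) k (l i k)) ->
    L2 (laguerre_measure alpha) b ->
    (forall nu : d.-tuple nat,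
      L2inner (laguerre_measure alpha) b (product_poly l nu) != 0) ->
    approximately_controllable (laguerre_measure alpha)
      (laguerre_semigroup alpha l) (laguerre_control alpha l b) t1 /\
    ~ exactly_controllable (laguerre_measure alpha)
      (laguerre_semigroup alpha l) (laguerre_control alpha l b) t1) /\
  (forall (alpha beta : d.-tuple R) (p : 'I_d -> nat -> {poly R})
      (b : d.-tuple (measurableTypeR R) -> R[i]),
    (forall i, -1 < tnth alpha i) ->
    (forall i, -1 < tnth beta i) ->
    (forall i k, normalized_jacobi (tnth alpha i) (tnth beta i) k (p i k)) ->
    L2 (jacobi_measure alpha beta) b ->
    (forall nu : d.-tuple nat,
      L2inner (jacobi_measure alpha beta) b (product_poly p nu) != 0) ->
    approximately_controllable (jacobi_measure alpha beta)
      (jacobi_semigroup alpha beta p) (jacobi_control alpha beta p b) t1 /\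
    ~ exactly_controllable (jacobi_measure alpha beta)
      (jacobi_semigroup alpha beta p) (jacobi_control alpha beta p b) t1).
Proof.
split.
- move=> alpha l b alpha_gt l_laguerre Lb b_neq0.
  (* The measure, semigroup and control operator are instances of the general ones by definition;
     what is left concerns one variable and the blocks of indices. *)
  apply: (@product_poly_controllability R d (fun i => laguerre_weight1 (tnth alpha i))
    (fun i => measurable_laguerre_weight1 _) (fun i => laguerre_weight1_ge0 _)
    (measurable_laguerre_weight alpha) (laguerre_weight_ge0 alpha) l) => //.
  + by move=> i j k; exact: laguerre_integrable.
  + by move=> i j k; exact: laguerre_orthonormal.
  + by move=> i B; exact: laguerre_ray_closure.
  + by move=> i; exact: laguerre_weight_lty (l_laguerre i).
  + exact: finite_degree_set.
  + exact: degree_set_disj.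
  + by move=> nu; exists (multi_index_degree nu).
- move=> alpha beta p b alpha_gt beta_gt p_jacobi Lb b_neq0.
  apply: (@product_poly_controllability R d
    (fun i => jacobi_weight1 (tnth alpha i) (tnth beta i))
    (fun i => measurable_jacobi_weight1 _ _) (fun i => jacobi_weight1_ge0 _ _)
    (measurable_jacobi_weight alpha beta) (jacobi_weight_ge0 alpha beta) p) => //.
  + by move=> i j k; exact: jacobi_integrable.
  + by move=> i j k; exact: jacobi_orthonormal.
  + by move=> i B; exact: jacobi_ray_closure.
  + by move=> i; exact: jacobi_weight_lty (p_jacobi i).
  + exact: jacobi_index_set_finite.
  + exact: jacobi_index_set_disj.
  + exact: jacobi_index_set_cover.
  + exact: jacobi_rate_ge0.
Qed.
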